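(* Let $p(x)=\sum_{m=0}^d a_m x^m$ be a degree $d$ polynomial. Then there exists a Gaussian process $\mathcal{G}$ on $\mathbb{S}^{n-1}$ such that $$\mathcal{WF}_\infty^2(\mathcal{P}_kp,\mathcal{G})\le C_d\,\max_{m}\{|a_m|^2\}\left(\frac{n^{5d-\frac12}}{k}\right)^{\frac13},$$ where $C_d\le d^{Cd}$ for some numerical constant $C>0$.
   Context: Let $n>1$ be the dimension and let $\mathbb{S}^{n-1}$ be the unit sphere of $\mathbb{R}^n$. For a function $\sigma:\mathbb{R}\to\mathbb{R}$ and a positive integer $k$ (the width), $\mathcal{P}_k\sigma$ denotes the random process on $\mathbb{S}^{n-1}$ given by $$\mathcal{P}_k\sigma(x)=\frac{1}{\sqrt{k}}\sum_{i=1}^k s_i\,\sigma(w_i\cdot x),$$ where $w_1,\dots,w_k$ are i.i.d. standard Gaussian vectors in $\mathbb{R}^n$ and $s_1,\dots,s_k$ are i.i.d. with $\mathbb{P}(s_i=1)=\mathbb{P}(s_i=-1)=\frac12$, independent of the $w_i$. The polynomial $p$ has real coefficients; the constant $C_d$ depends only on $d$. A Gaussian process on $\mathbb{S}^{n-1}$ is a random element $\mathcal{G}$ of $L^2(\mathbb{S}^{n-1})$ such that for every finite set $\{x_j\}_{j=1}^m\subset\mathbb{S}^{n-1}$ the vector $(\mathcal{G}(x_j))_{j=1}^m$ has a multivariate Gaussian law. For random processes $\mathcal{P},\mathcal{P}'$ on $\mathbb{S}^{n-1}$, $$\mathcal{WF}_\infty(\mathcal{P},\mathcal{P}')=\inf\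 \mathbb{E}\Big[\sup_{x\in\mathbb{S}^{n-1}}|\mathcal{P}(x)-\mathcal{P}'(x)|\Big],$$ where the infimum is over all couplings of $(\mathcal{P},\mathcal{P}')$, and $\mathcal{WF}_\infty^2$ denotes its square.
   Formalization: The degree d is required to be at least 1: for d = 0 and k = 1 the process is a random sign times a_0, at a fixed positive distance from every Gaussian process, while the claimed bound tends to 0 as n grows. *)

(* Defs.v *)
From HB Require Import structures.
From mathcomp Require Import all_boot all_order all_algebra.
From mathcomp Require Import all_classical all_reals all_analysis.
From mathcomp Require Import measurable_realfun.

Set Implicit Arguments.
Unset Strict Implicit.
Unset Printing Implicit Defensive.
Import Order.TTheory GRing.Theory Num.Theory.
Import numFieldNormedType.Exports.
Local Open Scope classical_set_scope.
Local Open Scope ring_scope.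

(* R^n is [n.-tuple R], on which the library puts the product sigma-algebra. *)

Section euclidean.
Context {R : realType}.

Definition dot n (x y : n.-tuple R) : R := \sum_(i < n) tnth x i * tnth y i.

Definition enorm n (x : n.-tuple R) : R := Num.sqrt (dot x x).

Definition sphere n : set (n.-tuple R) := [set x | enorm x = 1].

(* [normalize x] is the null vector when x is. *)
Definition normalize n (x : n.-tuple R) : n.-tuple R :=
  [tuple tnth x i / enorm x | i < n].

Definition affine r m (M : 'M[R]_(m, r)) (b : m.-tuple R) (z : r.-tuple R) :
    m.-tuple R :=
  [tuple tnth b i + \sum_(j < r) M i j * tnth z j | i < m].

End euclidean.
Arguments sphere {R} n.

Section standard_gaussian.
Context {R : realType}.

Definition tcons n (xy : measurableTypeR R * n.-tuple R) : n.+1.-tuple R :=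
  [tuple of xy.1 :: xy.2].

Lemma measurable_tcons n : measurable_fun [set: measurableTypeR R * n.-tuple R] (@tcons n).
Proof. exact: measurable_cons. Qed.

Section step.
Variables (n : nat) (mu : probability (measurableTypeR R) R) (nu : probability (n.-tuple R) R).

Definition cons_law : set (n.+1.-tuple R) -> \bar R :=
  fun A => (mu \x nu)%E (@tcons n @^-1` A).

Let cons_law0 : cons_law set0 = 0%E.
Proof. by rewrite /cons_law preimage_set0 measure0. Qed.

Let cons_law_ge0 A : (0 <= cons_law A)%E.
Proof. exact: measure_ge0. Qed.

Let cons_law_sigma_additive : semi_sigma_additive cons_law.
Proof.
exact: (@measure_semi_sigma_additive _ _ _
  (pushforward (mu \x nu)%E (mfun_Sub (mem_set (@measurable_tcons n))))).
Qed.

HB.instance Definition _ := isMeasure.Build _ _ _ cons_law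
  cons_law0 cons_law_ge0 cons_law_sigma_additive.

Let cons_lawT : cons_law setT = 1%E.
Proof.
rewrite /cons_law preimage_setT -setXTT product_measure1E//.
by rewrite -[RHS]mule1; congr (_ * _)%E; exact: probability_setT.
Qed.

HB.instance Definition _ := Measure_isProbability.Build _ _ _ cons_law cons_lawT.

End step.

(* The n-fold product of N(0, 1). *)
Fixpoint std_gauss n : probability (n.-tuple R) R :=
  match n return probability (n.-tuple R) R with
  | 0 => \d_[tuple]
  | m.+1 => cons_law (normal_prob (0 : R) 1) (std_gauss m)
  end.

Lemma measurable_enorm n : measurable_fun [set: n.-tuple R] (@enorm R n).
Proof.
have -> : @enorm R n = fun x => dot x x `^ 2^-1.
  apply/funext => x; rewrite powR12_sqrt//.
  by apply: sumr_ge0 => i _; exact: sqr_ge0.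
apply: (measurableT_comp (measurable_powR _)).
by apply: measurable_sum => i; apply: measurable_funM; exact: measurable_tnth.
Qed.

Lemma measurable_normalize n :
  measurable_fun [set: n.-tuple R] (@normalize R n).
Proof.
apply/measurable_fun_tnthP => i.
rewrite (_ : _ \o _ = fun x => tnth x i * (enorm x)^-1); last first.
  by apply/funext => x /=; rewrite tnth_mktuple.
apply: measurable_funM; first exact: measurable_tnth.
have -> : (fun x : n.-tuple R => (enorm x)^-1) = fun x => enorm x `^ (-1).
  apply/funext => x; rewrite powR_inv1 //; exact: sqrtr_ge0.
apply: (measurableT_comp (measurable_powR _)); exact: measurable_enorm.
Qed.

HB.instance Definition _ n := isMeasurableFun.Build _ _ _ _ (@normalize R n)
  (@measurable_normalize n).

(* The normalized surface measure on the unit sphere: the law of Z / |Z| for a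
   standard Gaussian vector Z; as a measure on R^n it is carried by the sphere. *)
Definition sphere_measure n : probability (n.-tuple R) R :=
  distribution (std_gauss n) (@normalize R n).

End standard_gaussian.

Section processes.
Context {R : realType}.

(* Sample paths are functions on R^n, but everything below only depends on their
   values on the sphere. *)
Definition sample_path n : Type := n.-tuple R -> R.
HB.instance Definition _ n := Pointed.on (sample_path n).

Definition L2 n : set (sample_path n) := [set f : sample_path n |
  measurable_fun (sphere n) (f : n.-tuple R -> R) /\
  (\int[sphere_measure n]_(x in sphere n) ((f x) ^+ 2)%:E < +oo)%E].
Arguments L2 n _ : clear implicits.

Definition L2_open n (U : set (sample_path n)) := U `<=` L2 n /\
  forall f, U f -> exists2 r : R, 0 < r & forall g, L2 n g ->
    (\int[sphere_measure n]_(x in sphere n) ((f x - g x) ^+ 2)%:E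
       < (r ^+ 2)%:E)%E -> U g.

(* Generators: the open sets of L^2(S^{n-1}) and the evaluations at points of the
   sphere. *)
Definition path_gen n : set (set (sample_path n)) :=
  [set U : set (sample_path n) | L2_open U] `|`
  [set A : set (sample_path n) | exists2 x, sphere n x &
             exists2 B : set R, measurable B & A = [set f : sample_path n | B (f x)]].

Definition path_space n := g_sigma_algebraType (@path_gen n).

Section one_space.
Context d (T : measurableType d) (P : probability T R).

(* A random element of L^2(S^{n-1}) whose values at points are random variables. *)
Definition random_process n (X : T -> sample_path n) :=
  (forall t, L2 n (X t)) /\ measurable_fun [set: T] (X : T -> path_space n).

Definition gaussian_vector m (Y : T -> m.-tuple R) :=
  exists r (M : 'M[R]_(m, r)) (b : m.-tuple R),
    forall B : set (m.-tuple R), measurable B ->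
      P (Y @^-1` B) = std_gauss r (affine M b @^-1` B).

Definition gaussian_process n (X : T -> sample_path n) :=
  random_process X /\
  forall m (x : m.-tuple (n.-tuple R)), (forall j, sphere n (tnth x j)) ->
    gaussian_vector (fun t => [tuple X t (tnth x j) | j < m]).

Definition sup_dist n (f g : sample_path n) : \bar R :=
  ereal_sup [set `|f x - g x|%:E | x in sphere n].

(* Mutual independence of a finite family of sigma-algebras. *)
Definition mutual_indep (I : finType) (F : I -> set (set T)) :=
  forall (J : {set I}) (A : I -> set T), (forall i, i \in J -> F i (A i)) ->
    P (\bigcap_(i in [set` J]) A i) = (\prod_(i in J) fine (P (A i)))%:E.

Definition std_gaussian n (w : T -> n.-tuple R) :=
  measurable_fun [set: T] w /\
  forall B, measurable B -> P (w @^-1` B) = std_gauss n B.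

Definition rademacher (s : T -> R) :=
  [/\ measurable_fun [set: T] s, P [set t | s t = 1] = (2^-1)%:E
    & P [set t | s t = -1] = (2^-1)%:E].

Definition network_weights n k (w : 'I_k -> T -> n.-tuple R)
    (s : 'I_k -> T -> R) :=
  [/\ forall i, std_gaussian (w i), forall i, rademacher (s i) &
      mutual_indep (fun i : 'I_k + 'I_k =>
        match i with
        | inl a => g_sigma_algebra_preimage (w a)
        | inr b => g_sigma_algebra_preimage (s b)
        end)].

Definition network n k (w : 'I_k -> T -> n.-tuple R) (s : 'I_k -> T -> R)
    (sigma : R -> R) : T -> sample_path n :=
  fun t x => (Num.sqrt k%:R)^-1 * \sum_(i < k) s i t * sigma (dot (w i t) x).

End one_space.

Definition same_law n d (T : measurableType d) (P : probability T R)
    (X : T -> sample_path n) d' (T' : measurableType d') (P' : probability T' R)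
    (X' : T' -> sample_path n) :=
  forall A : set (path_space n), measurable A -> P (X @^-1` A) = P' (X' @^-1` A).

(* Over an uncountable index set the supremum need not be measurable; couplings
   for which it is not have no expected distance and are left out. *)
Definition WF_infty n d (T : measurableType d) (P : probability T R)
    (X : T -> sample_path n) d' (T' : measurableType d') (P' : probability T' R)
    (X' : T' -> sample_path n) : \bar R :=
  ereal_inf [set e | exists d0 (T0 : measurableType d0) (P0 : probability T0 R)
      (Y Y' : T0 -> sample_path n),
    [/\ random_process Y /\ random_process Y', same_law P0 Y P X,
        same_law P0 Y' P' X',
        measurable_fun [set: T0] (fun t => sup_dist (Y t) (Y' t))
      & e = (\int[P0]_t sup_dist (Y t) (Y' t))%E]].

End processes.

(* Main.v *)
(* The feature map phi sending w to its monomials of degree at most d turns the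
   network into the linear functional x |-> <S, psi(x)> of S = k^(-1/2) sum s_i
   phi(w_i), and a Gaussian vector G gives the Gaussian process <G, psi>, so it
   suffices to couple S with G.

   Truncate phi and add noise ep Z with Z standard Gaussian. By Cameron-Martin
   S/ep + Z has an explicit density with respect to Z, and so does the vector
   obtained when the summands are replaced by Gaussian ones with the same
   covariance. Replacing them one at a time, the symmetry of the summands kills
   the odd moments and the second moments cancel, so each replacement costs, in
   L^2 of the Gaussian, only O(E<X, X'>^4)^(1/2), with X' an independent copy of
   X. The resulting L^1 bound on the difference of the densities, weighted by
   |z|, is turned into a coupling by accepting S/ep + Z with probability min(1,
   g / f) and otherwise drawing from the normalised excess (g - f)^+. Balancing
   the noise ep E|Z|, the truncation and the replacement costs gives the rate.
  
   For d = 1 the constant d^(Cd) is 1. There the linear part k^(-1/2) sum s_i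
   w_i is exactly Gaussian and independent of the signs, so only the scalar sum
   k^(-1/2) sum s_i has to be coupled. *)

Require Import Defs.
From HB Require Import structures.
From mathcomp Require Import all_boot all_order all_algebra.
From mathcomp Require Import all_classical all_reals all_analysis.
From mathcomp Require Import measurable_realfun.
From mathcomp Require Import ring lra.

Set Implicit Arguments.
Unset Strict Implicit.
Unset Printing Implicit Defensive.
Import Order.TTheory GRing.Theory Num.Theory.
Import numFieldNormedType.Exports.
Local Open Scope classical_set_scope.
Local Open Scope ring_scope.

Global Opaque integral.

(** * Laws, convolutions and linear algebra of tuples *)

(** A smoothed law has as density an average of kernels exp(<y,z> - |y|^2/2), and two kernels have
    inner product exp<x,y> in L^2 of the Gaussian. So the squared distance of two densities is E
    exp<X,X'> + E exp<Y,Y'> - 2 E exp<X,Y>. For X symmetric and Y Gaussian with the same covariance,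
    each expectation is 1 + E<X,X'>^2 / 2 up to fourth order. Controlling the exponentials this
    sharply is the reason for truncating at |X|^2 <= 1/2.

    Features are indexed by words, not multi-indices: <phi(w), phi(x)> is then a plain sum of powers
    of w.x, |psi| on the sphere is bounded without n, and E<phi,phi'>^4 is of order n^(2d), although
    E|phi|^8 is of order n^(4d). With B^2 the target rate, the noise level is B / n^(d/2). For d > 1
    the balance has room to spare: the exponent -1/2 is handled by sqrt n <= n^d alone.

    The coupling lives on a larger space that projects onto the given one. In degree one the
    rejection step must also keep its output independent of the Gaussian linear part. *)

Lemma measurable_preimageT d d' (T : measurableType d) (E : measurableType d')
    (f : T -> E) (B : set E) :
  measurable_fun [set: T] f -> measurable B -> measurable (f @^-1` B).
Proof. by move=> mf mB; rewrite -[X in measurable X]setTI; exact: mf. Qed.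

Section law.
Context {R : realType} d d' (T : measurableType d) (E : measurableType d').

Definition law (P : probability T R) (X : T -> E)
    (mX : measurable_fun [set: T] X) : probability E R :=
  distribution P (mfun_Sub (mem_set mX)).

Lemma lawE (P : probability T R) X mX A : @law P X mX A = P (X @^-1` A).
Proof. by []. Qed.

Lemma ge0_integral_law (P : probability T R) X mX (u : E -> \bar R) :
  measurable_fun [set: E] u -> (forall x, (0 <= u x)%E) ->
  (\int[@law P X mX]_y u y = \int[P]_x u (X x))%E.
Proof. by move=> mu u0; rewrite ge0_integral_distribution. Qed.

End law.
Global Opaque law.

Section tonelli.
Context {R : realType} d1 d2 (T1 : measurableType d1) (T2 : measurableType d2).
Variables (P1 : probability T1 R) (P2 : probability T2 R) (u : T1 -> T2 -> \bar R).
Hypothesis mu : measurable_fun [set: T1 * T2] (fun z => u z.1 z.2).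
Hypothesis u0 : forall x y, (0 <= u x y)%E.

Lemma tonelli_prod :
  (\int[(P1 \x P2)%E]_z u z.1 z.2 = \int[P1]_x \int[P2]_y u x y)%E.
Proof. by rewrite (@fubini_tonelli1 _ _ _ _ _ P1 P2 _ mu). Qed.

Lemma tonelli_swap :
  (\int[P1]_x \int[P2]_y u x y = \int[P2]_y \int[P1]_x u x y)%E.
Proof. exact: (@fubini_tonelli _ _ _ _ _ P1 P2 _ mu). Qed.

Lemma measurable_integral2 : measurable_fun [set: T1] (fun x => \int[P2]_y u x y)%E.
Proof. exact: (@measurable_fun_fubini_tonelli_F _ _ _ _ _ P2 _ mu). Qed.

Lemma measurable_integral1 : measurable_fun [set: T2] (fun y => \int[P1]_x u x y)%E.
Proof. exact: (@measurable_fun_fubini_tonelli_G _ _ _ _ _ P1 _ mu). Qed.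

End tonelli.

Section density.
Local Open Scope ereal_scope.
Context {R : realType} d (T : measurableType d).
Variables (mu m : {measure set T -> \bar R}) (h : T -> R).
Hypotheses (mh : measurable_fun [set: T] h) (h0 : forall x, (0 <= h x)%R).
Hypothesis mE : forall A, measurable A -> m A = \int[mu]_(x in A) (h x)%:E.

Import HBNNSimple.

(** True for indicators by [mE], for simple functions by linearity, and in general by monotone
    convergence along [nnsfun_approx]. It serves the normal density as well as the excess law of the
    rejection step. *)
Lemma ge0_integral_density (u : T -> \bar R) :
  measurable_fun [set: T] u -> (forall x, 0 <= u x) ->
  \int[m]_x u x = \int[mu]_x (u x * (h x)%:E).
Proof.
move=> mu_ u0.
pose u_ := nnsfun_approx measurableT mu_.
have mhE : measurable_fun [set: T] (EFin \o h) by exact/measurable_EFinP.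
have nn (f : {nnsfun T >-> R}) :
    \int[m]_x (f x)%:E = \int[mu]_x ((f x)%:E * (h x)%:E).
  under eq_integral do rewrite fimfunE -fsumEFin//.
  rewrite ge0_integral_fsum//; last 2 first.
    - by move=> r; apply/measurable_EFinP; exact: measurable_funM.
    - by move=> n x _; rewrite EFinM nnfun_muleindic_ge0.
  under [RHS]eq_integral.
    move=> x xD; rewrite fimfunE -fsumEFin// ge0_mule_fsuml; last first.
      by move=> r; rewrite EFinM nnfun_muleindic_ge0.
    over.
  rewrite [RHS]ge0_integral_fsum//; last 2 first.
    - move=> r; apply: emeasurable_funM => //; apply/measurable_EFinP.
      exact: measurable_funM.
    - by move=> n x _; rewrite EFinM mule_ge0// ?nnfun_muleindic_ge0// lee_fin.
  apply: eq_fsbigr => r _.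
  have mI : measurable (f @^-1` [set r]) by [].
  under eq_integral do rewrite EFinM.
  rewrite integralZl_indic_nnsfun// integral_indic// setIT mE//.
  (* A negative [r] is not a value of [f], so its level set is empty and both sides vanish. This
     leaves [0 <= r], where the constant can be pulled out. *)
  have [r0|r0] := leP 0%R r; last first.
    have E0 : f @^-1` [set r] = set0.
      apply/seteqP; split => // x /= fxr; have : (0 <= f x)%R by exact: fun_ge0.
      by rewrite fxr leNgt r0.
    rewrite E0 integral_set0 mule0 [RHS]integral0_eq// => x _.
    by rewrite indic0 mulr0 mul0e.
  under [RHS]eq_integral do rewrite EFinM -muleA.
  rewrite ge0_integralZl//; last 2 first.
  - by apply: emeasurable_funM => //; exact/measurable_EFinP.
  - by move=> x _; rewrite mule_ge0// lee_fin.
  congr (_ * _); rewrite integral_mkcond; apply: eq_integral => x _.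
  by rewrite patchE indicE; case: ifPn => _; rewrite ?mul1e ?mul0e.
transitivity (limn (fun n => \int[m]_x (u_ n x)%:E)).
  rewrite -monotone_convergence//=.
  - apply: eq_integral => ? /[!inE] xD; apply/esym/cvg_lim => //=.
    exact: cvg_nnsfun_approx.
  - by move=> n; exact/measurable_EFinP.
  - by move=> n ? _; rewrite lee_fin.
  - by move=> ? _ ? ? mn; rewrite lee_fin; exact/lefP/nd_nnsfun_approx.
transitivity (limn (fun n => \int[mu]_x ((u_ n x)%:E * (h x)%:E))).
  by congr (limn _); apply/funext => n; exact: nn.
rewrite -monotone_convergence//=.
- apply: eq_integral => x _; apply/cvg_lim => //.
  apply: cvgeZr => //; exact: cvg_nnsfun_approx.
- by move=> n; apply: emeasurable_funM => //; exact/measurable_EFinP.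
- by move=> n x _; rewrite mule_ge0// lee_fin.
- move=> x _ a b ab; rewrite lee_wpmul2r ?lee_fin//.
  exact/lefP/nd_nnsfun_approx.
Qed.

End density.

Section independent_pair.
Context {R : realType} d (T : measurableType d) d1 d2
  (E1 : measurableType d1) (E2 : measurableType d2).

(** Rectangles determine the product measure. *)
Lemma law_pair (P : probability T R) (X : T -> E1) (Y : T -> E2)
  (mX : measurable_fun [set: T] X) (mY : measurable_fun [set: T] Y)
  (mXY : measurable_fun [set: T] (fun t => (X t, Y t)))
  (P1 : probability E1 R) (P2 : probability E2 R) :
  (forall A B, measurable A -> measurable B ->
     P (X @^-1` A `&` Y @^-1` B) = (P1 A * P2 B)%E) ->
  forall C, measurable C -> P [set t | C (X t, Y t)] = (P1 \x P2)%E C.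
Proof.
by move=> H C mC; rewrite (@product_measure_unique _ _ _ _ _ P1 P2 (law P mXY)).
Qed.

End independent_pair.

Section tuples.
Context {R : realType}.
Implicit Types n : nat.

Definition tadd n (x y : n.-tuple R) : n.-tuple R :=
  [tuple tnth x i + tnth y i | i < n].

Definition tscale n (a : R) (x : n.-tuple R) : n.-tuple R :=
  [tuple a * tnth x i | i < n].

Definition tzero n : n.-tuple R := [tuple 0 | i < n].

Lemma tnth_tadd n (x y : n.-tuple R) i : tnth (tadd x y) i = tnth x i + tnth y i.
Proof. exact: tnth_mktuple. Qed.

Lemma tnth_tscale n a (x : n.-tuple R) i : tnth (tscale a x) i = a * tnth x i.
Proof. exact: tnth_mktuple. Qed.

Lemma tnth_tzero n i : tnth (tzero n) i = 0.
Proof. exact: tnth_mktuple. Qed.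

Definition tE := (tnth_tadd, tnth_tscale, tnth_tzero).

Lemma taddC n : commutative (@tadd n).
Proof. by move=> x y; apply: eq_from_tnth => i; rewrite !tE addrC. Qed.

Lemma taddA n : associative (@tadd n).
Proof. by move=> x y z; apply: eq_from_tnth => i; rewrite !tE addrA. Qed.

Lemma tscaleA n a b (x : n.-tuple R) : tscale a (tscale b x) = tscale (a * b) x.
Proof. by apply: eq_from_tnth => i; rewrite !tE mulrA. Qed.

Lemma tscale1 n (x : n.-tuple R) : tscale 1 x = x.
Proof. by apply: eq_from_tnth => i; rewrite !tE mul1r. Qed.

Lemma dotC n (x y : n.-tuple R) : dot x y = dot y x.
Proof. by apply: eq_bigr => i _; rewrite mulrC. Qed.

Lemma dotDr n (x y z : n.-tuple R) : dot x (tadd y z) = dot x y + dot x z.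
Proof. by rewrite -big_split; apply: eq_bigr => i _ /=; rewrite tE mulrDr. Qed.

Lemma dotDl n (x y z : n.-tuple R) : dot (tadd y z) x = dot y x + dot z x.
Proof. by rewrite !(dotC _ x) dotDr. Qed.

Lemma dotZr n a (x y : n.-tuple R) : dot x (tscale a y) = a * dot x y.
Proof. by rewrite mulr_sumr; apply: eq_bigr => i _; rewrite tE mulrCA. Qed.

Lemma dotZl n a (x y : n.-tuple R) : dot (tscale a x) y = a * dot x y.
Proof. by rewrite dotC dotZr dotC. Qed.

Lemma dot0r n (x : n.-tuple R) : dot x (tzero n) = 0.
Proof. by rewrite /dot big1// => i _; rewrite tE mulr0. Qed.

Lemma dot_ge0 n (x : n.-tuple R) : 0 <= dot x x.
Proof. by apply: sumr_ge0 => i _; exact: sqr_ge0. Qed.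

Lemma dotNN n (x : n.-tuple R) : dot (tscale (-1) x) (tscale (-1) x) = dot x x.
Proof. by rewrite dotZl dotZr mulrA mulrNN mulr1 mul1r. Qed.

Lemma dot_cons n (x y : R) (xs ys : n.-tuple R) :
  dot (tcons (x, xs)) (tcons (y, ys)) = x * y + dot xs ys.
Proof.
rewrite /dot big_ord_recl; congr (_ + _); apply: eq_bigr => i _.
by rewrite /= !tnthS.
Qed.

Lemma tadd_cons n (x y : R) (xs ys : n.-tuple R) :
  tadd (tcons (x, xs)) (tcons (y, ys)) = tcons (x + y, tadd xs ys).
Proof.
apply: eq_from_tnth => i; rewrite tE; case: (unliftP ord0 i) => [j ->|->] //=.
by rewrite !tnthS tE.
Qed.

Lemma tscale_cons n a (x : R) (xs : n.-tuple R) :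
  tscale a (tcons (x, xs)) = tcons (a * x, tscale a xs).
Proof.
apply: eq_from_tnth => i; rewrite tE; case: (unliftP ord0 i) => [j ->|->] //=.
by rewrite !tnthS tE.
Qed.

Lemma tconsP n (x : n.+1.-tuple R) : exists y ys, x = tcons (y, ys).
Proof. by case/tupleP: x => y ys; exists y, ys; exact: val_inj. Qed.

Lemma normsqD n (x y : n.-tuple R) :
  dot (tadd x y) (tadd x y) = dot x x + 2 * dot x y + dot y y.
Proof. by rewrite dotDr !dotDl (dotC y x); ring. Qed.

Lemma enorm_ge0 n (x : n.-tuple R) : 0 <= enorm x.
Proof. exact: sqrtr_ge0. Qed.

Lemma enorm_sqr n (x : n.-tuple R) : enorm x ^+ 2 = dot x x.
Proof. by rewrite sqr_sqrtr// dot_ge0. Qed.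

Lemma cauchy_schwarz n (x y : n.-tuple R) : dot x y ^+ 2 <= dot x x * dot y y.
Proof.
have [y0|y0] := eqVneq (dot y y) 0.
  have yi i : tnth y i = 0.
    apply/eqP; rewrite -sqrf_eq0 expr2.
    have /eqP := y0; rewrite psumr_eq0; last by move=> j _; exact: sqr_ge0.
    by move/allP => /(_ i); rewrite mem_index_enum => /(_ isT).
  rewrite y0 mulr0 (_ : dot x y = 0) ?expr0n//.
  by rewrite /dot big1// => i _; rewrite yi mulr0.
have yp : 0 < dot y y by rewrite lt_neqAle eq_sym y0 dot_ge0.
(* The component of [x] orthogonal to [y], scaled by |y|^2 so that nothing is divided. *)
have := dot_ge0 (tadd (tscale (dot y y) x) (tscale (- dot x y) y)).
rewrite normsqD !(dotZl, dotZr) => H.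
have : 0 <= dot y y * (dot x x * dot y y - dot x y ^+ 2).
  by apply: le_trans H _; rewrite le_eqVlt; apply/orP; left; apply/eqP; ring.
by rewrite pmulr_rge0// subr_ge0.
Qed.

Lemma dot_le_enorm n (x y : n.-tuple R) : `|dot x y| <= enorm x * enorm y.
Proof.
rewrite -(@ler_pXn2r _ 2)// ?nnegrE ?mulr_ge0 ?enorm_ge0//.
by rewrite real_normK ?num_real// exprMn !enorm_sqr cauchy_schwarz.
Qed.

Lemma ler_enormD n (x y : n.-tuple R) : enorm (tadd x y) <= enorm x + enorm y.
Proof.
rewrite -(@ler_pXn2r _ 2)// ?nnegrE ?addr_ge0 ?enorm_ge0//.
rewrite enorm_sqr normsqD sqrrD !enorm_sqr.
have := ler_norm (dot x y); have := dot_le_enorm x y; lra.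
Qed.

Lemma enormZ n a (x : n.-tuple R) : enorm (tscale a x) = `|a| * enorm x.
Proof. by rewrite /enorm dotZl dotZr mulrA -expr2 sqrtrM ?sqr_ge0// sqrtr_sqr. Qed.

End tuples.

Section measurable_tuples.
Context {R : realType} d (T : measurableType d).
Implicit Types n : nat.

Lemma measurable_tadd n (f g : T -> n.-tuple R) : measurable_fun [set: T] f ->
  measurable_fun [set: T] g -> measurable_fun [set: T] (fun t => tadd (f t) (g t)).
Proof.
move=> /measurable_fun_tnthP mf /measurable_fun_tnthP mg.
apply/measurable_fun_tnthP => i.
rewrite (_ : _ \o _ = fun t => tnth (f t) i + tnth (g t) i).
  by apply: measurable_funD; [exact: mf|exact: mg].
by apply/funext => t /=; rewrite tE.
Qed.

Lemma measurable_tscale n (a : T -> R) (f : T -> n.-tuple R) :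
  measurable_fun [set: T] a -> measurable_fun [set: T] f ->
  measurable_fun [set: T] (fun t => tscale (a t) (f t)).
Proof.
move=> ma /measurable_fun_tnthP mf.
apply/measurable_fun_tnthP => i.
rewrite (_ : _ \o _ = fun t => a t * tnth (f t) i).
  by apply: measurable_funM => //; exact: mf.
by apply/funext => t /=; rewrite tE.
Qed.

Lemma measurable_dot n (f g : T -> n.-tuple R) : measurable_fun [set: T] f ->
  measurable_fun [set: T] g -> measurable_fun [set: T] (fun t => dot (f t) (g t)).
Proof.
move=> /measurable_fun_tnthP mf /measurable_fun_tnthP mg.
apply: measurable_sum => i.
by apply: measurable_funM; [exact: mf|exact: mg].
Qed.

Lemma measurable_enorm_comp n (f : T -> n.-tuple R) : measurable_fun [set: T] f ->
  measurable_fun [set: T] (fun t => enorm (f t)).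
Proof. by move=> mf; apply: measurableT_comp mf; exact: measurable_enorm. Qed.

End measurable_tuples.

Section convol.
Context {R : realType} (n : nat).
Local Notation E := (n.-tuple R).
Implicit Types mu nu pi : probability E R.

Lemma measurable_tadd2 : measurable_fun [set: E * E] (fun z => tadd z.1 z.2).
Proof. exact: measurable_tadd. Qed.

Definition convol mu nu : probability E R := law (mu \x nu)%E measurable_tadd2.

Section integral.
Variable u : E -> \bar R.
Hypotheses (mu_ : measurable_fun [set: E] u) (u0 : forall x, (0 <= u x)%E).

Lemma measurable_shift2 : measurable_fun [set: E * E] (fun z => u (tadd z.1 z.2)).
Proof. exact: measurableT_comp (mu_) measurable_tadd2. Qed.

Lemma measurable_shift x : measurable_fun [set: E] (fun y => u (tadd x y)).
Proof. by apply: (measurableT_comp mu_); exact: measurable_tadd. Qed.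

Lemma measurable_integral_shift nu :
  measurable_fun [set: E] (fun x => \int[nu]_y u (tadd x y))%E.
Proof. exact: measurable_integral2 measurable_shift2 _. Qed.

Lemma ge0_integral_convol mu nu :
  (\int[convol mu nu]_x u x = \int[mu]_x \int[nu]_y u (tadd x y))%E.
Proof.
rewrite [LHS]ge0_integral_law//.
exact: (tonelli_prod mu nu measurable_shift2).
Qed.

End integral.

(** Convolutions and densities are compared through integrals of non-negative functions; this
    returns from there to measures. *)
Lemma eq_meas_integral mu nu :
  (forall u : E -> \bar R, measurable_fun [set: E] u -> (forall x, (0 <= u x)%E) ->
     (\int[mu]_x u x = \int[nu]_x u x)%E) ->
  forall A, measurable A -> mu A = nu A.
Proof.
move=> H A mA.
have := H (EFin \o \1_A); rewrite !integral_indic// !setIT; apply.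
- exact/measurable_EFinP/measurable_indic.
- by move=> x; rewrite lee_fin.
Qed.
End convol.
Global Opaque convol.

Section cpow.
Context {R : realType} (n : nat).
Local Notation E := (n.-tuple R).
Implicit Types mu nu pi : probability E R.

(** The convolution power carries an initial law [pi], which collects the summands already replaced
    in the telescoping of [wdist_cpow]. *)
Definition cpow pi mu k := iter k (fun p => convol p mu) pi.

Lemma convolAC_integral pi mu nu (u : E -> \bar R) :
  measurable_fun [set: E] u -> (forall x, (0 <= u x)%E) ->
  (\int[convol (convol pi mu) nu]_x u x = \int[convol (convol pi nu) mu]_x u x)%E.
Proof.
move=> mu_ u0.
have c0 (rho : probability E R) x : (0 <= \int[rho]_y u (tadd x y))%E.
  exact: integral_ge0.
have mi rho := measurable_integral_shift mu_ u0 rho.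
rewrite (ge0_integral_convol mu_ u0 (convol pi mu) nu) (ge0_integral_convol mu_ u0 (convol pi nu) mu).
rewrite (ge0_integral_convol (mi nu) (c0 nu) pi mu) (ge0_integral_convol (mi mu) (c0 mu) pi nu).
apply: eq_integral => x _.
have m3 : measurable_fun [set: E * E] (fun z => u (tadd (tadd x z.1) z.2)).
  by apply: (measurableT_comp mu_); do 2 apply: measurable_tadd => //.
apply: (etrans (@tonelli_swap _ _ _ _ _ mu nu (fun y z => u (tadd (tadd x y) z)) m3 (fun y z => u0 _))).
apply: eq_integral => y _; apply: eq_integral => z _ /=.
by rewrite -!taddA (taddC z).
Qed.

(** Commutativity of convolution: a summand added last can be moved into the initial law. This is
    what makes the replacement of all summands an induction on [k]. *)
Lemma cpow_convol_integral pi mu nu k (u : E -> \bar R) :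
  measurable_fun [set: E] u -> (forall x, (0 <= u x)%E) ->
  (\int[convol (cpow pi mu k) nu]_x u x = \int[cpow (convol pi nu) mu k]_x u x)%E.
Proof.
elim: k u => [//|k IH] u mu_ u0 /=.
rewrite convolAC_integral// (ge0_integral_convol mu_ u0 (convol _ _)).
rewrite IH; [|exact: measurable_integral_shift|by move=> x; exact: integral_ge0].
by rewrite (ge0_integral_convol mu_ u0 (cpow _ _ _)).
Qed.

End cpow.

(** * Gaussian vectors *)

Section gauss1.
Context {R : realType}.
Notation leb := (@lebesgue_measure R).
Notation N01 := (normal_prob (0 : R) 1).

Lemma lebesgue_measure_shift (a : R) (A : set R) : measurable A ->
  pushforward leb (fun x => x + a : measurableTypeR R) A = leb A.
Proof.
move=> mA; apply/esym.
have ms : measurable_fun [set: measurableTypeR R] (fun x => x + a : measurableTypeR R).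
  exact: measurable_funD.
pose m := pushforward leb
  (@mfun_Sub _ _ (measurableTypeR R) (measurableTypeR R) _ (mem_set ms)).
apply: (@lebesgue_measure_unique R m) => // _ [[b c]] _ <-.
transitivity (leb `]b - a, c - a]%classic); last first.
  congr (leb _); apply/seteqP; split => x /=;
    by rewrite !in_itv/= => /andP[? ?]; apply/andP; split; lra.
rewrite !lebesgue_measure_itv/= !lte_fin ltrD2r; case: ifPn => // _.
by rewrite -!EFinB; congr (_%:E); ring.
Qed.

Lemma integral_lebesgue_shift (a : R) (u : R -> \bar R) :
  measurable_fun [set: R] u -> (forall x, (0 <= u x)%E) ->
  (\int[leb]_x u (x + a)%R = \int[leb]_x u x)%E.
Proof.
move=> mu u0.
have ms : measurable_fun [set: measurableTypeR R] (fun x => x + a : measurableTypeR R).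
  exact: measurable_funD.
have H := @ge0_integral_pushforward _ _ _ _ R _ ms leb [set: R] u measurableT mu
  (fun y _ => u0 y).
apply: etrans (etrans (esym H) _).
  by rewrite preimage_setT.
by apply: eq_measure_integral => A mA _; exact: lebesgue_measure_shift.
Qed.

Lemma integral_N01 (u : R -> \bar R) :
  measurable_fun [set: R] u -> (forall x, (0 <= u x)%E) ->
  (\int[N01]_x u x = \int[leb]_x (u x * (normal_pdf 0 1 x)%:E))%E.
Proof.
move=> mu u0.
have H := @ge0_integral_density R _ _ leb N01 (normal_pdf 0 1)
  (measurable_normal_pdf 0 1) (normal_pdf_ge0 0 1) (fun A _ => erefl) u mu u0.
exact: H.
Qed.

Lemma normal_pdf01E (x : R) :
  normal_pdf 0 1 x = normal_peak 1 * expR (- x ^+ 2 / 2).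
Proof. by rewrite normal_pdfE ?oner_neq0// /normal_fun subr0 expr1n. Qed.

Lemma measurable_normal_pdfE (m s : R) :
  measurable_fun [set: R] (fun x => (normal_pdf m s x)%:E).
Proof. by apply/measurable_EFinP; exact: measurable_normal_pdf. Qed.

(** Translate Lebesgue measure by [- y] and expand the square in the Gaussian exponent. *)
Lemma N01_shift (y : R) (u : R -> \bar R) :
  measurable_fun [set: R] u -> (forall x, (0 <= u x)%E) ->
  (\int[N01]_x u (y + x)%R =
   \int[N01]_x (u x * (expR (y * x - y ^+ 2 / 2))%:E))%E.
Proof.
move=> mu u0.
have ms : measurable_fun [set: R] (fun x => u (y + x)).
  by apply: (measurableT_comp mu); exact: measurable_funD.
have me : measurable_fun [set: R] (fun x : R => (expR (y * x - y ^+ 2 / 2))%:E).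
  apply/measurable_EFinP; apply: measurableT_comp => //.
  by apply: measurable_funB => //; exact: measurable_funM.
rewrite (integral_N01 ms (fun x => u0 _)).
rewrite integral_N01; last 2 first.
- exact: emeasurable_funM.
- by move=> x; rewrite mule_ge0// lee_fin expR_ge0.
rewrite -(@integral_lebesgue_shift (- y)); last 2 first.
- by apply: emeasurable_funM => //; exact: measurable_normal_pdfE.
- by move=> x; rewrite mule_ge0// lee_fin normal_pdf_ge0.
apply: eq_integral => x _; rewrite -muleA -EFinM; congr (u _ * _%:E)%E.
  by rewrite addrC subrK.
by rewrite !normal_pdf01E mulrCA -expRD; congr (_ * expR _); lra.
Qed.

Lemma N01_opp (u : R -> \bar R) :
  measurable_fun [set: R] u -> (forall x, (0 <= u x)%E) ->
  (\int[N01]_x u (- x)%R = \int[N01]_x u x)%E.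
Proof.
move=> mu u0.
have ms : measurable_fun [set: R] (fun x => u (- x)).
  by apply: (measurableT_comp mu).
rewrite (integral_N01 ms (fun x => u0 _)) (integral_N01 mu u0).
have mo : measurable_fun [set: measurableTypeR R] (-%R : R -> measurableTypeR R).
  exact: measurable_funN.
pose v x := (u x * (normal_pdf 0 1 x)%:E)%E.
have mv : measurable_fun [set: R] v.
  by apply: emeasurable_funM => //; exact: measurable_normal_pdfE.
have v0 x : (0 <= v x)%E by rewrite mule_ge0// lee_fin normal_pdf_ge0.
have H := @ge0_integral_pushforward _ _ _ _ R _ mo leb [set: R] v measurableT mv
  (fun y _ => v0 y).
apply: etrans (etrans (esym H) _); rewrite ?preimage_setT.
  by apply: eq_integral => x _; rewrite /v/= !normal_pdf01E sqrrN.
by apply: eq_measure_integral => A mA _; exact: lebesgue_measureN.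
Qed.

Lemma N01_expR_sqr (l : R) : l < 1 ->
  (\int[N01]_x (expR (l * x ^+ 2 / 2))%:E = ((Num.sqrt (1 - l))^-1)%:E)%E.
Proof.
move=> l1; have l1' : 0 < 1 - l by rewrite subr_gt0.
have me : measurable_fun [set: R] (fun x : R => (expR (l * x ^+ 2 / 2))%:E).
  apply/measurable_EFinP; apply: measurableT_comp => //.
  by do 2 apply: measurable_funM => //; exact: measurable_funX.
rewrite integral_N01; [|exact: me|by move=> x; rewrite lee_fin expR_ge0].
(* The standard deviation of the tilted Gaussian: exp(l x^2/2) times the N(0,1) density is [s] times
   the N(0,s^2) density. *)
pose s := (Num.sqrt (1 - l))^-1.
have s0 : 0 < s by rewrite invr_gt0 sqrtr_gt0.
have s2 : s ^+ 2 = (1 - l)^-1 by rewrite exprVn sqr_sqrtr// ltW.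
transitivity (\int[leb]_x (s%:E * (normal_pdf 0 s x)%:E))%E.
  apply: eq_integral => x _; rewrite -!EFinM; congr (_%:E).
  rewrite normal_pdf01E normal_pdfE ?gt_eqF//.
  have pk : s * normal_peak s = normal_peak 1.
    rewrite /normal_peak expr1n mul1r -mulrnAr sqrtrM ?sqr_ge0//.
    by rewrite sqrtr_sqr ger0_norm ?ltW// invfM mulrA divff ?mul1r// gt_eqF.
  rewrite /normal_fun subr0 [RHS]mulrA pk mulrCA -expRD s2.
  by congr (_ * expR _); field; lra.
rewrite ge0_integralZl//; last 3 first.
- exact: measurable_normal_pdfE.
- by move=> x _; rewrite lee_fin normal_pdf_ge0.
- by rewrite lee_fin ltW.
by rewrite integral_normal_pdf mule1.
Qed.

End gauss1.

Section ereal_tools.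
Local Open Scope ereal_scope.
Context {R : realType} d (T : measurableType d) (P : probability T R).

Lemma integral_prob_cste (c : \bar R) : \int[P]_x c = c.
Proof.
rewrite integral_cst// -[RHS]mule1; congr (_ * _); exact: probability_setT.
Qed.

Lemma integral_prob_cst (c : R) : \int[P]_x c%:E = c%:E.
Proof. exact: integral_prob_cste. Qed.

Lemma prob_indic (A : set T) : measurable A -> P A = \int[P]_x (\1_A x)%:E.
Proof. by move=> mA; rewrite integral_indic// setIT. Qed.

Lemma ge0_le_integralT (f g : T -> \bar R) :
  measurable_fun [set: T] f -> measurable_fun [set: T] g ->
  (forall x, 0 <= f x) -> (forall x, f x <= g x) ->
  \int[P]_x f x <= \int[P]_x g x.
Proof. by move=> mf mg f0 fg; apply: ge0_le_integral => // x _. Qed.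

Lemma ge0_integralDT (f g : T -> \bar R) :
  measurable_fun [set: T] f -> measurable_fun [set: T] g ->
  (forall x, 0 <= f x) -> (forall x, 0 <= g x) ->
  \int[P]_x (f x + g x) = \int[P]_x f x + \int[P]_x g x.
Proof. by move=> mf mg f0 g0; rewrite ge0_integralD. Qed.

Lemma ge0_integralZlT (k : R) (f : T -> \bar R) : (0 <= k)%R ->
  measurable_fun [set: T] f -> (forall x, 0 <= f x) ->
  \int[P]_x (k%:E * f x) = k%:E * \int[P]_x f x.
Proof. by move=> k0 mf f0; rewrite ge0_integralZl_EFin. Qed.

Lemma ge0_integralZrT (k : R) (f : T -> \bar R) : (0 <= k)%R ->
  measurable_fun [set: T] f -> (forall x, 0 <= f x) ->
  \int[P]_x (f x * k%:E) = (\int[P]_x f x) * k%:E.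
Proof. by move=> k0 mf f0; rewrite ge0_integralZr// lee_fin. Qed.

End ereal_tools.

Section real_tools.
Context {R : realType}.

Lemma expR_le_inv (v : R) : v < 1 -> expR v <= (1 - v)^-1.
Proof.
move=> v1; rewrite -[v in expR v]opprK expRN lef_pV2 ?posrE ?expR_gt0 ?subr_gt0//.
exact: expR_ge1Dx.
Qed.

(** The first-order coefficient 1/2 is the exact Taylor coefficient. It yields the sharp variance in
    [std_gauss_dot_sqr] and the cancellation of second moments in [chi2_bound]; only the quadratic
    term is lossy. *)
Lemma inv_sqrt_ub (q : R) : 0 <= q -> q <= 4^-1 ->
  (Num.sqrt (1 - q))^-1 <= 1 + q / 2 + q ^+ 2 / 2.
Proof.
move=> q0 q4; have s0 : 0 < 1 - q by lra.
have p0 : 0 < 1 + q / 2 + q ^+ 2 / 2 by nra.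
rewrite -[leRHS]invrK lef_pV2 ?posrE ?invr_gt0 ?sqrtr_gt0//.
rewrite -(@ler_pXn2r _ 2) ?nnegrE ?invr_ge0 ?sqrtr_ge0 ?(ltW p0)//.
rewrite (sqr_sqrtr (ltW s0)) exprVn -[leLHS]div1r ler_pdivrMr ?exprn_gt0//.
(* The remaining factor 1 - 3q - q^2 - q^3 is positive up to q = 1/4. *)
have -> : (1 - q) * (1 + q / 2 + q ^+ 2 / 2) ^+ 2 =
  1 + q ^+ 2 * ((1 - 3 * q - q ^+ 2 - q ^+ 3) / 4) by field.
rewrite lerDl mulr_ge0 ?sqr_ge0//.
have q2 : q ^+ 2 <= q / 4 by rewrite expr2 ler_wpM2l.
have q3 : q ^+ 3 <= q / 16.
  by rewrite exprS; have : q * q ^+ 2 <= q * (q / 4) by [rewrite ler_wpM2l]; nra.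
lra.
Qed.

Lemma le_of_forall_eps (a b c e0 : R) : 0 < e0 ->
  (forall e, 0 < e -> e < e0 -> a <= b + c * e) -> a <= b.
Proof.
move=> e00 H; rewrite leNgt; apply/negP => ba.
pose e := Num.min (e0 / 2) ((a - b) / (2 * (`|c| + 1))).
have c1 : 0 < `|c| + 1 by rewrite ltr_wpDl.
have e_gt0 : 0 < e.
  by rewrite lt_min !divr_gt0//= ?mulr_gt0// subr_gt0.
have ee0 : e < e0 by rewrite gt_min; apply/orP; left; lra.
have := H _ e_gt0 ee0.
have : e * (2 * (`|c| + 1)) <= a - b.
  by rewrite -ler_pdivlMr ?mulr_gt0// ge_min lexx orbT.
have := ler_norm c; nra.
Qed.

End real_tools.

Section gauss.
Context {R : realType}.
Notation N01 := (normal_prob (0 : R) 1).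
Notation sg := (@std_gauss R).

Lemma measurable_tconsx n (x : R) : measurable_fun [set: n.-tuple R] (fun xs => tcons (x, xs)).
Proof.
have := @measurable_tcons R n.
by move=> H; apply: (measurableT_comp H); exact: measurable_fun_pair.
Qed.

Section rec.
Local Open Scope ereal_scope.
Variables (n : nat) (u : n.+1.-tuple R -> \bar R).
Hypotheses (mu : measurable_fun [set: n.+1.-tuple R] u) (u0 : forall x, 0 <= u x).

Lemma measurable_tcons_comp :
  measurable_fun [set: measurableTypeR R * n.-tuple R] (fun z => u (tcons (z.1, z.2))).
Proof.
have H := @measurable_tcons R n.
rewrite (_ : (fun _ => _) = u \o @tcons R n); first exact: (measurableT_comp mu H).
by apply/funext => -[].
Qed.

Lemma integral_std_gaussS :
  \int[sg n.+1]_x u x = \int[N01]_x \int[sg n]_xs u (tcons (x, xs)).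
Proof.
transitivity (\int[law (N01 \x sg n) (@measurable_tcons R n)]_x u x).
  have E A : sg n.+1 A = law (N01 \x sg n) (@measurable_tcons R n) A by rewrite lawE.
  by apply: eq_measure_integral => A mA _; first [exact: E|exact: esym (E A)].
rewrite ge0_integral_law//.
have := @tonelli_prod _ _ _ _ _ N01 (sg n) (fun x xs => u (tcons (x, xs)))
  measurable_tcons_comp (fun x y => u0 _).
move=> <-; apply: eq_integral => -[x xs] _ //.
Qed.

Lemma measurable_std_gaussS :
  measurable_fun [set: R] (fun x => \int[sg n]_xs u (tcons (x, xs))).
Proof.
exact: (@measurable_integral2 R _ _ _ _ (sg n) (fun x xs => u (tcons (x, xs)))
  measurable_tcons_comp (fun x y => u0 _)).
Qed.

End rec.

Lemma integral_std_gauss0 (u : 0.-tuple R -> \bar R) :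
  measurable_fun [set: 0.-tuple R] u -> (\int[sg 0]_x u x = u [tuple])%E.
Proof.
move=> mu; rewrite /= integral_dirac// diracE mem_set// mul1e//.
Qed.

Definition cmk n (y z : n.-tuple R) : R := expR (dot y z - dot y y / 2).

Lemma cmk_ge0 n (y z : n.-tuple R) : 0 <= cmk y z.
Proof. exact: expR_ge0. Qed.

Lemma measurable_cmk d (T : measurableType d) n (f g : T -> n.-tuple R) :
  measurable_fun [set: T] f -> measurable_fun [set: T] g ->
  measurable_fun [set: T] (fun t => cmk (f t) (g t)).
Proof.
move=> mf mg; apply: measurableT_comp => //; apply: measurable_funB.
  exact: measurable_dot.
by apply: measurable_funM => //; exact: measurable_dot.
Qed.

(* Cameron-Martin: the density of y + Z with respect to Z. *)
Lemma std_gauss_shift n (y : n.-tuple R) (u : n.-tuple R -> \bar R) :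
  measurable_fun [set: n.-tuple R] u -> (forall x, (0 <= u x)%E) ->
  (\int[sg n]_z u (tadd y z) = \int[sg n]_z (u z * (cmk y z)%:E))%E.
Proof.
elim: n y u => [|n IH] y u mu u0.
  have mk : measurable_fun [set: 0.-tuple R] (fun z => (u z * (cmk y z)%:E)%E).
    by apply: emeasurable_funM => //; apply/measurable_EFinP; exact: measurable_cmk.
  have ms : measurable_fun [set: 0.-tuple R] (fun z => u (tadd y z)).
    by apply: (measurableT_comp mu); exact: measurable_tadd.
  rewrite (integral_std_gauss0 mk) (integral_std_gauss0 ms).
  rewrite (tuple0 (tadd _ _)) /cmk /dot !big_ord0 mul0r subr0 expR0 mule1.
  by congr u; exact: val_inj.
have [y0 [ys ->]] := tconsP y.
have ms : measurable_fun [set: n.+1.-tuple R] (fun z => u (tadd (tcons (y0, ys)) z)).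
  by apply: (measurableT_comp mu); exact: measurable_tadd.
have mk : measurable_fun [set: n.+1.-tuple R]
    (fun z => (u z * (cmk (tcons (y0, ys)) z)%:E)%E).
  by apply: emeasurable_funM => //; apply/measurable_EFinP; exact: measurable_cmk.
rewrite (integral_std_gaussS ms (fun z => u0 _)).
rewrite (integral_std_gaussS mk); last by move=> z; rewrite mule_ge0// lee_fin cmk_ge0.
pose v x := (\int[sg n]_xs u (tcons (x, tadd ys xs)))%E.
have mxy : measurable_fun [set: measurableTypeR R * n.-tuple R]
    (fun z => u (tcons (z.1, tadd ys z.2))).
  apply: (measurableT_comp mu).
  have H := @measurable_tcons R n.
  apply: (measurableT_comp (f := @tcons R n) H (g := fun z : measurableTypeR R * n.-tuple R => (z.1, tadd ys z.2))).
  by apply: measurable_fun_pair => //; exact: measurable_tadd.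
have mv : measurable_fun [set: R] v.
  exact: (@measurable_integral2 R _ _ _ _ (sg n) (fun x xs => u (tcons (x, tadd ys xs))) mxy).
have v0 x : (0 <= v x)%E by apply: integral_ge0.
transitivity (\int[N01]_x v (y0 + x)%R)%E.
  by apply: eq_integral => x _; apply: eq_integral => xs _; rewrite tadd_cons.
rewrite (N01_shift y0 mv v0); apply: eq_integral => x _.
have mux : measurable_fun [set: n.-tuple R] (fun xs => u (tcons (x, xs))).
  by apply: (measurableT_comp mu); exact: measurable_tconsx.
rewrite /v (IH ys (fun xs => u (tcons (x, xs))) mux (fun _ => u0 _)).
rewrite -ge0_integralZrT ?expR_ge0//; last 2 first.
- by apply: emeasurable_funM => //; apply/measurable_EFinP; exact: measurable_cmk.
- by move=> z; rewrite mule_ge0// lee_fin cmk_ge0.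
apply: eq_integral => xs _; rewrite -muleA -EFinM; congr (_ * _%:E)%E.
by rewrite /cmk !dot_cons -expRD; congr expR; lra.
Qed.

Lemma std_gauss_cmk n (y : n.-tuple R) : (\int[sg n]_z (cmk y z)%:E = 1)%E.
Proof.
have := @std_gauss_shift n y (cst 1%E) (measurable_cst _) (fun _ => lee01).
rewrite integral_prob_cst => ->; apply: eq_integral => z _.
by rewrite mul1e.
Qed.

Lemma std_gauss_mgf n (y : n.-tuple R) :
  (\int[sg n]_z (expR (dot y z))%:E = (expR (dot y y / 2))%:E)%E.
Proof.
have mk : measurable_fun [set: n.-tuple R] (fun z => (cmk y z)%:E).
  by apply/measurable_EFinP; exact: measurable_cmk.
rewrite -[RHS]mule1 -(std_gauss_cmk y) -ge0_integralZlT//; last by move=> z; rewrite lee_fin cmk_ge0.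
apply: eq_integral => z _; rewrite -EFinM /cmk -expRD; congr (expR _)%:E; lra.
Qed.

Lemma N01_mgf (y : R) :
  (\int[N01]_z (expR (y * z))%:E = (expR (y ^+ 2 / 2))%:E)%E.
Proof.
have mk : measurable_fun [set: R] (fun z => (expR (y * z - y ^+ 2 / 2))%:E).
  apply/measurable_EFinP; apply: measurableT_comp => //.
  by apply: measurable_funB => //; exact: measurable_funM.
have := @N01_shift R y (cst 1%E) (measurable_cst _) (fun _ => lee01).
rewrite integral_prob_cst => H1.
rewrite -[RHS]mule1 H1 -ge0_integralZlT//; last 2 first.
- by under eq_fun do rewrite mul1e.
- by move=> z; rewrite mul1e lee_fin expR_ge0.
apply: eq_integral => z _; rewrite mul1e -EFinM -expRD; congr (expR _)%:E; lra.
Qed.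

Lemma std_gauss_opp n (u : n.-tuple R -> \bar R) :
  measurable_fun [set: n.-tuple R] u -> (forall x, (0 <= u x)%E) ->
  (\int[sg n]_z u (tscale (-1) z) = \int[sg n]_z u z)%E.
Proof.
elim: n u => [|n IH] u mu u0.
  have ms : measurable_fun [set: 0.-tuple R] (fun z => u (tscale (-1) z)).
    by apply: (measurableT_comp mu); exact: measurable_tscale.
  rewrite (integral_std_gauss0 mu) (integral_std_gauss0 ms) (tuple0 (tscale _ _)).
  by congr u; exact: val_inj.
have ms : measurable_fun [set: n.+1.-tuple R] (fun z => u (tscale (-1) z)).
  by apply: (measurableT_comp mu); exact: measurable_tscale.
rewrite (integral_std_gaussS ms (fun z => u0 _)) (integral_std_gaussS mu u0).
have mv := measurable_std_gaussS mu u0.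
rewrite -(N01_opp mv); last by move=> x; apply: integral_ge0.
apply: eq_integral => x _.
have mux : measurable_fun [set: n.-tuple R] (fun xs => u (tcons (- x, xs))).
  by apply: (measurableT_comp mu); exact: measurable_tconsx.
rewrite -(IH _ mux (fun _ => u0 _)); apply: eq_integral => xs _.
by rewrite tscale_cons mulN1r.
Qed.

Lemma std_gauss_expR_sqr n (l : R) : l < 1 ->
  (\int[sg n]_z (expR (l * dot z z / 2))%:E = ((Num.sqrt (1 - l))^-1 ^+ n)%:E)%E.
Proof.
move=> l1; elim: n => [|n IH].
  rewrite integral_std_gauss0.
    by rewrite /dot big_ord0 mulr0 mul0r expR0 expr0.
  apply/measurable_EFinP; apply: measurableT_comp => //.
  by do 2 apply: measurable_funM => //; exact: measurable_dot.
have me m : measurable_fun [set: m.-tuple R] (fun z => (expR (l * dot z z / 2))%:E).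
  apply/measurable_EFinP; apply: measurableT_comp => //.
  by do 2 apply: measurable_funM => //; exact: measurable_dot.
rewrite (integral_std_gaussS (me _)); last by move=> z; rewrite lee_fin expR_ge0.
rewrite exprSr EFinM -IH -N01_expR_sqr//.
have mx : measurable_fun [set: R] (fun x : R => (expR (l * x ^+ 2 / 2))%:E).
  apply/measurable_EFinP; apply: measurableT_comp => //.
  by do 2 apply: measurable_funM => //; exact: measurable_funX.
have J : (0 <= \int[sg n]_z (expR (l * dot z z / 2))%:E)%E.
  by apply: integral_ge0 => z _; rewrite lee_fin expR_ge0.
rewrite IH -ge0_integralZlT//.
apply: eq_integral => x _; rewrite -IH -ge0_integralZrT; [|exact: expR_ge0|exact: me|]; last first.
  by move=> z; rewrite lee_fin expR_ge0.
apply: eq_integral => z _; rewrite -EFinM -expRD dot_cons; congr (expR _)%:E; lra.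
Qed.

(** Linearise the square: exp(x^2/2) is the mean of exp(x h) for a scalar Gaussian [h]. After
    swapping the integrals, the one over [z] is a moment generating function and the one over [h] is
    [N01_expR_sqr] with l = |b|^2. *)
Lemma std_gauss_expR_dot_sqr n (b : n.-tuple R) : dot b b < 1 ->
  (\int[sg n]_z (expR (dot b z ^+ 2 / 2))%:E = ((Num.sqrt (1 - dot b b))^-1)%:E)%E.
Proof.
move=> b1.
have mp : measurable_fun [set: n.-tuple R * measurableTypeR R]
    (fun z => (expR (dot b z.1 * z.2))%:E).
  apply/measurable_EFinP; apply: measurableT_comp => //.
  by apply: measurable_funM => //; exact: measurable_dot.
transitivity (\int[sg n]_z \int[N01]_h (expR (dot b z * h))%:E)%E.
  by apply: eq_integral => z _; rewrite N01_mgf.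
have sw := @tonelli_swap R _ _ _ _ (sg n) N01 (fun z h => (expR (dot b z * h))%:E) mp
  (fun x y => expR_ge0 _).
apply: (etrans sw).
rewrite -N01_expR_sqr//; apply: eq_integral => h _.
transitivity (\int[sg n]_z (expR (dot (tscale h b) z))%:E)%E.
  by apply: eq_integral => z _; rewrite dotZl mulrC.
by rewrite std_gauss_mgf dotZl dotZr; congr (expR _)%:E; ring.
Qed.

(** The variance is read off the exponential moment: integrate 1 + e<b,z>^2/2 <= exp(e<b,z>^2/2),
    bound the result by [inv_sqrt_ub], divide by [e / 2] and let [e] tend to 0. *)
Lemma std_gauss_dot_sqr n (b : n.-tuple R) :
  (\int[sg n]_z (dot b z ^+ 2)%:E <= (dot b b)%:E)%E.
Proof.
(* The added 1 keeps the range of [e] meaningful when [b] is null. *)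
pose B := dot b b + 1; have B0 : 0 < B by rewrite ltr_wpDl ?dot_ge0.
have B1 : dot b b <= B by rewrite lerDl.
have ms : measurable_fun [set: n.-tuple R] (fun z => (dot b z ^+ 2)%:E).
  by apply/measurable_EFinP; apply: measurable_funX; exact: measurable_dot.
have key e : 0 < e -> e < (4 * B)^-1 ->
    ((e / 2)%:E * \int[sg n]_z (dot b z ^+ 2)%:E + 1 <=
     (1 + (e * dot b b) / 2 + (e * dot b b) ^+ 2 / 2)%:E)%E.
  move=> e0 eB.
  have eb : e * dot b b <= 4^-1.
    apply: (@le_trans _ _ (e * B)); first by rewrite ler_wpM2l// ltW.
    by rewrite -ler_pdivlMr// -invfM ltW.
  have eb0 : 0 <= e * dot b b by rewrite mulr_ge0 ?dot_ge0// ltW.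
  have bE : dot (tscale (Num.sqrt e) b) (tscale (Num.sqrt e) b) = e * dot b b.
    by rewrite dotZl dotZr mulrA -expr2 sqr_sqrtr// ltW.
  apply: (@le_trans _ _ ((Num.sqrt (1 - e * dot b b))^-1)%:E); last first.
    by rewrite lee_fin inv_sqrt_ub.
  rewrite -bE -std_gauss_expR_dot_sqr; last by rewrite bE; lra.
  rewrite -(integral_prob_cst (sg n) 1) -ge0_integralZlT//; last 2 first.
  - by rewrite divr_ge0 ?ltW.
  - by move=> z; rewrite lee_fin sqr_ge0.
  have m1 : measurable_fun [set: n.-tuple R] (fun z => ((e / 2)%:E * (dot b z ^+ 2)%:E)%E).
    exact: emeasurable_funM.
  rewrite -ge0_integralDT//; last first.
    by move=> z; rewrite mule_ge0// lee_fin ?sqr_ge0// divr_ge0 ?ltW.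
  apply: ge0_le_integralT.
  - exact: emeasurable_funD.
  - apply/measurable_EFinP; apply: measurableT_comp => //.
    apply: measurable_funM => //; apply: measurable_funX; exact: measurable_dot.
  - by move=> z; rewrite -EFinM -EFinD lee_fin addr_ge0// mulr_ge0 ?sqr_ge0// divr_ge0 ?ltW.
  - move=> z; rewrite -EFinM -EFinD lee_fin.
    rewrite dotZl exprMn (sqr_sqrtr (ltW e0)) addrC.
    by apply: le_trans (expR_ge1Dx _); rewrite lerD2l mulrAC.
set I := (\int[sg n]_z _)%E in key *.
have I0 : (0 <= I)%E by apply: integral_ge0 => z _; rewrite lee_fin sqr_ge0.
(* One admissible value of [e] already shows finiteness; only then can the inequality be treated in
   R. *)
have If : I \is a fin_num.
  have e0 : 0 < (8 * B)^-1 by rewrite invr_gt0 mulr_gt0.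
  have := key _ e0; rewrite ltf_pV2 ?posrE ?mulr_gt0// ltr_pM2r// => /(_ _).
  have h : (4 : R) < 8 by lra.
  move=> /(_ h); case: (I) I0 => [//|//|] //.
  by move=> _; rewrite gt0_muley ?lte_fin ?divr_gt0.
rewrite -(fineK If) lee_fin in key *.
apply: (@le_of_forall_eps _ _ _ (dot b b ^+ 2) (4 * B)^-1).
  by rewrite invr_gt0 mulr_gt0.
move=> e e0 /(key e e0); rewrite -(fineK If) -EFinM -EFinD lee_fin => H.
rewrite -(@ler_pM2l _ (e / 2)) ?divr_gt0//; nra.
Qed.

Lemma std_gauss_normsq n : (\int[sg n]_z (dot z z)%:E <= n%:R%:E)%E.
Proof.
have md i : measurable_fun [set: n.-tuple R] (fun z => (tnth z i * tnth z i)%:E).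
  by apply/measurable_EFinP; apply: measurable_funM; exact: measurable_tnth.
under eq_integral do rewrite /dot -sumEFin.
rewrite ge0_integral_sum//; last by move=> i z _; rewrite lee_fin -expr2 sqr_ge0.
rewrite -[n in (n%:R)]card_ord -sum1_card natr_sum -sumEFin.
apply: lee_sum => i _.
pose b : n.-tuple R := [tuple (i == j)%:R | j < n].
have bz z : dot b z = tnth z i.
  rewrite /dot (bigD1 i)//= tnth_mktuple eqxx mul1r big1 ?addr0// => j ji.
  by rewrite tnth_mktuple eq_sym (negbTE ji) mul0r.
have := std_gauss_dot_sqr b; rewrite bz tnth_mktuple eqxx.
suff -> : (\int[sg n]_x (tnth x i * tnth x i)%:E =
  \int[sg n]_z (dot b z ^+ 2)%:E)%E by [].
by apply: eq_integral => z _; rewrite bz expr2.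
Qed.

End gauss.

(** * Cholesky factorisation of positive semidefinite matrices *)

Section cholesky.
Context {R : rcfType}.

Definition qform n (S : 'M[R]_n) (x : 'rV[R]_n) : R := (x *m S *m x^T) 0 0.

Lemma qform_block n (a : R) (v : 'rV[R]_n) (S : 'M[R]_n) (c : R) (y : 'rV[R]_n) :
  qform (block_mx a%:M v v^T S : 'M[R]_(1 + n)) (row_mx c%:M y) =
  c ^+ 2 * a + 2 * c * (v *m y^T) 0 0 + qform S y.
Proof.
rewrite /qform mul_row_block tr_row_mx mul_row_col tr_scalar_mx mul_mx_scalar.
rewrite mulmxDl !mul_scalar_mx -scalemxAl.
have <- : (y *m v^T) 0 0 = (v *m y^T) 0 0.
  by rewrite !mxE; apply: eq_bigr => j _; rewrite !mxE mulrC.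
have -> : v *m y^T = y *m v^T.
  by apply/matrixP => i j; rewrite !ord1 !mxE; apply: eq_bigr => l _; rewrite !mxE mulrC.
move: (y *m v^T) (y *m S *m y^T) => p r; rewrite !mxE eqxx mulr1n; ring.
Qed.

(** Induction on the size. A positive pivot [a] leaves the Schur complement [S2], again positive
    semidefinite; a null pivot forces the rest [v] of its row to vanish. *)
Lemma cholesky n (S : 'M[R]_n) : S^T = S -> (forall x, 0 <= qform S x) ->
  exists A : 'M[R]_n, S = A *m A^T.
Proof.
elim: n S => [|n IH] S symS psdS.
  by exists 0; rewrite [S]flatmx0 mul0mx.
pose a := S 0 0.
pose v : 'rV[R]_n := ursubmx (S : 'M[R]_(1 + n)).
pose S1 : 'M[R]_n := drsubmx (S : 'M[R]_(1 + n)).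
have Sul : ulsubmx (S : 'M[R]_(1 + n)) = a%:M.
  apply/matrixP => i j; rewrite !mxE !ord1 eqxx mulr1n /a.
  by congr (S _ _); apply: val_inj.
have Sdl : dlsubmx (S : 'M[R]_(1 + n)) = v^T.
  by rewrite /v trmx_ursub symS.
have SE : S = block_mx a%:M v v^T S1 :> 'M[R]_(1 + n).
  by rewrite -[LHS](@submxK _ 1 n 1 n) Sul Sdl.
have symS1 : S1^T = S1 by rewrite /S1 trmx_drsub symS.
clear Sul Sdl; clearbody v S1.
have pos c y : 0 <= c ^+ 2 * a + 2 * c * (v *m y^T) 0 0 + qform S1 y.
  by rewrite -qform_block -SE.
have vv : (v *m v^T) 0 0 = \sum_j v 0 j ^+ 2.
  by rewrite mxE; apply: eq_bigr => j _; rewrite [v^T _ _]mxE expr2.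
have a0 : 0 <= a.
  have := pos 1 0; rewrite trmx0 mulmx0 /qform trmx0 mulmx0 !mxE.
  by rewrite expr1n mul1r mulr0 !addr0.
have [a_eq0|a_neq0] := eqVneq a 0.
  have v0 : v = 0.
    have vv0 : (v *m v^T) 0 0 = 0.
      apply/eqP; rewrite eq_le; apply/andP; split; last first.
        by rewrite vv; apply: sumr_ge0 => j _; exact: sqr_ge0.
      rewrite leNgt; apply/negP => vvp.
      (* With a null pivot the form is affine in the first coordinate; this coordinate makes its
         value -1. *)
      have := pos (- (qform S1 v + 1) / (2 * (v *m v^T) 0 0)) v.
      rewrite a_eq0 mulr0 add0r; set w := (v *m v^T) 0 0 in vvp *.
      have -> : 2 * (- (qform S1 v + 1) / (2 * w)) * w = - (qform S1 v + 1).
        by field; rewrite gt_eqF.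
      lra.
    apply/rowP => j; rewrite mxE; apply/eqP; rewrite -sqrf_eq0; move/eqP: vv0.
    rewrite vv psumr_eq0; last by move=> i _; exact: sqr_ge0.
    by move=> /allP /(_ j); rewrite mem_index_enum => /(_ isT).
  have [|A SA] := IH S1 symS1.
    by move=> y; have := pos 0 y; rewrite expr0n mul0r mulr0 mul0r !add0r.
  pose X : 'M[R]_(1 + n) := block_mx 0 0 0 A.
  have XE : S = X *m X^T :> 'M[R]_(1 + n).
    rewrite SE a_eq0 v0 /X tr_block_mx !trmx0.
    by rewrite mulmx_block !mulmx0 !mul0mx !addr0 !add0r SA raddf0.
  by exists X.
have ap : 0 < a by rewrite lt_neqAle eq_sym a_neq0.
pose b := Num.sqrt a.
have bp : 0 < b by rewrite sqrtr_gt0.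
have bb : b * b = a by rewrite -expr2 sqr_sqrtr.
pose S2 := S1 - a^-1 *: (v^T *m v).
have S2q y : qform S2 y = qform S1 y - a^-1 * ((v *m y^T) 0 0) ^+ 2.
  rewrite /qform /S2 mulmxBr mulmxBl -scalemxAr -scalemxAl.
  rewrite !mulmxA -[y *m v^T *m v *m y^T]mulmxA !mxE; congr (_ - _ * _).
  rewrite big_ord1 expr2; congr (_ * _).
    by rewrite !mxE; apply: eq_bigr => j _; rewrite !mxE mulrC.
  by rewrite !mxE.
have [||A SA] := IH S2.
- rewrite /S2 linearB /= linearZ /= trmx_mul trmxK symS1//.
(* The first coordinate that minimises the form for fixed [y]; the minimum is the form of the Schur
   complement. *)
- move=> y; have := pos (- a^-1 * (v *m y^T) 0 0) y; rewrite S2q.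
  set w := (v *m y^T) 0 0.
  have -> : (- a^-1 * w) ^+ 2 * a + 2 * (- a^-1 * w) * w = - (a^-1 * w ^+ 2).
    by field.
  by rewrite addrC.
pose X : 'M[R]_(1 + n) := block_mx b%:M 0 (b^-1 *: v^T) A.
suff XE : S = X *m X^T :> 'M[R]_(1 + n) by exists X.
rewrite SE /X tr_block_mx mulmx_block trmx0 !mulmx0 !mul0mx !addr0.
rewrite tr_scalar_mx linearZ /= trmxK.
congr block_mx.
- by rewrite -scalar_mxM bb.
- by rewrite mul_scalar_mx scalerA divff ?scale1r// gt_eqF.
- by rewrite mul_mx_scalar scalerA divff ?scale1r// gt_eqF.
- rewrite -SA /S2 -scalemxAl -scalemxAr scalerA -invfM bb.
  by rewrite addrC subrK.
Qed.

End cholesky.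

(** * Gaussian laws: affine images and convolutions *)

Section gauss_law.
Context {R : realType}.
Notation sg := (@std_gauss R).

Definition tcat m n (x : m.-tuple R) (y : n.-tuple R) : (m + n).-tuple R :=
  [tuple of x ++ y].

Lemma measurable_tcat d (T : measurableType d) m n (f : T -> m.-tuple R)
    (g : T -> n.-tuple R) : measurable_fun [set: T] f ->
  measurable_fun [set: T] g -> measurable_fun [set: T] (fun t => tcat (f t) (g t)).
Proof.
move=> /measurable_fun_tnthP mf /measurable_fun_tnthP mg.
apply/measurable_fun_tnthP => i; case: (split_ordP i) => j ->.
  rewrite (_ : _ \o _ = fun t => tnth (f t) j); first exact: mf.
  by apply/funext => t /=; rewrite tnth_lshift.
rewrite (_ : _ \o _ = fun t => tnth (g t) j); first exact: mg.
by apply/funext => t /=; rewrite tnth_rshift.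
Qed.

Lemma measurable_affine r m (M : 'M[R]_(m, r)) b :
  measurable_fun [set: r.-tuple R] (affine M b).
Proof.
apply/measurable_fun_tnthP => i.
rewrite (_ : _ \o _ = fun z => tnth b i + \sum_(j < r) M i j * tnth z j).
  apply: measurable_funD => //; apply: measurable_sum => j.
  by apply: measurable_funM => //; exact: measurable_tnth.
by apply/funext => z /=; rewrite tnth_mktuple.
Qed.

Lemma std_gauss_cat m n (u : (m + n).-tuple R -> \bar R) :
  measurable_fun [set: (m + n).-tuple R] u -> (forall x, (0 <= u x)%E) ->
  (\int[sg (m + n)]_z u z = \int[sg m]_x \int[sg n]_y u (tcat x y))%E.
Proof.
elim: m u => [|m IH] u mu u0.
  have mxy : measurable_fun [set: 0.-tuple R * n.-tuple R] (fun z => u (tcat z.1 z.2)).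
    by apply: (measurableT_comp mu); exact: measurable_tcat.
  have := @measurable_integral2 R _ _ _ _ (sg n) (fun x y => u (tcat x y)) mxy (fun x y => u0 _).
  move=> mi; rewrite (integral_std_gauss0 mi).
  by apply: eq_integral => y _; congr u; exact: val_inj.
rewrite (@integral_std_gaussS R (m + n) u mu u0).
have mi : measurable_fun [set: m.+1.-tuple R] (fun x => \int[sg n]_y u (tcat x y))%E.
  apply: (@measurable_integral2 R _ _ _ _ (sg n) (fun x y => u (tcat x y))) => //.
  by apply: (measurableT_comp mu); exact: measurable_tcat.
rewrite (integral_std_gaussS mi); last by move=> x; exact: integral_ge0.
apply: eq_integral => x _.
have mx : measurable_fun [set: (m + n).-tuple R] (fun z => u (tcons (x, z))).
  by apply: (measurableT_comp mu); exact: (@measurable_tconsx R (m + n)).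
rewrite (IH _ mx (fun _ => u0 _)); apply: eq_integral => xs _.
by apply: eq_integral => y _; congr u; exact: val_inj.
Qed.

(** The source dimension [r] is free, so degenerate covariances and point masses are included, and
    sums of independent vectors stay in the class by enlarging [r]. *)
Definition is_gauss N (mu : probability (N.-tuple R) R) :=
  exists r (M : 'M[R]_(N, r)) (b : N.-tuple R),
    forall B, measurable B -> mu B = sg r (affine M b @^-1` B).

Lemma is_gauss_integral N (mu : probability (N.-tuple R) R) r (M : 'M[R]_(N, r))
    (b : N.-tuple R) :
  (forall B, measurable B -> mu B = sg r (affine M b @^-1` B)) ->
  forall u, measurable_fun [set: N.-tuple R] u -> (forall x, (0 <= u x)%E) ->
  (\int[mu]_x u x = \int[sg r]_z u (affine M b z))%E.
Proof.
move=> muE u mu_ u0; rewrite -(ge0_integral_law _ (measurable_affine M b))//.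
by apply: eq_measure_integral => B mB _; rewrite /= muE.
Qed.

Lemma affine_add N r1 r2 (M1 : 'M[R]_(N, r1)) (M2 : 'M[R]_(N, r2)) b1 b2 z1 z2 :
  affine (row_mx M1 M2) (tadd b1 b2) (tcat z1 z2) =
  tadd (affine M1 b1 z1) (affine M2 b2 z2).
Proof.
apply: eq_from_tnth => i; rewrite !tE !tnth_mktuple big_split_ord/=.
rewrite [RHS]addrACA; congr (_ + (_ + _)); apply: eq_bigr => j _.
  by rewrite row_mxEl tnth_lshift.
by rewrite row_mxEr tnth_rshift.
Qed.

Lemma affine_comp N m r (A : 'M[R]_(N, m)) c (M : 'M[R]_(m, r)) b z :
  affine A c (affine M b z) = affine (A *m M) (affine A c b) z.
Proof.
apply: eq_from_tnth => i; rewrite !tnth_mktuple -addrA; congr (_ + _).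
under eq_bigr do rewrite tnth_mktuple mulrDr.
rewrite big_split/=; congr (_ + _).
under eq_bigr do rewrite mulr_sumr.
rewrite exchange_big/=; apply: eq_bigr => j _.
by rewrite mxE mulr_suml; apply: eq_bigr => l _; rewrite mulrA.
Qed.

(** Put the two matrices side by side: two independent standard vectors concatenate to one standard
    vector of dimension [r1 + r2]. *)
Lemma is_gauss_convol N (mu nu : probability (N.-tuple R) R) :
  is_gauss mu -> is_gauss nu -> is_gauss (convol mu nu).
Proof.
move=> [r1 [M1 [b1 E1]]] [r2 [M2 [b2 E2]]].
exists (r1 + r2)%N, (row_mx M1 M2), (tadd b1 b2) => B mB.
pose u (x : N.-tuple R) := (\1_B x)%:E : \bar R.
have mu_ : measurable_fun [set: N.-tuple R] u.
  by apply/measurable_EFinP; exact: measurable_indic.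
have u0 x : (0 <= u x)%E by rewrite lee_fin.
have mA := measurable_affine (row_mx M1 M2) (tadd b1 b2).
have mAB : measurable (affine (row_mx M1 M2) (tadd b1 b2) @^-1` B).
  by rewrite -[X in measurable X]setTI; exact: mA.
rewrite (prob_indic (convol mu nu) mB) (prob_indic (sg (r1 + r2)) mAB).
rewrite (ge0_integral_convol mu_ u0 mu nu).
rewrite (is_gauss_integral E1 (measurable_integral_shift mu_ u0 nu)); last first.
  by move=> x; exact: integral_ge0.
have mu2 : measurable_fun [set: (r1 + r2).-tuple R]
    (fun z => u (affine (row_mx M1 M2) (tadd b1 b2) z)).
  exact: measurableT_comp mu_ mA.
transitivity (\int[sg (r1 + r2)]_z u (affine (row_mx M1 M2) (tadd b1 b2) z))%E.
  rewrite (std_gauss_cat mu2 (fun _ => u0 _)); apply: eq_integral => z1 _.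
  rewrite (is_gauss_integral E2 (measurable_shift mu_ _)); last by move=> x; exact: u0.
  by apply: eq_integral => z2 _; rewrite affine_add.
by apply: eq_integral => z _.
Qed.

Lemma is_gauss_affine N m (mu : probability (m.-tuple R) R) (A : 'M[R]_(N, m)) c :
  is_gauss mu -> is_gauss (law mu (measurable_affine A c)).
Proof.
move=> [r [M [b E]]]; exists r, (A *m M), (affine A c b) => B mB.
rewrite lawE E; last by rewrite -[X in measurable X]setTI; exact: measurable_affine.
by congr (sg r _); apply/seteqP; split => z; rewrite /preimage/= affine_comp.
Qed.

Lemma affine1 N (z : N.-tuple R) : affine 1%:M (tzero N) z = z.
Proof.
apply: eq_from_tnth => i; rewrite tnth_mktuple tE add0r (bigD1 i)//= mxE eqxx mul1r.
by rewrite big1 ?addr0// => j ji; rewrite mxE eq_sym (negbTE ji) mul0r.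
Qed.

Lemma is_gauss_std N : is_gauss (sg N).
Proof.
exists N, 1%:M, (tzero N) => B mB; congr (sg N _).
by apply/seteqP; split => z; rewrite /preimage/= affine1.
Qed.

Lemma is_gauss_eq N (mu nu : probability (N.-tuple R) R) :
  (forall B, measurable B -> mu B = nu B) -> is_gauss mu -> is_gauss nu.
Proof.
by move=> E [r [M [b H]]]; exists r, M, b => B mB; rewrite -E// H.
Qed.

Lemma is_gauss_cpow N (pi mu : probability (N.-tuple R) R) k :
  is_gauss pi -> is_gauss mu -> is_gauss (cpow pi mu k).
Proof. by move=> gp gm; elim: k => //= k IH; exact: is_gauss_convol. Qed.

End gauss_law.

(** * Densities of Gaussian convolutions *)

Section real_integrals.
Local Open Scope ereal_scope.
Context {R : realType} d (T : measurableType d) (P : probability T R).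
Implicit Types f g : T -> R.

(** Both one-sided bounds come from f <= g + |f - g| and its mirror image, which integrate without
    any subtraction in the extended reals. *)
Lemma abs_integral_diff f g (a b : R) :
  measurable_fun [set: T] f -> measurable_fun [set: T] g ->
  (forall x, 0 <= f x)%R -> (forall x, 0 <= g x)%R ->
  \int[P]_x (f x)%:E = a%:E -> \int[P]_x (g x)%:E = b%:E ->
  `|a - b|%:E <= \int[P]_x (`|f x - g x|)%:E.
Proof.
move=> mf mg f0 g0 fa gb.
have md : measurable_fun [set: T] (fun x => `|f x - g x|)%R.
  by apply: measurableT_comp => //; exact: measurable_funB.
have key (u v : T -> R) (c e : R) : measurable_fun [set: T] u -> measurable_fun [set: T] v ->
    (forall x, 0 <= u x)%R -> (forall x, 0 <= v x)%R ->
    \int[P]_x (u x)%:E = c%:E -> \int[P]_x (v x)%:E = e%:E ->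
    (forall x, u x <= v x + `|f x - g x|)%R ->
    c%:E <= e%:E + \int[P]_x (`|f x - g x|)%:E.
  move=> mu mv u0 v0 <- <- uv.
  rewrite -ge0_integralDT//; last 2 first.
  - exact/measurable_EFinP.
  - exact/measurable_EFinP.
  apply: ge0_le_integralT.
  - exact/measurable_EFinP.
  - by apply: emeasurable_funD; exact/measurable_EFinP.
  - by move=> x; rewrite lee_fin.
  - by move=> x; rewrite -EFinD lee_fin.
have h1 := key f g a b mf mg f0 g0 fa gb.
have h2 := key g f b a mg mf g0 f0 gb fa.
have d0 : 0 <= \int[P]_x (`|f x - g x|)%:E by apply: integral_ge0 => x _; rewrite lee_fin.
move: h1 h2 d0; case: (\int[P]_x _) => [r| |]; rewrite ?leey//.
rewrite -!EFinD !lee_fin => h1 h2 d0.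
have {}h1 : (a <= b + r)%R.
  by apply: h1 => x; have := ler_norm (f x - g x)%R; lra.
have {}h2 : (b <= a + r)%R.
  by apply: h2 => x; have := ler_norm (g x - f x)%R; rewrite distrC; lra.
by rewrite ler_norml; apply/andP; split; lra.
Qed.

(** Integrate the tangent line at the mean: 2 m f <= f^2 + m^2. *)
Lemma jensen_sqr f (m : R) : measurable_fun [set: T] f -> (forall x, 0 <= f x)%R ->
  \int[P]_x (f x)%:E = m%:E -> (m ^+ 2)%:E <= \int[P]_x (f x ^+ 2)%:E.
Proof.
move=> mf f0 fm.
have m0 : (0 <= m)%R by rewrite -lee_fin -fm; apply: integral_ge0 => x _; rewrite lee_fin.
have mf2 : measurable_fun [set: T] (fun x => (f x ^+ 2)%:E).
  by apply/measurable_EFinP; exact: measurable_funX.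
have H : (2 * m)%:E * \int[P]_x (f x)%:E <= \int[P]_x (f x ^+ 2)%:E + (m ^+ 2)%:E.
  rewrite -(integral_prob_cst P (m ^+ 2)) -ge0_integralZlT//; last 2 first.
  - by rewrite mulr_ge0.
  - exact/measurable_EFinP.
  rewrite -ge0_integralDT//; last 2 first.
  - by move=> x; rewrite lee_fin sqr_ge0.
  - by move=> x; rewrite lee_fin sqr_ge0.
  apply: ge0_le_integralT.
  - by apply: emeasurable_funM => //; exact/measurable_EFinP.
  - exact: emeasurable_funD.
  - by move=> x; rewrite -EFinM lee_fin !mulr_ge0.
  - by move=> x; rewrite -EFinM -EFinD lee_fin; have := sqr_ge0 (f x - m)%R; nra.
have i0 : 0 <= \int[P]_x (f x ^+ 2)%:E.
  by apply: integral_ge0 => x _; rewrite lee_fin sqr_ge0.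
move: H i0; rewrite fm; case: (\int[P]_x _) => [r| |]; rewrite ?leey//.
by rewrite -EFinM -EFinD !lee_fin; nra.
Qed.

(** Integrate the tangent line of [expR] at [m], with terms moved so that both sides are
    non-negative. *)
Lemma jensen_expR f (m : R) : measurable_fun [set: T] f -> (forall x, 0 <= f x)%R ->
  \int[P]_x (f x)%:E = m%:E -> (expR m)%:E <= \int[P]_x (expR (f x))%:E.
Proof.
move=> mf f0 fm.
have m0 : (0 <= m)%R by rewrite -lee_fin -fm; apply: integral_ge0 => x _; rewrite lee_fin.
have me : measurable_fun [set: T] (fun x => (expR (f x))%:E).
  by apply/measurable_EFinP; exact: measurableT_comp.
have mfE : measurable_fun [set: T] (fun x => (f x)%:E) by exact/measurable_EFinP.
have H : (expR m)%:E * \int[P]_x (f x)%:E + (expR m)%:E <=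
    \int[P]_x (expR (f x))%:E + (expR m * m)%:E.
  have E1 : (expR m)%:E * \int[P]_x (f x)%:E = \int[P]_x ((expR m)%:E * (f x)%:E).
    by rewrite ge0_integralZlT ?expR_ge0.
  rewrite {}E1 -[X in _ + X <= _](integral_prob_cst P (expR m)).
  rewrite -(integral_prob_cst P (expR m * m)).
  have mm : measurable_fun [set: T] (fun x => (expR m)%:E * (f x)%:E).
    exact: emeasurable_funM.
  have E2 : \int[P]_x ((expR m)%:E * (f x)%:E) + \int[P]__ (expR m)%:E =
      \int[P]_x ((expR m)%:E * (f x)%:E + (expR m)%:E).
    by rewrite ge0_integralDT// => x; rewrite -EFinM lee_fin mulr_ge0 ?expR_ge0.
  have E3 : \int[P]_x (expR (f x))%:E + \int[P]__ (expR m * m)%:E =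
      \int[P]_x ((expR (f x))%:E + (expR m * m)%:E).
    by rewrite ge0_integralDT// => x; rewrite lee_fin mulr_ge0 ?expR_ge0.
  rewrite {}E2 {}E3.
  apply: ge0_le_integralT.
  - by apply: emeasurable_funD => //; exact: emeasurable_funM.
  - exact: emeasurable_funD.
  - by move=> x; rewrite -EFinM -EFinD lee_fin addr_ge0 ?mulr_ge0 ?expR_ge0.
  - move=> x; rewrite -EFinM -!EFinD lee_fin.
    have -> : expR (f x) = (expR m * expR (f x - m))%R.
      by rewrite -expRD; congr expR; ring.
    by have := ler_wpM2l (expR_ge0 m) (expR_ge1Dx (f x - m)%R); lra.
have i0 : 0 <= \int[P]_x (expR (f x))%:E.
  by apply: integral_ge0 => x _; rewrite lee_fin expR_ge0.
move: H i0; rewrite fm; case: (\int[P]_x _) => [r| |]; rewrite ?leey//.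
by rewrite -EFinM -!EFinD !lee_fin; lra.
Qed.

End real_integrals.

Section density_of_convolution.
Context {R : realType} (N : nat).
Local Notation E := (N.-tuple R).
Notation sg := (@std_gauss R N).
Implicit Types mu nu pi : probability E R.

Definition tsub (z y : E) : E := tadd z (tscale (-1) y).

Lemma tsubK y z : tsub (tadd y z) y = z.
Proof. by apply: eq_from_tnth => i; rewrite !tE mulN1r [_ + tnth z i]addrC addrK. Qed.

Lemma measurable_tsub d (T : measurableType d) (f g : T -> E) :
  measurable_fun [set: T] f -> measurable_fun [set: T] g ->
  measurable_fun [set: T] (fun t => tsub (f t) (g t)).
Proof.
by move=> mf mg; apply: measurable_tadd => //; exact: measurable_tscale.
Qed.

(** The cocycle rule of the Cameron-Martin kernel. It makes the density of a convolution an average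
    of shifted densities, as in [dens_convol]. *)
Lemma cmkD (x y z : E) : cmk (tadd y x) z = cmk y z * cmk x (tsub z y).
Proof.
rewrite /cmk -expRD normsqD dotDl /tsub (dotC x (tadd z _)) dotDl dotZl (dotC z x).
by congr expR; lra.
Qed.

(** Since every kernel has integral 1, the inner product of two kernels in L^2 of the Gaussian is
    exp<x,y>. *)
Lemma cmkM (x y z : E) : cmk x z * cmk y z = expR (dot x y) * cmk (tadd x y) z.
Proof. by rewrite /cmk -!expRD normsqD dotDl; congr expR; lra. Qed.

(** Non-negativity of |z - y|^2. The bound is uniform in [y], so [dens mu z] is finite for every
    probability [mu]. *)
Lemma cmk_ub (y z : E) : cmk y z <= expR (dot z z / 2).
Proof.
rewrite ler_expR; have := dot_ge0 (tsub z y).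
by rewrite /tsub normsqD !(dotZl, dotZr) (dotC z y); lra.
Qed.

(** The density, with respect to a standard Gaussian, of the law of X + Z with X distributed as [mu]
    and Z an independent standard Gaussian; see [integral_convol_std_gauss]. *)
Definition dens mu (z : E) : R := fine (\int[mu]_y (cmk y z)%:E).

Lemma measurable_cmk_l z : measurable_fun [set: E] (fun y : E => (cmk y z)%:E).
Proof. by apply/measurable_EFinP; exact: measurable_cmk. Qed.

Lemma measurable_cmk_r y : measurable_fun [set: E] (fun z : E => (cmk y z)%:E).
Proof. by apply/measurable_EFinP; exact: measurable_cmk. Qed.

Lemma measurable_cmk2 :
  measurable_fun [set: E * E] (fun z : E * E => (cmk z.2 z.1)%:E).
Proof. by apply/measurable_EFinP; exact: measurable_cmk. Qed.

Lemma densE mu z : (\int[mu]_y (cmk y z)%:E = (dens mu z)%:E)%E.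
Proof.
rewrite /dens fineK// ge0_fin_numE; last first.
  by apply: integral_ge0 => y _; rewrite lee_fin cmk_ge0.
apply: (@le_lt_trans _ _ (expR (dot z z / 2))%:E); last exact: ltry.
rewrite -(integral_prob_cst mu); apply: ge0_le_integralT => //.
- exact: measurable_cmk_l.
- by move=> y; rewrite lee_fin cmk_ge0.
- by move=> y; rewrite lee_fin cmk_ub.
Qed.

Lemma dens_ge0 mu z : 0 <= dens mu z.
Proof.
by rewrite -lee_fin -densE; apply: integral_ge0 => y _; rewrite lee_fin cmk_ge0.
Qed.

Lemma measurable_dens mu : measurable_fun [set: E] (dens mu).
Proof.
apply/measurable_EFinP; rewrite (_ : _ \o _ = fun z => \int[mu]_y (cmk y z)%:E)%E.
  apply: (@measurable_integral2 R _ _ _ _ mu (fun z y => (cmk y z)%:E)).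
    exact: measurable_cmk2.
  by move=> x y; rewrite lee_fin cmk_ge0.
by apply/funext => z; rewrite densE.
Qed.

Lemma eq_dens mu nu :
  (forall u : E -> \bar R, measurable_fun [set: E] u -> (forall x, (0 <= u x)%E) ->
     (\int[mu]_x u x = \int[nu]_x u x)%E) -> dens mu = dens nu.
Proof.
move=> H; apply/funext => z; rewrite /dens H//; first exact: measurable_cmk_l.
by move=> x; rewrite lee_fin cmk_ge0.
Qed.

Lemma integral_convol_std_gauss mu (u : E -> \bar R) :
  measurable_fun [set: E] u -> (forall x, (0 <= u x)%E) ->
  (\int[convol mu sg]_x u x = \int[sg]_z (u z * (dens mu z)%:E))%E.
Proof.
move=> mu_ u0; rewrite (ge0_integral_convol mu_ u0).
have mk y : measurable_fun [set: E] (fun z => (u z * (cmk y z)%:E)%E).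
  by apply: emeasurable_funM => //; exact: measurable_cmk_r.
transitivity (\int[mu]_y \int[sg]_z (u z * (cmk y z)%:E))%E.
  by apply: eq_integral => y _; rewrite (std_gauss_shift y mu_ u0).
have m2 : measurable_fun [set: E * E] (fun z : E * E => (u z.2 * (cmk z.1 z.2)%:E)%E).
  apply: emeasurable_funM; first exact: measurableT_comp.
  by apply/measurable_EFinP; exact: measurable_cmk.
have k0 x y : (0 <= u y * (cmk x y)%:E)%E by rewrite mule_ge0// lee_fin cmk_ge0.
apply: (etrans (@tonelli_swap R _ _ _ _ mu sg (fun y z => u z * (cmk y z)%:E)%E m2 k0)).
apply: eq_integral => z _; rewrite -densE.
under eq_integral do rewrite muleC.
rewrite muleC ge0_integralZr//; first exact: measurable_cmk_l.
by move=> y _; rewrite lee_fin cmk_ge0.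
Qed.

Lemma dens_convol pi mu z :
  ((dens (convol pi mu) z)%:E = \int[pi]_y (cmk y z * dens mu (tsub z y))%:E)%E.
Proof.
rewrite -densE ge0_integral_convol; last 2 first.
- exact: measurable_cmk_l.
- by move=> x; rewrite lee_fin cmk_ge0.
apply: eq_integral => y _; rewrite EFinM -densE.
under eq_integral do rewrite cmkD EFinM.
rewrite ge0_integralZlT//; first exact: cmk_ge0.
- exact: measurable_cmk_l.
- by move=> x; rewrite lee_fin cmk_ge0.
Qed.

(** The weight |z| is the transport price of a rejection: the displaced point and its replacement
    are each charged their norm, which is [rej_map_cost] with [c] the norm. *)
Definition wdist mu nu : \bar R :=
  (\int[sg]_z (enorm z * `|dens mu z - dens nu z|)%:E)%E.

Definition sqdist mu nu : \bar R :=
  (\int[sg]_z ((dens mu z - dens nu z) ^+ 2)%:E)%E.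

Definition mom2 mu : \bar R := (\int[mu]_x (dot x x)%:E)%E.

Definition symm mu := forall u : E -> \bar R, measurable_fun [set: E] u ->
  (forall x, (0 <= u x)%E) -> (\int[mu]_x u (tscale (-1) x) = \int[mu]_x u x)%E.

Lemma measurable_normsq : measurable_fun [set: E] (fun x : E => (dot x x)%:E).
Proof. by apply/measurable_EFinP; exact: measurable_dot. Qed.

(** The integral equals its reflection, and in the sum of the two the cross term cancels pointwise.
    This covers an infinite [mom2 mu]. *)
Lemma mom2_shift mu y : symm mu ->
  (\int[mu]_x (dot (tadd y x) (tadd y x))%:E = (dot y y)%:E + mom2 mu)%E.
Proof.
move=> smu.
have ms : measurable_fun [set: E] (fun x => (dot (tadd y x) (tadd y x))%:E).
  by apply/measurable_EFinP; apply: measurable_dot; exact: measurable_tadd.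
have ms' : measurable_fun [set: E]
    (fun x => (dot (tadd y (tscale (-1) x)) (tadd y (tscale (-1) x)))%:E).
  apply/measurable_EFinP; apply: measurable_dot; apply: measurable_tadd => //;
    exact: measurable_tscale.
have p0 x : (0 <= (dot (tadd y x) (tadd y x))%:E)%E by rewrite lee_fin dot_ge0.
have := smu _ ms p0; set I := (\int[mu]_x (dot (tadd y x) (tadd y x))%:E)%E => II.
have I2 : (2%:E * I = 2%:E * ((dot y y)%:E + mom2 mu))%E.
  have MD (r : R) (M : \bar R) : (2%:E * (r%:E + M) = (2 * r)%:E + 2%:E * M)%E.
    by rewrite muleDr ?fin_num_adde_defr.
  have E2 : (2%:E * mom2 mu = \int[mu]_x (2%:E * (dot x x)%:E))%E.
    rewrite ge0_integralZlT//; first exact: measurable_normsq.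
    by move=> x; rewrite lee_fin dot_ge0.
  rewrite MD -(integral_prob_cst mu (2 * dot y y)) E2.
  rewrite -ge0_integralDT; [|exact: measurable_cst
    |by apply: emeasurable_funM => //; exact: measurable_normsq
    |by move=> x; rewrite lee_fin mulr_ge0 ?dot_ge0
    |by move=> x; rewrite mule_ge0// lee_fin dot_ge0].
  rewrite (_ : (2%:E * I = I + I)%E); last first.
    have -> : (2 : R) = 1 + 1 by lra.
    by rewrite EFinD ge0_muleDl ?lee01// !mul1e.
  rewrite -{1}II /I -ge0_integralDT//.
  apply: eq_integral => x _; rewrite -EFinM -!EFinD; congr (_%:E).
  rewrite !normsqD !(dotZl, dotZr); ring.
have /= := congr1 (fun z => (2^-1)%:E * z)%E I2.
by rewrite !muleA -EFinM mulVf ?pnatr_eq0// !mul1e.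
Qed.

Lemma mom2_convol pi mu : symm mu -> mom2 (convol pi mu) = (mom2 pi + mom2 mu)%E.
Proof.
move=> smu; rewrite {1}/mom2 ge0_integral_convol; last 2 first.
- exact: measurable_normsq.
- by move=> x; rewrite lee_fin dot_ge0.
under eq_integral do rewrite mom2_shift//.
have m0 : (0 <= mom2 mu)%E by apply: integral_ge0 => x _; rewrite lee_fin dot_ge0.
rewrite ge0_integralDT//; last 2 first.
- exact: measurable_normsq.
- by move=> x; rewrite lee_fin dot_ge0.
congr (_ + _)%E; rewrite integral_cst// -[RHS]mule1; congr (_ * _)%E.
exact: probability_setT.
Qed.

Lemma symm_std_gauss : symm sg.
Proof. by move=> u mu u0; exact: std_gauss_opp. Qed.

Lemma mom2_cpow pi mu k (M : R) : symm mu -> (mom2 mu <= M%:E)%E ->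
  (mom2 (cpow pi mu k) <= mom2 pi + (k%:R * M)%:E)%E.
Proof.
move=> smu muM; elim: k => [|k IH] /=; first by rewrite mul0r adde0.
rewrite mom2_convol// -natr1 mulrDl mul1r EFinD.
by move: (mom2 _) (mom2 mu) (mom2 pi) IH muM => a b c h1 h2; rewrite addeA leeD.
Qed.

Lemma measurable_wd mu nu :
  measurable_fun [set: E] (fun z => (enorm z * `|dens mu z - dens nu z|)%:E).
Proof.
apply/measurable_EFinP; apply: measurable_funM; first exact: measurable_enorm.
by apply: measurableT_comp => //; apply: measurable_funB; exact: measurable_dens.
Qed.

Lemma wdist_triangle mu nu pi : (wdist mu pi <= wdist mu nu + wdist nu pi)%E.
Proof.
rewrite /wdist -ge0_integralDT//; last 4 first.
- exact: measurable_wd.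
- exact: measurable_wd.
- by move=> x; rewrite lee_fin mulr_ge0 ?enorm_ge0.
- by move=> x; rewrite lee_fin mulr_ge0 ?enorm_ge0.
apply: ge0_le_integralT.
- exact: measurable_wd.
- by apply: emeasurable_funD; exact: measurable_wd.
- by move=> x; rewrite lee_fin mulr_ge0 ?enorm_ge0.
- move=> x; rewrite -EFinD lee_fin -mulrDr ler_wpM2l ?enorm_ge0//.
  exact: ler_distD.
Qed.

(** Cost of exchanging one summand while the others, with law [pi], stay. Given their value [y], the
    difference of the densities is a shifted copy of that of [mu] and [nu]; undoing the shift turns
    the weight |z| into |y + z|, whose mean square is |y|^2 plus at most [N]. *)
Lemma wdist_step pi mu nu (eta lam L : R) : 0 < eta -> 0 < lam ->
  (sqdist mu nu <= (eta ^+ 2)%:E)%E ->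
  (mom2 pi + N%:R%:E <= L%:E)%E ->
  (wdist (convol pi mu) (convol pi nu) <=
     (eta / (2 * lam) * L + lam * eta / 2)%:E)%E.
Proof.
move=> eta0 lam0 hsq hL.
pose h z := `|dens mu z - dens nu z|.
have h0 z : 0 <= h z by exact: normr_ge0.
have mh : measurable_fun [set: E] h.
  by apply: measurableT_comp => //; apply: measurable_funB; exact: measurable_dens.
have mcd (rho : probability E R) z :
    measurable_fun [set: E] (fun y => cmk y z * dens rho (tsub z y)).
  apply: measurable_funM; first exact: measurable_cmk.
  by apply: (measurableT_comp (measurable_dens rho)); exact: measurable_tsub.
have mG : measurable_fun [set: E * E]
    (fun w : E * E => (enorm w.1 * (cmk w.2 w.1 * h (tsub w.1 w.2)))%:E).
  apply/measurable_EFinP; apply: measurable_funM; first exact: measurable_enorm_comp.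
  apply: measurable_funM; first exact: measurable_cmk.
  by apply: (measurableT_comp mh); exact: measurable_tsub.
have G0 z y : (0 <= (enorm z * (cmk y z * h (tsub z y)))%:E)%E.
  by rewrite lee_fin !mulr_ge0 ?enorm_ge0 ?cmk_ge0.
have step1 : (wdist (convol pi mu) (convol pi nu) <=
    \int[sg]_z \int[pi]_y (enorm z * (cmk y z * h (tsub z y)))%:E)%E.
  apply: ge0_le_integralT.
  - exact: measurable_wd.
  - exact: (@measurable_integral2 R _ _ _ _ pi
      (fun z y => (enorm z * (cmk y z * h (tsub z y)))%:E) mG G0).
  - by move=> z; rewrite lee_fin mulr_ge0 ?enorm_ge0.
  - move=> z; under eq_integral do rewrite EFinM.
    rewrite ge0_integralZlT ?enorm_ge0//; last 2 first.
    + apply/measurable_EFinP; apply: measurable_funM; first exact: measurable_cmk.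
      by apply: (measurableT_comp mh); exact: measurable_tsub.
    + by move=> y; rewrite lee_fin mulr_ge0 ?cmk_ge0.
    rewrite EFinM lee_wpmul2l ?lee_fin ?enorm_ge0//.
    have := @abs_integral_diff R _ E pi _ _ _ _ (mcd mu z) (mcd nu z)
      (fun y => mulr_ge0 (cmk_ge0 _ _) (dens_ge0 _ _))
      (fun y => mulr_ge0 (cmk_ge0 _ _) (dens_ge0 _ _))
      (esym (dens_convol pi mu z)) (esym (dens_convol pi nu z)).
    move=> H; apply: (le_trans H); rewrite le_eqVlt; apply/orP; left; apply/eqP.
    by apply: eq_integral => y _; rewrite -mulrBr normrM (ger0_norm (cmk_ge0 _ _)).
apply: (le_trans step1).
rewrite (@tonelli_swap R _ _ _ _ sg pi
  (fun z y => (enorm z * (cmk y z * h (tsub z y)))%:E) mG G0).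
have mS y : measurable_fun [set: E] (fun z => (dot (tadd y z) (tadd y z))%:E).
  by apply/measurable_EFinP; apply: measurable_dot; exact: measurable_tadd.
have c1 : 0 <= eta / (2 * lam) by rewrite divr_ge0 ?mulr_ge0 ?ltW.
have c2 : 0 <= lam / (2 * eta) by rewrite divr_ge0 ?mulr_ge0 ?ltW.
have mh2 : measurable_fun [set: E] (fun z => ((dens mu z - dens nu z) ^+ 2)%:E).
  apply/measurable_EFinP; apply: measurable_funX.
  by apply: measurable_funB; exact: measurable_dens.
have inner y : (\int[sg]_z (enorm z * (cmk y z * h (tsub z y)))%:E <=
    (eta / (2 * lam))%:E * ((dot y y)%:E + N%:R%:E) + (lam * eta / 2)%:E)%E.
  have mu1 : measurable_fun [set: E] (fun z => (enorm z * h (tsub z y))%:E).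
    apply/measurable_EFinP; apply: measurable_funM; first exact: measurable_enorm.
    by apply: (measurableT_comp mh); exact: measurable_tsub.
  have u10 z : (0 <= (enorm z * h (tsub z y))%:E)%E by rewrite lee_fin mulr_ge0 ?enorm_ge0.
  (* Cameron-Martin read backwards: the factor [cmk y z] is absorbed by translating [z]. *)
  have -> : (\int[sg]_z (enorm z * (cmk y z * h (tsub z y)))%:E =
      \int[sg]_z (enorm (tadd y z) * h z)%:E)%E.
    transitivity (\int[sg]_z ((enorm z * h (tsub z y))%:E * (cmk y z)%:E))%E.
      by apply: eq_integral => z _; rewrite -EFinM; congr (_%:E); ring.
    rewrite -(std_gauss_shift y mu1 u10).
    by apply: eq_integral => z _; rewrite tsubK.
  apply: (@le_trans _ _ (\int[sg]_z ((eta / (2 * lam))%:E * (dot (tadd y z) (tadd y z))%:E +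
      (lam / (2 * eta))%:E * ((dens mu z - dens nu z) ^+ 2)%:E))%E).
    apply: ge0_le_integralT.
    - apply/measurable_EFinP; apply: measurable_funM => //.
      by apply: measurable_enorm_comp; exact: measurable_tadd.
    - by apply: emeasurable_funD; exact: emeasurable_funM.
    - by move=> z; rewrite lee_fin mulr_ge0 ?enorm_ge0.
    - move=> z; rewrite -!EFinM -EFinD lee_fin -enorm_sqr.
      have -> : (dens mu z - dens nu z) ^+ 2 = h z ^+ 2 by rewrite real_normK ?num_real.
      set a := enorm _; set b := h z.
      (* Weighted arithmetic-geometric mean. As [b] has mean square at most [eta ^+ 2], the two
         halves balance when the mean square of [a] is [lam ^+ 2]. *)
      have -> : eta / (2 * lam) * a ^+ 2 + lam / (2 * eta) * b ^+ 2 =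
         a * b + (eta * a - lam * b) ^+ 2 / (2 * lam * eta).
        by field; rewrite !gt_eqF.
      by rewrite lerDl divr_ge0 ?sqr_ge0// !mulr_ge0 ?ltW.
  rewrite ge0_integralDT; last 4 first.
  - exact: emeasurable_funM.
  - exact: emeasurable_funM.
  - by move=> z; rewrite mule_ge0// lee_fin dot_ge0.
  - by move=> z; rewrite mule_ge0// lee_fin sqr_ge0.
  apply: leeD.
  - rewrite ge0_integralZlT//; last by move=> z; rewrite lee_fin dot_ge0.
    rewrite mom2_shift; last exact: symm_std_gauss.
    rewrite lee_wpmul2l ?lee_fin// leeD2l//; exact: std_gauss_normsq.
  - rewrite ge0_integralZlT//; last by move=> z; rewrite lee_fin sqr_ge0.
    apply: (@le_trans _ _ ((lam / (2 * eta))%:E * (eta ^+ 2)%:E)%E).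
      by rewrite lee_wpmul2l ?lee_fin.
    by rewrite -EFinM lee_fin le_eqVlt; apply/orP; left; apply/eqP; field; rewrite gt_eqF.
have ms0 : measurable_fun [set: E] (fun y : E => ((dot y y)%:E + N%:R%:E)%E).
  by apply: emeasurable_funD => //; exact: measurable_normsq.
have ms1 : measurable_fun [set: E]
    (fun y : E => ((eta / (2 * lam))%:E * ((dot y y)%:E + N%:R%:E))%E).
  exact: emeasurable_funM.
have mI : measurable_fun [set: E]
    (fun y => \int[sg]_z (enorm z * (cmk y z * h (tsub z y)))%:E)%E.
  exact: (@measurable_integral1 R _ _ _ _ sg
      (fun z y => (enorm z * (cmk y z * h (tsub z y)))%:E) mG G0).
apply: (@le_trans _ _ (\int[pi]_y ((eta / (2 * lam))%:E * ((dot y y)%:E + N%:R%:E) +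
    (lam * eta / 2)%:E))%E).
  apply: ge0_le_integralT => //.
  - exact: emeasurable_funD.
  - by move=> y; apply: integral_ge0 => z _; exact: G0.
rewrite ge0_integralDT//; last 2 first.
- by move=> y; rewrite -EFinD -EFinM lee_fin mulr_ge0// addr_ge0 ?dot_ge0.
- by move=> y; rewrite lee_fin divr_ge0// mulr_ge0 ?ltW.
rewrite integral_prob_cst EFinD leeD2r// ge0_integralZlT//; last first.
  by move=> y; rewrite -EFinD lee_fin addr_ge0 ?dot_ge0.
rewrite ge0_integralDT//; last 2 first.
- exact: measurable_normsq.
- by move=> y; rewrite lee_fin dot_ge0.
by rewrite integral_prob_cst [X in (_ <= X)%E]EFinM lee_wpmul2l ?lee_fin.
Qed.

(** Lindeberg's replacement: exchange the last summand, move it into the initial law, and continue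
    with the [k] others. The second-moment budget [lam ^+ 2] is preserved, because what [pi] gains
    is bounded by the [M] freed by the summand; each exchange costs [eta * lam]. *)
Lemma wdist_cpow pi mu nu k (eta lam M : R) : 0 < eta -> 0 < lam -> 0 <= M ->
  symm mu -> symm nu -> (mom2 mu <= M%:E)%E -> (mom2 nu <= M%:E)%E ->
  (sqdist mu nu <= (eta ^+ 2)%:E)%E ->
  (mom2 pi + (k%:R * M + N%:R)%:E <= (lam ^+ 2)%:E)%E ->
  (wdist (cpow pi mu k) (cpow pi nu k) <= (k%:R * eta * lam)%:E)%E.
Proof.
move=> eta0 lam0 M0 smu snu mM nM hsq; elim: k pi => [|k IH] pi hpi.
  rewrite /wdist /= !mul0r integral0_eq// => z _.
  by rewrite subrr normr0 mulr0.
have hk : ((k.+1%:R : R) * M + N%:R = M + (k%:R * M + N%:R)).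
  by rewrite -natr1; ring.
have hstep : (mom2 (cpow pi mu k) + N%:R%:E <= (lam ^+ 2)%:E)%E.
  apply: le_trans hpi; apply: (@le_trans _ _ (mom2 pi + (k%:R * M)%:E + N%:R%:E)%E).
    by rewrite leeD2r// mom2_cpow.
  by rewrite -addeA -EFinD leeD2l// lee_fin hk lerDr.
have hpi' : (mom2 (convol pi nu) + (k%:R * M + N%:R)%:E <= (lam ^+ 2)%:E)%E.
  apply: le_trans hpi; rewrite mom2_convol// hk (EFinD M).
  by move: (mom2 pi) (mom2 nu) nM => a b ab; rewrite addeA leeD2r// leeD2l.
have E1 := wdist_step eta0 lam0 hsq hstep.
have E2 := IH _ hpi'.
(* The exchanged summand passes to the front, which restores the shape of the induction
   hypothesis. *)
have D : dens (convol (cpow pi mu k) nu) = dens (cpow (convol pi nu) mu k).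
  by apply: eq_dens => u mu_ u0; exact: cpow_convol_integral.
apply: (le_trans (wdist_triangle _ (convol (cpow pi mu k) nu) _)).
have -> : cpow pi nu k.+1 = cpow (convol pi nu) nu k by rewrite /cpow iterSr.
rewrite {2}/wdist D.
apply: (le_trans (leeD E1 E2)); rewrite -EFinD lee_fin -natr1.
rewrite le_eqVlt; apply/orP; left; apply/eqP; field; exact: lt0r_neq0.
Qed.

End density_of_convolution.

(** * The chi-square bound for one step *)

Section cosh.
Context {R : realType}.

(** A bound for a second derivative. Integrated twice in [two_cosh_ub], the constant 8/3 becomes 2/9
    in front of u^4, and the coefficient of u^2 comes out as exactly 1. *)
Lemma two_cosh_crude (u : R) : 0 <= u -> u <= 2^-1 ->
  expR u + expR (- u) <= 2 + 8 / 3 * u ^+ 2.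
Proof.
move=> u0 u1.
have h1 := @expR_le_inv R u ltac:(lra).
have h2 := @expR_le_inv R (- u) ltac:(lra).
apply: (le_trans (lerD h1 h2)).
have -> : (1 - u)^-1 + (1 - - u)^-1 = 2 / (1 - u ^+ 2).
  field; apply/and3P; split; apply/eqP; nra.
rewrite ler_pdivrMr; last by nra.
have : 0 <= u ^+ 2 * (4^-1 - u ^+ 2) by rewrite mulr_ge0 ?sqr_ge0//; nra.
lra.
Qed.

(* The exact coefficient 1 of u^2 is what makes the second moments cancel in
   [chi2_bound]. *)
Lemma two_cosh_ub (u : R) : `|u| <= 2^-1 ->
  expR u + expR (- u) <= 2 + u ^+ 2 + 2 / 9 * u ^+ 4.
Proof.
wlog u0 : u / 0 <= u => [H|].
  have [|u0 hu] := leP 0 u; first exact: H.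
  have := H (- u); rewrite normrN opprK sqrrN => /(_ _ hu) H'.
  rewrite addrC; have -> : u ^+ 4 = (- u) ^+ 4 by ring.
  by apply: H'; rewrite oppr_ge0 ltW.
rewrite ger0_norm// => u1.
pose F2 (x : R) := 2 + 8 / 3 * x ^+ 2 - (expR x + expR (- x)).
pose F1 (x : R) := 2 * x + 8 / 9 * x ^+ 3 - (expR x - expR (- x)).
pose F0 (x : R) := x ^+ 2 + 2 / 9 * x ^+ 4 - (expR x + expR (- x)).
have dE (x : R) : is_derive x 1 (fun x : R => expR (- x)) (- expR (- x)).
  have := @is_derive1_comp R expR (fun x => - x) x (expR (- x)) (-1).
  by rewrite mulrN1; apply.
have d1 (x : R) : is_derive x 1 F1 (F2 x).
  rewrite /F1.
  apply: is_derive_eq.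
  by rewrite /F2 /GRing.scale/=; field.
have d0 (x : R) : is_derive x 1 F0 (F1 x).
  rewrite /F0.
  apply: is_derive_eq.
  by rewrite /F1 /GRing.scale/=; field.
have F1ge x : 0 <= x -> x <= 2^-1 -> 0 <= F1 x.
  move=> x0 x1; have F10 : F1 0 = 0 by rewrite /F1 oppr0 expR0; ring.
  have [->|xn0] := eqVneq x 0; first by rewrite F10.
  have xp : 0 < x by rewrite lt_neqAle eq_sym xn0.
  have [|c cx] := @MVT R F1 F2 0 x xp (fun y _ => d1 y).
    apply: derivable_within_continuous => y _; exact: ex_derive.
  rewrite F10 !subr0 => ->; rewrite mulr_ge0//.
  move: cx; rewrite in_itv/= => /andP[c0 c1].
  by have := @two_cosh_crude c (ltW c0) ltac:(lra); rewrite /F2; lra.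
have F0ge : -2 <= F0 u.
  have F00 : F0 0 = -2 by rewrite /F0 oppr0 expR0; ring.
  have [->|xn0] := eqVneq u 0; first by rewrite F00.
  have xp : 0 < u by rewrite lt_neqAle eq_sym xn0.
  have [|c cx] := @MVT R F0 F1 0 u xp (fun y _ => d0 y).
    apply: derivable_within_continuous => y _; exact: ex_derive.
  rewrite F00 !subr0 => H.
  move: cx; rewrite in_itv/= => /andP[c0 c1].
  have : 0 <= F1 c * u by rewrite mulr_ge0// F1ge ?(ltW c0)//; lra.
  by rewrite -H; lra.
by move: F0ge; rewrite /F0; lra.
Qed.

End cosh.

Section chi2.
Context {R : realType} (N : nat).
Local Notation E := (N.-tuple R).
Notation sg := (@std_gauss R).
Implicit Types mu nu : probability E R.

Definition expI mu nu : \bar R := (\int[mu]_x \int[nu]_y (expR (dot x y))%:E)%E.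

Lemma measurable_expR_dot d (T : measurableType d) (f g : T -> E) :
  measurable_fun [set: T] f -> measurable_fun [set: T] g ->
  measurable_fun [set: T] (fun t => (expR (dot (f t) (g t)))%:E).
Proof.
move=> mf mg; apply/measurable_EFinP; apply: measurableT_comp => //.
exact: measurable_dot.
Qed.

(** Expand both densities as averages of kernels, apply Tonelli twice and use [cmkM]. *)
Lemma integral_dens_prod mu nu :
  (\int[sg N]_z (dens mu z * dens nu z)%:E = expI mu nu)%E.
Proof.
have m1 : measurable_fun [set: E * E] (fun w : E * E => (cmk w.2 w.1 * dens nu w.1)%:E).
  apply/measurable_EFinP; apply: measurable_funM; first exact: measurable_cmk.
  exact: (measurableT_comp (measurable_dens nu)).
have p1 z x : (0 <= (cmk x z * dens nu z)%:E)%E.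
  by rewrite lee_fin mulr_ge0 ?cmk_ge0 ?dens_ge0.
transitivity (\int[sg N]_z \int[mu]_x (cmk x z * dens nu z)%:E)%E.
  apply: eq_integral => z _; under [RHS]eq_integral do rewrite EFinM.
  rewrite ge0_integralZrT ?dens_ge0//; last 2 first.
  - exact: measurable_cmk_l.
  - by move=> x; rewrite lee_fin cmk_ge0.
  by rewrite densE -EFinM.
rewrite (@tonelli_swap R _ _ _ _ (sg N) mu (fun z x => (cmk x z * dens nu z)%:E) m1 p1).
apply: eq_integral => x _.
have m2 : measurable_fun [set: E * E] (fun w : E * E => (cmk x w.1 * cmk w.2 w.1)%:E).
  by apply/measurable_EFinP; apply: measurable_funM; exact: measurable_cmk.
have p2 z y : (0 <= (cmk x z * cmk y z)%:E)%E.
  by rewrite lee_fin mulr_ge0 ?cmk_ge0.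
transitivity (\int[sg N]_z \int[nu]_y (cmk x z * cmk y z)%:E)%E.
  apply: eq_integral => z _; under [RHS]eq_integral do rewrite EFinM.
  rewrite ge0_integralZlT ?cmk_ge0//; last 2 first.
  - exact: measurable_cmk_l.
  - by move=> y; rewrite lee_fin cmk_ge0.
  by rewrite densE -EFinM.
rewrite (@tonelli_swap R _ _ _ _ (sg N) nu (fun z y => (cmk x z * cmk y z)%:E) m2 p2).
apply: eq_integral => y _; under eq_integral do rewrite cmkM EFinM.
rewrite ge0_integralZlT ?expR_ge0//; last 2 first.
- exact: measurable_cmk_r.
- by move=> z; rewrite lee_fin cmk_ge0.
by rewrite std_gauss_cmk mule1.
Qed.

Lemma sqdist_le mu nu (a b c : R) : (expI mu mu <= a%:E)%E ->
  (expI nu nu <= b%:E)%E -> (c%:E <= expI mu nu)%E ->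
  (sqdist mu nu <= (a + b - 2 * c)%:E)%E.
Proof.
move=> ha hb hc.
have md (m1 m2 : probability E R) :
    measurable_fun [set: E] (fun z => (dens m1 z * dens m2 z)%:E).
  by apply/measurable_EFinP; apply: measurable_funM; exact: measurable_dens.
have pd (m1 m2 : probability E R) z : (0 <= (dens m1 z * dens m2 z)%:E)%E.
  by rewrite lee_fin mulr_ge0 ?dens_ge0.
have ms : measurable_fun [set: E] (fun z => ((dens mu z - dens nu z) ^+ 2)%:E).
  apply/measurable_EFinP; apply: measurable_funX.
  by apply: measurable_funB; exact: measurable_dens.
have ps z : (0 <= ((dens mu z - dens nu z) ^+ 2)%:E)%E by rewrite lee_fin sqr_ge0.
(* The expanded square, with the cross term on the left because any of these integrals could still
   be infinite. *)
have key : (sqdist mu nu + 2%:E * expI mu nu = expI mu mu + expI nu nu)%E.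
  rewrite -!integral_dens_prod /sqdist.
  rewrite -ge0_integralZlT//.
  have m2 : measurable_fun [set: E] (fun z => (2%:E * (dens mu z * dens nu z)%:E)%E).
    exact: emeasurable_funM.
  rewrite -(ge0_integralDT _ ms m2 ps); last by move=> z; rewrite mule_ge0.
  rewrite -(ge0_integralDT _ (md mu mu) (md nu nu) (pd _ _) (pd _ _)).
  by apply: eq_integral => z _; rewrite -EFinM -!EFinD; congr (_%:E); ring.
have : (sqdist mu nu + 2%:E * expI mu nu <= a%:E + b%:E)%E by rewrite key leeD.
have s0 : (0 <= sqdist mu nu)%E by apply: integral_ge0 => z _; exact: ps.
move: (sqdist mu nu) (expI mu nu) s0 hc => [x| |] [y| |] //=;
  rewrite ?gt0_muley ?lte_fin// -?EFinM -?EFinD ?lee_fin; try lra.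
Qed.

Definition lin m n (A : 'M[R]_(m, n)) (z : n.-tuple R) : m.-tuple R :=
  affine A (tzero m) z.

Lemma tnth_lin m n (A : 'M[R]_(m, n)) z i : tnth (lin A z) i = \sum_j A i j * tnth z j.
Proof. by rewrite tnth_mktuple tE add0r. Qed.

Lemma measurable_lin m n (A : 'M[R]_(m, n)) : measurable_fun [set: n.-tuple R] (lin A).
Proof. exact: measurable_affine. Qed.

Lemma dot_lin m n (A : 'M[R]_(m, n)) (x : m.-tuple R) (z : n.-tuple R) :
  dot x (lin A z) = dot (lin A^T x) z.
Proof.
rewrite /dot.
under eq_bigr do rewrite tnth_lin mulr_sumr.
under [RHS]eq_bigr do rewrite tnth_lin mulr_suml.
rewrite exchange_big; apply: eq_bigr => j _; apply: eq_bigr => i _.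
by rewrite mxE; ring.
Qed.

Context d (D : measurableType d) (Q : probability D R) (X : D -> E).
Hypothesis mX : measurable_fun [set: D] X.
Variable b : R.
Hypothesis Xb : forall w, dot (X w) (X w) <= b.

Definition cov (y : E) : R := fine (\int[Q]_w (dot y (X w) ^+ 2)%:E).

Lemma measurable_dotX2 y : measurable_fun [set: D] (fun w => (dot y (X w) ^+ 2)%:E).
Proof.
by apply/measurable_EFinP; apply: measurable_funX; exact: measurable_dot.
Qed.

Lemma dotX_ub y w : dot y (X w) ^+ 2 <= dot y y * b.
Proof.
by apply: (le_trans (cauchy_schwarz _ _)); rewrite ler_wpM2l ?dot_ge0.
Qed.

Lemma covE y : (\int[Q]_w (dot y (X w) ^+ 2)%:E = (cov y)%:E)%E.
Proof.
rewrite /cov fineK// ge0_fin_numE; last first.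
  by apply: integral_ge0 => w _; rewrite lee_fin sqr_ge0.
apply: (@le_lt_trans _ _ (dot y y * b)%:E); last exact: ltry.
rewrite -(integral_prob_cst Q); apply: ge0_le_integralT => //.
- exact: measurable_dotX2.
- by move=> w; rewrite lee_fin sqr_ge0.
- by move=> w; rewrite lee_fin dotX_ub.
Qed.

Lemma cov_ge0 y : 0 <= cov y.
Proof.
by rewrite -lee_fin -covE; apply: integral_ge0 => w _; rewrite lee_fin sqr_ge0.
Qed.

Lemma cov_ub y : cov y <= dot y y * b.
Proof.
rewrite -lee_fin -covE -(integral_prob_cst Q); apply: ge0_le_integralT => //.
- exact: measurable_dotX2.
- by move=> w; rewrite lee_fin sqr_ge0.
- by move=> w; rewrite lee_fin dotX_ub.
Qed.

Lemma measurable_cov : measurable_fun [set: E] cov.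
Proof.
apply/measurable_EFinP.
rewrite (_ : _ \o _ = fun y => \int[Q]_w (dot y (X w) ^+ 2)%:E)%E.
  apply: (@measurable_integral2 R _ _ _ _ Q (fun y w => (dot y (X w) ^+ 2)%:E)).
    apply/measurable_EFinP; apply: measurable_funX; apply: measurable_dot => //.
    exact: measurableT_comp.
  by move=> x y; rewrite lee_fin sqr_ge0.
by apply/funext => y /=; rewrite covE.
Qed.

Lemma integrable_XX i j :
  Q.-integrable [set: D] (EFin \o (fun w => tnth (X w) i * tnth (X w) j)).
Proof.
have mt l : measurable_fun [set: D] (fun w => tnth (X w) l).
  by have /measurable_fun_tnthP := mX => /(_ l).
have bt l w : tnth (X w) l ^+ 2 <= b.
  apply: le_trans (Xb w); rewrite /dot (bigD1 l)//= -expr2 lerDl sumr_ge0// => m _.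
  by rewrite -expr2 sqr_ge0.
apply: measurable_bounded_integrable => //.
- by rewrite (le_lt_trans (probability_le1 _ _))// ltry.
- exact: measurable_funM.
- exists b; split; first exact: num_real.
  move=> x bx w _ /=; apply: le_trans (ltW bx).
  rewrite ler_norml; have := bt i w; have := bt j w => h1 h2.
  have := sqr_ge0 (tnth (X w) i - tnth (X w) j).
  have := sqr_ge0 (tnth (X w) i + tnth (X w) j).
  by move=> h3 h4; apply/andP; split; nra.
Qed.

(** Cholesky applied to the second-moment matrix of [X]. For a standard Gaussian Z the vector A Z
    then has the covariance of [X], which is how [gcov] is used below. *)
Lemma cov_root : exists A : 'M[R]_N,
  forall y, dot (lin A^T y) (lin A^T y) = cov y.
Proof.
pose S : 'M[R]_N :=
  \matrix_(i, j) (\int[Q]_w (tnth (X w) i * tnth (X w) j))%R.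
have SE (y : E) : cov y = \sum_i \sum_j tnth y i * tnth y j * S i j.
  have -> : cov y = (\int[Q]_w (dot y (X w) ^+ 2))%R by [].
  have yE : forall w, dot y (X w) ^+ 2 =
      \sum_(p : 'I_N * 'I_N) (tnth y p.1 * tnth y p.2) * (tnth (X w) p.1 * tnth (X w) p.2).
    move=> w; rewrite expr2 /dot big_distrlr/= pair_big/=.
    by apply: eq_bigr => p _; ring.
  rewrite pair_big/= /Rintegral.
  under eq_integral do rewrite yE -sumEFin.
  rewrite integral_sum//; last first.
    move=> p; have := @integrableZl _ _ _ Q _ measurableT (tnth y p.1 * tnth y p.2) _
      (integrable_XX p.1 p.2).
    by apply: eq_integrable => // w _ /=; rewrite EFinM.
  transitivity (fine (\sum_p (tnth y p.1 * tnth y p.2 * S p.1 p.2)%:E)%E).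
    congr fine; apply: eq_bigr => p _.
    under eq_integral do rewrite EFinM.
    rewrite integralZl//; last exact: integrable_XX.
    have -> : S p.1 p.2 = fine (\int[Q]_w (tnth (X w) p.1 * tnth (X w) p.2)%:E)%E.
      by rewrite mxE.
    rewrite [RHS]EFinM fineK//.
    exact: (integrable_fin_num measurableT (integrable_XX _ _)).
  by rewrite sumEFin.
have Ssym : S^T = S.
  by apply/matrixP => i j; rewrite !mxE; apply: eq_Rintegral => w _; rewrite mulrC.
have qE (x : 'rV[R]_N) : qform S x = cov [tuple x 0 i | i < N].
  rewrite SE /qform mxE.
  under eq_bigr do rewrite mxE mulr_suml.
  rewrite exchange_big; apply: eq_bigr => i _; apply: eq_bigr => j _.
  by rewrite !tnth_mktuple !mxE; ring.
have [x|A SA] := cholesky Ssym; first by rewrite qE cov_ge0.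
exists A => y; rewrite SE.
rewrite -dot_lin /dot; apply: eq_bigr => i _.
rewrite tnth_lin mulr_sumr.
under eq_bigr do rewrite tnth_lin mulr_sumr mulr_sumr.
rewrite exchange_big; apply: eq_bigr => j _.
rewrite SA mxE mulr_sumr; apply: eq_bigr => l _.
by rewrite !mxE; ring.
Qed.

End chi2.

Lemma ereal_half {R : realType} (x y : \bar R) (q : R) : (0 <= x)%E -> (0 <= y)%E ->
  (x + x <= (2 + q)%:E + (2 / 9)%:E * y)%E ->
  (x <= (1 + q / 2)%:E + (9^-1)%:E * y)%E.
Proof.
move: x y => [x| |] [y| |] //= _ _;
  rewrite ?gt0_muley ?lte_fin// -?EFinM -?EFinD ?lee_fin ?leey//; try lra.
Qed.

Section chi2_bound.
Context {R : realType} (N : nat) d (D : measurableType d) (Q : probability D R).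
Local Notation E := (N.-tuple R).
Notation sg := (@std_gauss R).
Variable X : D -> E.
Hypothesis mX : measurable_fun [set: D] X.
Hypothesis Xb : forall w, dot (X w) (X w) <= 2^-1.
Hypothesis sX : symm (law Q mX).
Variable A : 'M[R]_N.
Hypothesis covA : forall y, dot (lin A^T y) (lin A^T y) = cov Q X y.
Variable M4 : R.
Hypothesis hM4 : (\int[Q]_v \int[Q]_w (dot (X v) (X w) ^+ 4)%:E <= M4%:E)%E.

Definition gcov : probability E R := law (sg N) (measurable_lin A).

Let covX_ub v : cov Q X (X v) <= 4^-1.
Proof.
apply: (le_trans (cov_ub Q mX Xb _)); have := Xb v; have := dot_ge0 (X v); lra.
Qed.

Let m_covX : measurable_fun [set: D] (fun v => cov Q X (X v)).
Proof. exact: (measurableT_comp (measurable_cov Q mX Xb) mX). Qed.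

Let m_covXE : measurable_fun [set: D] (fun v => (cov Q X (X v))%:E).
Proof. exact/measurable_EFinP. Qed.

Let covX_ge0 v : 0 <= cov Q X (X v).
Proof. exact: cov_ge0. Qed.

(** This is E<X,X'>^2 for an independent copy X'. All three inner products in [sqdist_le] contain 1
    + q2/2, which is the part that cancels. *)
Let q2 : R := fine (\int[Q]_v (cov Q X (X v))%:E).

Let q2E : (\int[Q]_v (cov Q X (X v))%:E = q2%:E)%E.
Proof.
rewrite /q2 fineK// ge0_fin_numE; last first.
  by apply: integral_ge0 => v _; rewrite lee_fin.
apply: (@le_lt_trans _ _ (4^-1)%:E); last exact: ltry.
by rewrite -(integral_prob_cst Q); apply: ge0_le_integralT.
Qed.

Let m4 : measurable_fun [set: D * D] (fun z : D * D => (dot (X z.1) (X z.2) ^+ 4)%:E).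
Proof.
apply/measurable_EFinP; apply: measurable_funX; apply: measurable_dot;
  exact: measurableT_comp.
Qed.

Let m4i : measurable_fun [set: D] (fun v => \int[Q]_w (dot (X v) (X w) ^+ 4)%:E)%E.
Proof.
apply: (@measurable_integral2 R _ _ _ _ Q (fun v w => (dot (X v) (X w) ^+ 4)%:E)) => //.
by move=> x y; rewrite lee_fin exprn_even_ge0.
Qed.

Let p4i v : (0 <= \int[Q]_w (dot (X v) (X w) ^+ 4)%:E)%E.
Proof. by apply: integral_ge0 => w _; rewrite lee_fin exprn_even_ge0. Qed.

(** Symmetry of the law replaces the exponential by a hyperbolic cosine, and |X|^2 <= 1/2 puts
    <X,X'> in the range of [two_cosh_ub]. *)
Let inner_ub v :
  (\int[law Q mX]_y (expR (dot (X v) y))%:E <=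
   (1 + cov Q X (X v) / 2)%:E + (9^-1)%:E * \int[Q]_w (dot (X v) (X w) ^+ 4)%:E)%E.
Proof.
have me : measurable_fun [set: E] (fun y => (expR (dot (X v) y))%:E).
  exact: measurable_expR_dot.
have pe y : (0 <= (expR (dot (X v) y))%:E)%E by rewrite lee_fin expR_ge0.
have mo : measurable_fun [set: E] (fun y => (expR (dot (X v) (tscale (-1) y)))%:E).
  by apply: measurable_expR_dot => //; exact: measurable_tscale.
have po y : (0 <= (expR (dot (X v) (tscale (-1) y)))%:E)%E by rewrite lee_fin expR_ge0.
have J2 : (\int[law Q mX]_y (expR (dot (X v) y))%:E +
   \int[law Q mX]_y (expR (dot (X v) y))%:E <=
   (2 + cov Q X (X v))%:E + (2 / 9)%:E * \int[Q]_w (dot (X v) (X w) ^+ 4)%:E)%E.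
  rewrite -{2}(sX me pe) -(ge0_integralDT _ me mo pe po).
  have m1 : measurable_fun [set: D] (fun w => (dot (X v) (X w) ^+ 4)%:E).
    by apply/measurable_EFinP; apply: measurable_funX; exact: measurable_dot.
  have p1 w : (0 <= (dot (X v) (X w) ^+ 4)%:E)%E by rewrite lee_fin exprn_even_ge0.
  have m2 : measurable_fun [set: D] (fun w => (dot (X v) (X w) ^+ 2)%:E).
    exact: (measurable_dotX2 mX).
  have p2 w : (0 <= (dot (X v) (X w) ^+ 2)%:E)%E by rewrite lee_fin sqr_ge0.
  rewrite -(ge0_integralZlT _ _ m1 p1)// EFinD -(integral_prob_cst Q 2) -(covE Q mX Xb).
  have m3 : measurable_fun [set: D] (fun w => (2 + dot (X v) (X w) ^+ 2)%:E).
    by apply/measurable_EFinP; apply: measurable_funD => //; exact/measurable_EFinP.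
  have p0 : forall w : D, (0 <= (2 : R)%:E)%E by rewrite lee_fin.
  rewrite -(ge0_integralDT _ (measurable_cst _) m2 p0 p2).
  have m5 : measurable_fun [set: D] (fun w => ((2 / 9)%:E * (dot (X v) (X w) ^+ 4)%:E)%E).
    exact: emeasurable_funM.
  rewrite -(ge0_integralDT _ m3 m5); last 2 first.
  - by move=> w; rewrite lee_fin addr_ge0// sqr_ge0.
  - by move=> w; rewrite mule_ge0.
  rewrite ge0_integral_law; last 2 first.
  - exact: emeasurable_funD.
  - by move=> y; rewrite adde_ge0.
  apply: ge0_le_integralT.
  - apply: emeasurable_funD; apply: measurable_expR_dot => //.
    exact: measurable_tscale.
  - exact: emeasurable_funD.
  - by move=> w; rewrite adde_ge0.
  - move=> w; rewrite -EFinM -!EFinD lee_fin dotZr mulN1r.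
    apply: two_cosh_ub; rewrite -(@ler_pXn2r _ 2) ?nnegrE//.
    rewrite real_normK ?num_real// expr2.
    by apply: (le_trans (cauchy_schwarz _ _)); rewrite ler_pM ?dot_ge0.
have J0 : (0 <= \int[law Q mX]_y (expR (dot (X v) y))%:E)%E by exact: integral_ge0.
exact: (ereal_half J0 (p4i v) J2).
Qed.

Let II_mu : (expI (law Q mX) (law Q mX) <= (1 + q2 / 2 + M4 / 9)%:E)%E.
Proof.
have me : measurable_fun [set: E * E] (fun z : E * E => (expR (dot z.1 z.2))%:E).
  exact: measurable_expR_dot.
have mi := @measurable_integral2 R _ _ _ _ (law Q mX) (fun x y => (expR (dot x y))%:E) me
  (fun x y => expR_ge0 _).
rewrite /expI ge0_integral_law//; last first.
  by move=> x; apply: integral_ge0 => y _; rewrite lee_fin expR_ge0.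
have ma : measurable_fun [set: D] (fun v => (1 + cov Q X (X v) / 2)%:E).
  by apply/measurable_EFinP; apply: measurable_funD => //; exact: measurable_funM.
have mb : measurable_fun [set: D]
    (fun v => ((9^-1)%:E * \int[Q]_w (dot (X v) (X w) ^+ 4)%:E)%E).
  exact: emeasurable_funM.
apply: (@le_trans _ _ (\int[Q]_v ((1 + cov Q X (X v) / 2)%:E +
    (9^-1)%:E * \int[Q]_w (dot (X v) (X w) ^+ 4)%:E))%E).
  apply: ge0_le_integralT.
  - exact: measurableT_comp mi mX.
  - exact: emeasurable_funD.
  - by move=> v; apply: integral_ge0 => y _; rewrite lee_fin expR_ge0.
  - by move=> v; exact: inner_ub.
rewrite (ge0_integralDT _ ma mb); last 2 first.
- by move=> v; rewrite lee_fin addr_ge0// divr_ge0.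
- by move=> v; rewrite mule_ge0 ?lee_fin.
rewrite EFinD; apply: leeD.
- under eq_integral do rewrite EFinD EFinM.
  have mc : measurable_fun [set: D] (fun v => ((cov Q X (X v))%:E * (2^-1)%:E)%E).
    exact: emeasurable_funM.
  rewrite (ge0_integralDT _ (measurable_cst _) mc)//; last by move=> v; rewrite -EFinM lee_fin mulr_ge0.
  by rewrite integral_prob_cst ge0_integralZrT// q2E.
- by rewrite ge0_integralZlT// (mulrC M4) EFinM lee_wpmul2l.
Qed.

Let gcov_mgf x : (\int[gcov]_y (expR (dot x y))%:E = (expR (cov Q X x / 2))%:E)%E.
Proof.
rewrite ge0_integral_law; last 2 first.
- exact: measurable_expR_dot.
- by move=> y; rewrite lee_fin expR_ge0.
under eq_integral do rewrite dot_lin.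
by rewrite std_gauss_mgf covA.
Qed.

(** The Gaussian integral is explicit, exp(cov/2), and 1 + x <= exp x suffices since the cross term
    is needed from below. *)
Let I_mu_nu : ((1 + q2 / 2)%:E <= expI (law Q mX) gcov)%E.
Proof.
rewrite /expI; under eq_integral do rewrite gcov_mgf.
rewrite ge0_integral_law; last 2 first.
- apply/measurable_EFinP; apply: measurableT_comp => //.
  by apply: measurable_funM => //; exact: (measurable_cov Q mX Xb).
- by move=> y; rewrite lee_fin expR_ge0.
rewrite EFinD EFinM -q2E -(integral_prob_cst Q 1) -ge0_integralZrT//.
have mc : measurable_fun [set: D] (fun v => ((cov Q X (X v))%:E * (2^-1)%:E)%E).
  exact: emeasurable_funM.
rewrite -(ge0_integralDT _ (measurable_cst _) mc)//; last by move=> v; rewrite -EFinM lee_fin mulr_ge0.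
apply: ge0_le_integralT.
- exact: emeasurable_funD.
- apply/measurable_EFinP; apply: measurableT_comp => //.
  exact: measurable_funM.
- by move=> v; rewrite -EFinM -EFinD lee_fin addr_ge0// mulr_ge0.
- by move=> v; rewrite -EFinM -EFinD lee_fin expR_ge1Dx.
Qed.

(** Jensen takes the average hidden in [cov] out of the exponential, which leaves exp(<y,X>^2/2)
    with [y] Gaussian. Its integral is (1 - c)^(-1/2) with c = cov(X) <= 1/4, and the c^2 in its
    expansion is at most a fourth moment, by Jensen again. *)
Let II_nu : (expI gcov gcov <= (1 + q2 / 2 + M4 / 2)%:E)%E.
Proof.
rewrite /expI; under eq_integral do rewrite gcov_mgf.
have me : measurable_fun [set: E * D] (fun z : E * D => (expR (dot z.1 (X z.2) ^+ 2 / 2))%:E).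
  apply/measurable_EFinP; apply: measurableT_comp => //; apply: measurable_funM => //.
  apply: measurable_funX; apply: measurable_dot => //; exact: measurableT_comp.
have pe (y : E) w : (0 <= (expR (dot y (X w) ^+ 2 / 2))%:E)%E by rewrite lee_fin expR_ge0.
have mi := @measurable_integral2 R _ _ _ _ Q _ me pe.
apply: (@le_trans _ _ (\int[gcov]_y \int[Q]_w (expR (dot y (X w) ^+ 2 / 2))%:E)%E).
  apply: ge0_le_integralT.
  - apply/measurable_EFinP; apply: measurableT_comp => //.
    by apply: measurable_funM => //; exact: (measurable_cov Q mX Xb).
  - exact: mi.
  - by move=> y; rewrite lee_fin expR_ge0.
  - move=> y; apply: jensen_expR.
    + apply: measurable_funM => //; apply/measurable_EFinP; exact: (measurable_dotX2 mX).
    + by move=> w; rewrite divr_ge0// sqr_ge0.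
    + under eq_integral do rewrite EFinM.
      rewrite ge0_integralZrT//; last 2 first.
      * exact: (measurable_dotX2 mX).
      * by move=> w; rewrite lee_fin sqr_ge0.
      by rewrite (covE Q mX Xb) EFinM.
rewrite (@tonelli_swap R _ _ _ _ gcov Q _ me pe).
have H w : (\int[gcov]_y (expR (dot y (X w) ^+ 2 / 2))%:E <=
    (1 + cov Q X (X w) / 2 )%:E + (2^-1)%:E * \int[Q]_v (dot (X w) (X v) ^+ 4)%:E)%E.
  rewrite ge0_integral_law; last 2 first.
  - apply/measurable_EFinP; apply: measurableT_comp => //; apply: measurable_funM => //.
    by apply: measurable_funX; exact: measurable_dot.
  - by move=> y; rewrite lee_fin expR_ge0.
  under eq_integral do rewrite dotC dot_lin.
  rewrite std_gauss_expR_dot_sqr covA; last by have := covX_ub w; lra.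
  apply: (@le_trans _ _ (1 + cov Q X (X w) / 2 + cov Q X (X w) ^+ 2 / 2)%:E).
    by rewrite lee_fin inv_sqrt_ub.
  rewrite EFinD leeD2l// mulrC EFinM lee_wpmul2l//.
  have := @jensen_sqr R _ D Q (fun v => dot (X w) (X v) ^+ 2) (cov Q X (X w)) _ _ (covE Q mX Xb _).
  move=> /(_ _ _)/le_trans; apply.
  - by apply/measurable_EFinP; exact: (measurable_dotX2 mX).
  - by move=> v; exact: sqr_ge0.
  - by under eq_integral do rewrite -exprM.
have ma : measurable_fun [set: D] (fun v => (1 + cov Q X (X v) / 2)%:E).
  by apply/measurable_EFinP; apply: measurable_funD => //; exact: measurable_funM.
have mb : measurable_fun [set: D]
    (fun v => ((2^-1)%:E * \int[Q]_w (dot (X v) (X w) ^+ 4)%:E)%E).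
  exact: emeasurable_funM.
apply: (@le_trans _ _ (\int[Q]_v ((1 + cov Q X (X v) / 2)%:E +
    (2^-1)%:E * \int[Q]_w (dot (X v) (X w) ^+ 4)%:E))%E).
  apply: ge0_le_integralT => //.
  - exact: (@measurable_integral1 R _ _ _ _ gcov _ me pe).
  - exact: emeasurable_funD.
  - by move=> v; apply: integral_ge0 => y _; exact: pe.
rewrite (ge0_integralDT _ ma mb); last 2 first.
- by move=> v; rewrite lee_fin addr_ge0// divr_ge0.
- by move=> v; rewrite mule_ge0 ?lee_fin.
rewrite EFinD; apply: leeD.
- under eq_integral do rewrite EFinD EFinM.
  have mc : measurable_fun [set: D] (fun v => ((cov Q X (X v))%:E * (2^-1)%:E)%E).
    exact: emeasurable_funM.
  rewrite (ge0_integralDT _ (measurable_cst _) mc)//; last by move=> v; rewrite -EFinM lee_fin mulr_ge0.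
  by rewrite integral_prob_cst ge0_integralZrT// q2E.
- by rewrite ge0_integralZlT// (mulrC M4) EFinM lee_wpmul2l.
Qed.

(** The constant is 1/9 + 1/2, from the two diagonal terms. *)
Lemma chi2_bound : (sqdist (law Q mX) gcov <= (11 / 18 * M4)%:E)%E.
Proof.
have := sqdist_le II_mu II_nu I_mu_nu.
by congr (_ <= _%:E)%E; field.
Qed.

Lemma symm_gcov : symm gcov.
Proof.
move=> u mu u0.
have mo : measurable_fun [set: E] (fun x => u (tscale (-1) x)).
  by apply: (measurableT_comp mu); exact: measurable_tscale.
rewrite (ge0_integral_law _ (measurable_lin A) mo (fun x => u0 _)).
rewrite (ge0_integral_law _ (measurable_lin A) mu u0).
rewrite -[RHS]std_gauss_opp//; last exact: (measurableT_comp mu (measurable_lin A)).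
apply: eq_integral => z _; congr u; apply: eq_from_tnth => i.
by rewrite tE !tnth_lin mulr_sumr; apply: eq_bigr => j _; rewrite tE; ring.
Qed.

Lemma is_gauss_gcov : is_gauss gcov.
Proof. by apply: (@is_gauss_affine R N N (sg N) A (tzero N)); exact: is_gauss_std. Qed.

Lemma mom2_gcov : (mom2 gcov <= mom2 (law Q mX))%E.
Proof.
pose e i : E := [tuple (i == j)%:R | j < N].
have ez i z : dot (e i) z = tnth z i.
  rewrite /dot (bigD1 i)//= tnth_mktuple eqxx mul1r big1 ?addr0// => j ji.
  by rewrite tnth_mktuple eq_sym (negbTE ji) mul0r.
have dE z : dot z z = \sum_i dot (e i) z ^+ 2.
  by apply: eq_bigr => i _; rewrite ez expr2.
have p0 (x : E) : (0 <= (dot x x)%:E)%E by rewrite lee_fin dot_ge0.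
rewrite /mom2 (ge0_integral_law (sg N) (measurable_lin A) (@measurable_normsq R N) p0).
rewrite (ge0_integral_law Q mX (@measurable_normsq R N) p0).
under eq_integral do rewrite dE -sumEFin.
under [leRHS]eq_integral do rewrite dE -sumEFin.
rewrite ge0_integral_sum//; last 2 first.
- move=> i; apply/measurable_EFinP; apply: measurable_funX.
  by apply: measurable_dot => //; exact: measurable_lin.
- by move=> i z _; rewrite lee_fin sqr_ge0.
rewrite ge0_integral_sum//; last 2 first.
- by move=> i; exact: (measurable_dotX2 mX).
- by move=> i z _; rewrite lee_fin sqr_ge0.
apply: lee_sum => i _; rewrite (covE Q mX Xb) -covA.
under eq_integral do rewrite dot_lin.
exact: std_gauss_dot_sqr.
Qed.

End chi2_bound.

(** * Rejection coupling *)

Section density_probability.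
Context {R : realType} d (E : measurableType d) (gam : probability E R) (h : E -> R).
Local Open Scope ereal_scope.
Hypotheses (mh : measurable_fun [set: E] h) (h0 : forall x, (0 <= h x)%R)
  (h1 : \int[gam]_x (h x)%:E = 1).

Definition dprob (_ : measurable_fun [set: E] h) (_ : forall x, (0 <= h x)%R)
  (_ : \int[gam]_x (h x)%:E = 1) (A : set E) : \bar R := \int[gam]_(x in A) (h x)%:E.

Local Notation m := (dprob mh h0 h1).

Let m0 : m set0 = 0.
Proof. by rewrite /dprob integral_set0. Qed.

Let m_ge0 A : 0 <= m A.
Proof. by apply: integral_ge0 => x _; rewrite lee_fin. Qed.

Let m_sigma_additive : semi_sigma_additive m.
Proof.
move=> F mF tF mUF; rewrite /dprob ge0_integral_bigcup//; last 2 first.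
- exact/measurable_EFinP/measurable_funTS.
- by move=> x _; rewrite lee_fin.
apply: is_cvg_ereal_nneg_natsum_cond => n _ _.
by apply: integral_ge0 => /= x ?; rewrite lee_fin.
Qed.

HB.instance Definition _ := isMeasure.Build _ _ _ m m0 m_ge0 m_sigma_additive.

Let mT : m [set: E] = 1.
Proof. by rewrite /dprob h1. Qed.

HB.instance Definition _ := Measure_isProbability.Build _ _ _ m mT.

End density_probability.

(* nu is the law with density proportional to (g - f)^+, and arbitrary when
   delta = 0. *)
Section rejection_parameters.
Context {R : realType} d (E : measurableType d) (gam : probability E R) (f g : E -> R).
Local Open Scope ereal_scope.
Hypotheses (mf : measurable_fun [set: E] f) (f0 : forall x, (0 <= f x)%R)
  (f1 : \int[gam]_x (f x)%:E = 1).
Hypotheses (mg : measurable_fun [set: E] g) (g0 : forall x, (0 <= g x)%R)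
  (g1 : \int[gam]_x (g x)%:E = 1).

Lemma rejection_parameters : exists (delta : R) (nu : probability E R),
  [/\ (0 <= delta)%R, \int[gam]_z (Num.max (f z - g z) 0)%:E = delta%:E &
   forall A, measurable A ->
     delta%:E * nu A = \int[gam]_(z in A) (Num.max (g z - f z) 0)%:E].
Proof.
have mm (p q : E -> R) : measurable_fun [set: E] p -> measurable_fun [set: E] q ->
    measurable_fun [set: E] (fun z => Num.max (p z - q z) 0)%R.
  by move=> mp mq; apply: measurable_maxr => //; exact: measurable_funB.
have pm (x : R) : (0 <= Num.max x 0)%R by rewrite le_max lexx orbT.
have i0 (p q : E -> R) : 0 <= \int[gam]_z (Num.max (p z - q z) 0)%:E.
  by apply: integral_ge0 => z _; rewrite lee_fin.
(* Both sides integrate the larger of [f] and [g]. Since both densities have mass 1, excess and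
   deficit have the same mass [delta]. *)
have swap : \int[gam]_z (Num.max (f z - g z) 0)%:E + 1 =
    \int[gam]_z (Num.max (g z - f z) 0)%:E + 1.
  rewrite -{1}g1 -{1}f1 -ge0_integralDT; last 4 first.
  - by apply/measurable_EFinP; exact: mm.
  - exact/measurable_EFinP.
  - by move=> z; rewrite lee_fin.
  - by move=> z; rewrite lee_fin.
  rewrite -ge0_integralDT; last 4 first.
  - by apply/measurable_EFinP; exact: mm.
  - exact/measurable_EFinP.
  - by move=> z; rewrite lee_fin.
  - by move=> z; rewrite lee_fin.
  apply: eq_integral => z _; rewrite -!EFinD; congr (_%:E).
  by rewrite /Num.max; case: ltP => h1; case: ltP => h2; lra.
have ub : \int[gam]_z (Num.max (f z - g z) 0)%:E <= 1.
  rewrite -f1; apply: ge0_le_integralT.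
  - by apply/measurable_EFinP; exact: mm.
  - exact/measurable_EFinP.
  - by move=> z; rewrite lee_fin.
  - by move=> z; rewrite lee_fin ge_max f0 andbT; have := g0 z; lra.
pose delta := fine (\int[gam]_z (Num.max (f z - g z) 0)%:E).
have dE : \int[gam]_z (Num.max (f z - g z) 0)%:E = delta%:E.
  by rewrite /delta fineK// ge0_fin_numE// (le_lt_trans ub)// ltry.
have d0 : (0 <= delta)%R by rewrite -lee_fin -dE.
have dE' : \int[gam]_z (Num.max (g z - f z) 0)%:E = delta%:E.
  move: swap; rewrite dE; move: (\int[gam]_z _) => [x| |]//.
  by rewrite -!EFinD => -[] /addIr ->.
have [delta0|dn0] := eqVneq delta 0%R.
  exists delta, gam; split => // A mA; rewrite delta0 mul0e.
  apply/eqP; rewrite eq_le; apply/andP; split.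
    by apply: integral_ge0 => z _; rewrite lee_fin.
  apply: (@le_trans _ _ delta%:E); last by rewrite delta0.
  rewrite -dE'; apply: ge0_subset_integral => //.
    by apply/measurable_EFinP; exact: mm.
  by move=> z _; rewrite lee_fin.
have dp : (0 < delta)%R by rewrite lt_neqAle eq_sym dn0.
pose h z := (delta^-1 * Num.max (g z - f z) 0)%R.
have mh : measurable_fun [set: E] h by apply: measurable_funM => //; exact: mm.
have h0 z : (0 <= h z)%R by rewrite mulr_ge0// invr_ge0.
have h1 : \int[gam]_z (h z)%:E = 1.
  rewrite /h; under eq_integral do rewrite EFinM.
  rewrite ge0_integralZlT ?invr_ge0//; last 2 first.
  - by apply/measurable_EFinP; exact: mm.
  - by move=> z; rewrite lee_fin.
  by rewrite dE' -EFinM mulVf.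
exists delta, (dprob mh h0 h1); split => // A mA.
rewrite /= /dprob /h; under eq_integral do rewrite EFinM.
rewrite ge0_integralZl//; last 3 first.
- by apply/measurable_EFinP/measurable_funTS; exact: mm.
- by move=> z _; rewrite lee_fin.
- by rewrite lee_fin invr_ge0.
by rewrite muleA -EFinM divff// mul1e.
Qed.

End rejection_parameters.

Section uniform_lemmas.
Context {R : realType}.
Notation U := (uniform_prob (@ltr01 R)).

(** Multiplied by the density [f], the rejection probability becomes the density of rejected points,
    an identity that also holds where [f] vanishes. *)
Lemma uniform_gt (f g : R) : 0 <= f -> 0 <= g ->
  (f%:E * U [set u : R | (g < u * f)%R] = (Num.max (f - g) 0)%:E)%E.
Proof.
move=> f0 g0.
have [->|fn0] := eqVneq f 0.
  rewrite mul0e; congr (_%:E); rewrite max_r//; lra.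
have fp : 0 < f by rewrite lt_neqAle eq_sym fn0.
have -> : [set u : R | (g < u * f)%R] = `]g / f, +oo[%classic.
  by apply/seteqP; split => u /=; rewrite in_itv/= andbT ltr_pdivrMr.
have mI : measurable (`]g / f, +oo[%classic : set R) by exact: measurable_itv.
have UE : U `]g / f, +oo[%classic = (\int[U]_x (\1_(`]g / f, +oo[%classic : set R) x)%:E)%E.
  by rewrite integral_indic// setIT.
rewrite UE integral_uniform//; last exact/measurable_EFinP/measurable_indic.
rewrite subr0 invr1 mul1e integral_indic//.
have gf0 : 0 <= g / f by rewrite divr_ge0.
have [gf1|gf1] := ltP (g / f) 1.
  have -> : `]g / f, +oo[ `&` `[0, 1] = `]g / f, 1]%classic.
    apply/seteqP; split => u /=; rewrite !in_itv/= ?andbT.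
      by move=> [-> /andP[_ ->]].
    move=> /andP[h1 h2]; split => //; apply/andP; split => //.
    by apply: ltW; exact: le_lt_trans h1.
  have L : lebesgue_measure (`]g / f, 1]%classic : set R) = (1 - g / f)%:E.
    by rewrite lebesgue_measure_itv/= lte_fin gf1.
  rewrite [X in (_ * X)%E]L -EFinM; congr (_%:E).
  rewrite max_l; first by field.
  by rewrite subr_ge0; move: gf1; rewrite ltr_pdivrMr// mul1r => /ltW.
have -> : `]g / f, +oo[ `&` `[0, 1] = set0.
  apply/seteqP; split => u //=; rewrite !in_itv/= ?andbT => -[h1 /andP[_ h2]].
  by have := lt_le_trans (le_lt_trans gf1 h1) h2; rewrite ltxx.
rewrite measure0 mule0; congr (_%:E); rewrite max_r//.
by rewrite subr_le0; move: gf1; rewrite ler_pdivlMr// mul1r.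
Qed.

Lemma measurable_gt_set (f g : R) : measurable ([set u : R | (g < u * f)%R] : set R).
Proof.
rewrite (_ : [set u | _] = (fun u => g < u * f) @^-1` [set true]); last first.
  by apply/seteqP; split => u /=; case: (_ < _).
rewrite -[X in measurable X]setTI.
by apply: measurable_fun_ltr => //; exact: measurable_funM.
Qed.

Lemma uniform_le (f g : R) : 0 <= f -> 0 <= g ->
  (f%:E * U [set u : R | (u * f <= g)%R] = (Num.min f g)%:E)%E.
Proof.
move=> f0 g0.
have mg := measurable_gt_set f g.
have -> : [set u : R | (u * f <= g)%R] = ~` [set u : R | (g < u * f)%R].
  by apply/seteqP; split => u /=; rewrite leNgt => /negP.
have := probability_setC U mg => ->.
have Uf : U [set u : R | (g < u * f)%R] \is a fin_num by exact: fin_num_measure.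
pose r := fine (U [set u : R | (g < u * f)%R]).
have rE : U [set u : R | (g < u * f)%R] = r%:E by rewrite /r fineK.
rewrite [X in (_ * (1 - X))%E]rE -EFinB -EFinM.
have := uniform_gt f0 g0; rewrite rE -EFinM => -[H].
congr (_%:E); rewrite mulrBr mulr1 H /Num.max /Num.min.
by case: ltP => h1; case: ltP => h2; lra.
Qed.

End uniform_lemmas.

Section independent_integral.
Context {R : realType} dT (T : measurableType dT) (P : probability T R)
  dE (E : measurableType dE) dS (F : measurableType dS).
Local Open Scope ereal_scope.
Variables (V : T -> E) (S : T -> F).
Hypotheses (mV : measurable_fun [set: T] V) (mS : measurable_fun [set: T] S).
Hypothesis hS : forall A C, measurable A -> measurable C ->
  P (V @^-1` A `&` S @^-1` C) = P (V @^-1` A) * P (S @^-1` C).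

Lemma indep_integral (k : E -> \bar R) (C : set F) :
  measurable_fun [set: E] k -> (forall v, 0 <= k v) -> measurable C ->
  \int[P]_t (k (V t) * (\1_C (S t))%:E) = \int[P]_t k (V t) * P (S @^-1` C).
Proof.
move=> mk k0 mC.
have mJ : measurable_fun [set: F] (fun v => (\1_C v)%:E : \bar R).
  by exact/measurable_EFinP/measurable_indic.
have mVS : measurable_fun [set: T] (fun t => (V t, S t)) by exact: measurable_fun_pair.
pose k2 (z : E * F) := k z.1 * (\1_C z.2)%:E.
have mk2 : measurable_fun [set: E * F] k2.
  apply: emeasurable_funM; first exact: measurableT_comp.
  by apply: (measurableT_comp mJ).
have k20 z : 0 <= k2 z by rewrite mule_ge0.
have -> : \int[P]_t (k (V t) * (\1_C (S t))%:E) =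
    \int[(law P mV \x law P mS)]_z k2 (z.1, z.2).
  transitivity (\int[law P mVS]_z k2 z).
    by rewrite ge0_integral_law.
  transitivity (\int[(law P mV \x law P mS)]_z k2 z); last first.
    by apply: eq_integral => -[].
  apply: eq_measure_integral => B mB _.
  apply: (etrans (lawE P mVS B)); apply: (law_pair mV mS mVS _ mB) => A' C' mA' mC'.
  by apply: (etrans (hS mA' mC')); congr (_ * _); apply: esym; exact: lawE.
have mk2' : measurable_fun [set: E * F] (fun z => k2 (z.1, z.2)).
  by rewrite (_ : (fun _ => _) = k2)//; apply/funext => -[].
rewrite (@tonelli_prod R _ _ _ _ (law P mV) (law P mS) (fun x y => k2 (x, y)) mk2'
  (fun _ _ => k20 _)).
rewrite /k2/=.
have -> : \int[law P mV]_x \int[law P mS]_y (k x * (\1_C y)%:E) =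
    \int[law P mV]_x (k x * P (S @^-1` C)).
  apply: eq_integral => x _; rewrite ge0_integralZl//.
  by rewrite integral_indic// setIT.
rewrite ge0_integralZr//; congr (_ * _).
by rewrite ge0_integral_law.
Qed.

End independent_integral.

Section rejection_coupling.
Context {R : realType} dT (T : measurableType dT) (P : probability T R)
  dE (E : measurableType dE) (gam : probability E R).
Local Open Scope ereal_scope.
Variables (V : T -> E) (f g : E -> R) (delta : R) (nu : probability E R).
Hypotheses (mV : measurable_fun [set: T] V).
Hypotheses (mf : measurable_fun [set: E] f) (f0 : forall x, (0 <= f x)%R).
Hypotheses (mg : measurable_fun [set: E] g) (g0 : forall x, (0 <= g x)%R).
Hypothesis Vf : forall u : E -> \bar R, measurable_fun [set: E] u ->
  (forall x, 0 <= u x) -> \int[P]_t u (V t) = \int[gam]_z (u z * (f z)%:E).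
Hypothesis delta0 : (0 <= delta)%R.
Hypothesis deltaE : \int[gam]_z (Num.max (f z - g z) 0)%:E = delta%:E.
Hypothesis nuE : forall A, measurable A ->
  delta%:E * nu A = \int[gam]_(z in A) (Num.max (g z - f z) 0)%:E.

Notation U := (uniform_prob (@ltr01 R)).

(** The given space, a uniform variable that decides acceptance, and a replacement drawn in advance
    from the excess law. *)
Definition rej_prob : probability ((T * measurableTypeR R) * E)%type R :=
  ((P \x U) \x nu).

Definition rejects (w : (T * measurableTypeR R) * E) : bool :=
  (g (V w.1.1) < w.1.2 * f (V w.1.1))%R.

Definition rej_map (w : (T * measurableTypeR R) * E) : E :=
  if rejects w then w.2 else V w.1.1.

Let mV1 : measurable_fun [set: (T * measurableTypeR R) * E] (fun w => V w.1.1).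
Proof.
by apply: (measurableT_comp mV); apply: measurableT_comp.
Qed.

Lemma measurable_rejects : measurable_fun [set: (T * measurableTypeR R) * E] rejects.
Proof.
apply: measurable_fun_ltr; first exact: measurableT_comp mg mV1.
apply: measurable_funM; last exact: measurableT_comp mf mV1.
by apply: measurableT_comp => //; apply: measurable_fst.
Qed.

Lemma measurable_rej_map : measurable_fun [set: (T * measurableTypeR R) * E] rej_map.
Proof.
apply: measurable_fun_ifT => //; exact: measurable_rejects.
Qed.

Let rejset v : set (measurableTypeR R) := [set u | (g v < u * f v)%R].
Let accset v : set (measurableTypeR R) := [set u | (u * f v <= g v)%R].

Let Urej v : (f v)%:E * U (rejset v) = (Num.max (f v - g v) 0)%:E.
Proof. exact: uniform_gt. Qed.

Let Uacc v : (f v)%:E * U (accset v) = (Num.min (f v) (g v))%:E.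
Proof. exact: uniform_le. Qed.

Let mrej v : measurable (rejset v). Proof. exact: measurable_gt_set. Qed.

Let accC v : accset v = ~` rejset v.
Proof.
by apply/seteqP; split => u /=; rewrite /accset /rejset/= leNgt => /negP.
Qed.

Let macc v : measurable (accset v).
Proof. by rewrite accC; exact: measurableC. Qed.

Let mUrej : measurable_fun [set: T] (fun t => U (rejset (V t))).
Proof.
have mA : measurable ([set z | (g (V z.1) < z.2 * f (V z.1))%R] : set (T * measurableTypeR R)).
  rewrite (_ : [set z | _] = (fun z : T * measurableTypeR R =>
     g (V z.1) < z.2 * f (V z.1))%R @^-1` [set true]); last first.
    by apply/seteqP; split => u /=; case: (_ < _)%R.
  rewrite -[X in measurable X]setTI; apply: measurable_fun_ltr => //.
    by apply: (measurableT_comp mg); exact: measurableT_comp.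
  apply: measurable_funM => //.
  by apply: (measurableT_comp mf); exact: measurableT_comp.
have := measurable_fun_xsection U mA; congr (measurable_fun _ _).
apply/funext => t; congr (U _); apply/seteqP; split => u;
  by rewrite /xsection/= inE.
Qed.

Let mUacc : measurable_fun [set: T] (fun t => U (accset (V t))).
Proof.
rewrite (_ : (fun _ => _) = fun t => 1 - U (rejset (V t))); first exact: emeasurable_funB.
by apply/funext => t; rewrite accC; exact: probability_setC.
Qed.

(** The common source of the law, independence and cost statements: the replacement and the uniform
    variable are integrated out for fixed [t]. *)
Lemma integral_rej (a : T * E -> \bar R) (b : T -> \bar R) :
  measurable_fun [set: T * E] a -> (forall z, 0 <= a z) ->
  measurable_fun [set: T] b -> (forall t, 0 <= b t) ->
  \int[rej_prob]_w (if rejects w then a (w.1.1, w.2) else b w.1.1) =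
  \int[P]_t (U (rejset (V t)) * \int[nu]_v a (t, v) + U (accset (V t)) * b t).
Proof.
move=> ma a0 mb b0.
have mw11 : measurable_fun [set: (T * measurableTypeR R) * E] (fun w => w.1.1).
  exact: measurableT_comp.
have m1 : measurable_fun [set: (T * measurableTypeR R) * E]
    (fun w => if rejects (w.1, w.2) then a (w.1.1, w.2) else b w.1.1).
  rewrite (_ : (fun _ => _) = fun w => if rejects w then a (w.1.1, w.2) else b w.1.1);
    last by apply/funext => -[].
  apply: measurable_fun_ifT; first exact: measurable_rejects.
    by apply: (measurableT_comp ma); exact: measurable_fun_pair.
  exact: measurableT_comp.
have p1 (x : T * measurableTypeR R) v :
  0 <= (if rejects (x, v) then a (x.1, v) else b x.1) by case: ifP.
have := @tonelli_prod R _ _ _ _ (P \x U) nu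
  (fun x v => if rejects (x, v) then a (x.1, v) else b x.1) m1 p1.
have E1 : \int[rej_prob]_w (if rejects w then a (w.1.1, w.2) else b w.1.1) =
   \int[((P \x U) \x nu)]_z (if rejects (z.1, z.2) then a (z.1.1, z.2) else b z.1.1).
  by apply: eq_integral => -[] .
move=> E2; rewrite E1 E2 => {E1 E2}.
have mA : measurable_fun [set: T] (fun t => \int[nu]_v a (t, v)).
  apply: (@measurable_integral2 R _ _ _ _ nu (fun t v => a (t, v))) => //.
  by rewrite (_ : (fun _ => _) = a)//; apply/funext => -[].
have pA t : 0 <= \int[nu]_v a (t, v) by exact: integral_ge0.
have E3 (x : T * measurableTypeR R) :
    \int[nu]_v (if rejects (x, v) then a (x.1, v) else b x.1) =
    if (g (V x.1) < x.2 * f (V x.1))%R then \int[nu]_v a (x.1, v) else b x.1.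
  rewrite /rejects/=; case: ifP => _ //.
  rewrite integral_cst// -[RHS]mule1; congr (_ * _); exact: probability_setT.
under eq_integral do rewrite E3.
have mr2 : measurable_fun [set: T * measurableTypeR R]
    (fun x => g (V x.1) < x.2 * f (V x.1))%R.
  apply: measurable_fun_ltr.
    by apply: (measurableT_comp mg); exact: measurableT_comp.
  apply: measurable_funM => //.
  by apply: (measurableT_comp mf); exact: measurableT_comp.
have m2 : measurable_fun [set: T * measurableTypeR R] (fun x =>
    if (g (V x.1) < x.2 * f (V x.1))%R then \int[nu]_v a (x.1, v) else b x.1).
  apply: measurable_fun_ifT => //; first exact: (measurableT_comp mA).
  exact: (measurableT_comp mb).
have p2 t (u : measurableTypeR R) :
   0 <= (if (g (V t) < u * f (V t))%R then \int[nu]_v a (t, v) else b t).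
  by case: ifP.
rewrite (@tonelli_prod R _ _ _ _ P U (fun t u =>
    if (g (V t) < u * f (V t))%R then \int[nu]_v a (t, v) else b t) m2 p2).
apply: eq_integral => t _.
transitivity (\int[U]_u ((\1_(rejset (V t)) u)%:E * \int[nu]_v a (t, v) +
    (\1_(accset (V t)) u)%:E * b t)).
  apply: eq_integral => u _; rewrite !indicE.
  case: ifPn => h.
    rewrite mem_set//= memNset; first by rewrite mul0e adde0 mul1e.
    by rewrite /accset/= leNgt h.
  rewrite memNset; last by rewrite /rejset/=; exact/negP.
  by rewrite mem_set ?mul0e ?add0e ?mul1e// /accset/= leNgt.
have mi (A : set (measurableTypeR R)) (c : \bar R) : measurable A ->
    measurable_fun [set: measurableTypeR R] (fun u => (\1_A u)%:E * c).
  move=> mA'; apply: emeasurable_funM => //.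
  exact/measurable_EFinP/measurable_indic.
have pi (A : set (measurableTypeR R)) (c : \bar R) u : 0 <= c -> 0 <= (\1_A u)%:E * c.
  by move=> c0; rewrite mule_ge0// lee_fin.
rewrite ge0_integralDT; [|exact: mi|exact: mi|by move=> u; exact: pi|by move=> u; exact: pi].
congr (_ + _).
- rewrite ge0_integralZr//; first by rewrite integral_indic// setIT.
  exact/measurable_EFinP/measurable_indic.
- rewrite ge0_integralZr//; first by rewrite integral_indic// setIT.
  exact/measurable_EFinP/measurable_indic.
Qed.

Let mmax (p q : E -> R) : measurable_fun [set: E] p -> measurable_fun [set: E] q ->
  measurable_fun [set: E] (fun v => (Num.max (p v - q v) 0)%:E).
Proof.
move=> mp mq; apply/measurable_EFinP; apply: measurable_maxr => //.
exact: measurable_funB.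
Qed.

Let pmax (x : R) : 0 <= (Num.max x 0)%:E.
Proof. by rewrite lee_fin le_max lexx orbT. Qed.

Let integral_nu (c : E -> \bar R) : measurable_fun [set: E] c -> (forall v, 0 <= c v) ->
  delta%:E * \int[nu]_v c v = \int[gam]_v (c v * (Num.max (g v - f v) 0)%:E).
Proof.
move=> mc c0.
pose D := NngNum delta0.
have mh : measurable_fun [set: E] (fun v => Num.max (g v - f v) 0)%R.
  by apply: measurable_maxr => //; exact: measurable_funB.
have h0 x : (0 <= Num.max (g x - f x) 0)%R by rewrite le_max lexx orbT.
have H := @ge0_integral_density R _ E gam (mscale D nu) _ mh h0
  (fun A mA => nuE mA) c mc c0.
by rewrite -H ge0_integral_mscale.
Qed.

Let mUrejE : measurable_fun [set: E] (fun v => U (rejset v)).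
Proof.
have mA : measurable ([set z | (g z.1 < z.2 * f z.1)%R] : set (E * measurableTypeR R)).
  rewrite (_ : [set z | _] = (fun z : E * measurableTypeR R =>
     g z.1 < z.2 * f z.1)%R @^-1` [set true]); last first.
    by apply/seteqP; split => u /=; case: (_ < _)%R.
  rewrite -[X in measurable X]setTI; apply: measurable_fun_ltr => //.
    exact: measurableT_comp.
  by apply: measurable_funM => //; exact: measurableT_comp.
have := measurable_fun_xsection U mA; congr (measurable_fun _ _).
apply/funext => t; congr (U _); apply/seteqP; split => u;
  by rewrite /xsection/= inE.
Qed.

Let mUaccE : measurable_fun [set: E] (fun v => U (accset v)).
Proof.
rewrite (_ : (fun _ => _) = fun v => 1 - U (rejset v)); first exact: emeasurable_funB.
by apply/funext => t; rewrite accC; exact: probability_setC.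
Qed.

(** Accepted points have density min(f,g). Rejected mass [delta] is redistributed by [nu], with
    density (g - f)^+, and the two densities add up to [g]. *)
Lemma rej_map_integral (u : E -> \bar R) : measurable_fun [set: E] u ->
  (forall v, 0 <= u v) ->
  \int[P]_t (U (rejset (V t)) * \int[nu]_v u v + U (accset (V t)) * u (V t)) =
  \int[gam]_v (u v * (g v)%:E).
Proof.
move=> mu u0.
have K0 : 0 <= \int[nu]_v u v by exact: integral_ge0.
pose k v := U (rejset v) * \int[nu]_v u v + U (accset v) * u v.
have mk : measurable_fun [set: E] k.
  by apply: emeasurable_funD; apply: emeasurable_funM.
have k0 v : 0 <= k v by rewrite adde_ge0// mule_ge0.
rewrite (Vf mk k0) /k.
transitivity (\int[gam]_v ((Num.max (f v - g v) 0)%:E * \int[nu]_v u v +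
    (u v * (Num.min (f v) (g v))%:E))).
  apply: eq_integral => v _; rewrite -Urej -Uacc ge0_muleDl ?mule_ge0//.
  congr (_ + _); first by rewrite muleAC (muleC (U _)).
  by rewrite (muleC (U _) (u v)) -muleA (muleC (U _)).
have mm : measurable_fun [set: E] (fun v => (Num.min (f v) (g v))%:E).
  by apply/measurable_EFinP; exact: measurable_minr.
have pm v : 0 <= (Num.min (f v) (g v))%:E by rewrite lee_fin le_min f0 g0.
rewrite ge0_integralDT; last 4 first.
- by apply: emeasurable_funM => //; exact: mmax.
- exact: emeasurable_funM.
- by move=> v; rewrite mule_ge0.
- by move=> v; rewrite mule_ge0.
rewrite ge0_integralZr//; last exact: mmax.
rewrite deltaE integral_nu//.
rewrite -ge0_integralDT; last 4 first.
- by apply: emeasurable_funM => //; exact: mmax.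
- exact: emeasurable_funM.
- by move=> v; rewrite mule_ge0.
- by move=> v; rewrite mule_ge0.
apply: eq_integral => v _; rewrite -ge0_muleDr// -EFinD; congr (_ * _%:E).
by rewrite /Num.max /Num.min; case: ltP => h1; case: ltP => h2; lra.
Qed.

Lemma rej_map_law (u : E -> \bar R) : measurable_fun [set: E] u ->
  (forall v, 0 <= u v) ->
  \int[rej_prob]_w u (rej_map w) = \int[gam]_v (u v * (g v)%:E).
Proof.
move=> mu u0; rewrite -rej_map_integral//.
have m2 : measurable_fun [set: T * E] (fun z => u z.2) by exact: measurableT_comp.
have mb : measurable_fun [set: T] (fun t => u (V t)) by exact: measurableT_comp.
rewrite -(integral_rej m2 (fun z => u0 _) mb (fun t => u0 _)).
by apply: eq_integral => w _; rewrite /rej_map; case: ifP.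
Qed.

(** Given [V], acceptance and replacement use fresh randomness only, so what is independent of [V]
    stays independent of the output. In degree one [S] is the Gaussian linear part. *)
Lemma rej_map_indep dS (F : measurableType dS) (S : T -> F) (A : set E) (C : set F) :
  measurable_fun [set: T] S ->
  (forall A C, measurable A -> measurable C ->
    P (V @^-1` A `&` S @^-1` C) = P (V @^-1` A) * P (S @^-1` C)) ->
  measurable A -> measurable C ->
  rej_prob (rej_map @^-1` A `&` (fun w => S w.1.1) @^-1` C) =
  rej_prob (rej_map @^-1` A) * P (S @^-1` C).
Proof.
move=> mS hS mA mC.
have mS1 : measurable_fun [set: (T * measurableTypeR R) * E] (fun w => S w.1.1).
  by apply: (measurableT_comp mS); exact: measurableT_comp.
have mI B : measurable B -> measurable_fun [set: E] (fun v => (\1_B v)%:E : \bar R).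
  by move=> mB; exact/measurable_EFinP/measurable_indic.
have mJ B : measurable B -> measurable_fun [set: F] (fun v => (\1_B v)%:E : \bar R).
  by move=> mB; exact/measurable_EFinP/measurable_indic.
have pI dX (X : measurableType dX) (B : set X) v : 0 <= (\1_B v)%:E :> \bar R.
  by rewrite lee_fin.
pose k v := U (rejset v) * \int[nu]_v (\1_A v)%:E + U (accset v) * (\1_A v)%:E.
have mk : measurable_fun [set: E] k.
  by apply: emeasurable_funD; apply: emeasurable_funM => //; exact: mI.
have k0 v : 0 <= k v by rewrite adde_ge0// mule_ge0// integral_ge0.
have mrm := measurable_rej_map.
have -> : rej_prob (rej_map @^-1` A) = \int[P]_t k (V t).
  rewrite /k (rej_map_integral (mI _ mA) (pI _ _ _)) -(rej_map_law (mI _ mA) (pI _ _ _)).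
  transitivity (\int[rej_prob]_w (\1_(rej_map @^-1` A) w)%:E); last by [].
  by rewrite integral_indic ?setIT//; exact: measurable_preimageT.
transitivity (\int[P]_t (k (V t) * (\1_C (S t))%:E)).
  transitivity (\int[rej_prob]_w (if rejects w then (\1_A w.2)%:E * (\1_C (S w.1.1))%:E
      else (\1_A (V w.1.1))%:E * (\1_C (S w.1.1))%:E)).
    transitivity (\int[rej_prob]_w
        (\1_(rej_map @^-1` A `&` (fun w => S w.1.1) @^-1` C) w)%:E).
      by rewrite integral_indic ?setIT//; apply: measurableI; exact: measurable_preimageT.
    apply: eq_integral => w _; rewrite !indicE in_setI.
    have -> : (w \in rej_map @^-1` A) = (rej_map w \in A).
      by apply/idP/idP; rewrite !inE.
    have -> : (w \in (fun w => S w.1.1) @^-1` C) = (S w.1.1 \in C).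
      by apply/idP/idP; rewrite !inE.
    by rewrite /rej_map; case: ifP => _; rewrite -EFinM -natrM mulnb.
  have ma : measurable_fun [set: T * E] (fun z => (\1_A z.2)%:E * (\1_C (S z.1))%:E : \bar R).
    apply: emeasurable_funM; first by apply: (measurableT_comp (mI _ mA)).
    by apply: (measurableT_comp (mJ _ mC)); exact: measurableT_comp.
  have mb : measurable_fun [set: T] (fun t => (\1_A (V t))%:E * (\1_C (S t))%:E : \bar R).
    apply: emeasurable_funM; first by apply: (measurableT_comp (mI _ mA)).
    exact: (measurableT_comp (mJ _ mC)).
  have pa (z : T * E) : 0 <= (\1_A z.2)%:E * (\1_C (S z.1))%:E :> \bar R by rewrite mule_ge0.
  have pb t : 0 <= (\1_A (V t))%:E * (\1_C (S t))%:E :> \bar R by rewrite mule_ge0.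
  rewrite (integral_rej ma pa mb pb); apply: eq_integral => t _ /=.
  rewrite ge0_integralZr//; last exact: mI.
  have i0 : 0 <= \int[nu]_v (\1_A v)%:E :> \bar R by exact: integral_ge0.
  have gen (x I c y b : \bar R) : 0 <= x -> 0 <= I -> 0 <= y -> 0 <= b ->
      x * (I * c) + y * (b * c) = (x * I + y * b) * c.
    by move=> *; rewrite ge0_muleDl ?mule_ge0// !muleA.
  by apply: gen.
exact: (indep_integral mV mS hS mk k0 mC).
Qed.

(** Rejected points have density (f - g)^+, their replacements (g - f)^+, and these add up to |f -
    g|. *)
Lemma rej_map_cost (c : E -> R) : measurable_fun [set: E] c ->
  (forall v, 0 <= c v)%R ->
  \int[rej_prob]_w (if rejects w then c (V w.1.1) + c w.2 else 0)%:E =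
  \int[gam]_v (c v * `|f v - g v|)%:E.
Proof.
move=> mc c0.
have mcE : measurable_fun [set: E] (fun v => (c v)%:E) by exact/measurable_EFinP.
have pc v : 0 <= (c v)%:E by rewrite lee_fin.
have ma : measurable_fun [set: T * E] (fun z => (c (V z.1))%:E + (c z.2)%:E).
  apply: emeasurable_funD; last exact: (measurableT_comp mcE).
  by apply: (measurableT_comp mcE); exact: measurableT_comp.
have pa (z : T * E) : 0 <= (c (V z.1))%:E + (c z.2)%:E by rewrite adde_ge0.
transitivity (\int[rej_prob]_w (if rejects w then (c (V w.1.1))%:E + (c w.2)%:E else 0)).
  by apply: eq_integral => w _; case: ifP.
rewrite (integral_rej ma pa (measurable_cst 0) (fun=> lexx 0)).
have K0 : 0 <= \int[nu]_v (c v)%:E by exact: integral_ge0.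
pose k v := U (rejset v) * ((c v)%:E + \int[nu]_v (c v)%:E).
have mk : measurable_fun [set: E] k.
  by apply: emeasurable_funM => //; exact: emeasurable_funD.
have k0 v : 0 <= k v by rewrite mule_ge0// adde_ge0.
transitivity (\int[P]_t k (V t)).
  apply: eq_integral => t _; rewrite mule0 adde0 /k/=; congr (_ * _).
  rewrite ge0_integralDT//; congr (_ + _).
  by rewrite integral_prob_cst.
rewrite (Vf mk k0) /k.
transitivity (\int[gam]_v ((c v * Num.max (f v - g v) 0)%:E +
    (Num.max (f v - g v) 0)%:E * \int[nu]_v (c v)%:E)).
  apply: eq_integral => v _; rewrite muleAC (muleC (U _)) Urej ge0_muleDr//.
  by rewrite -EFinM mulrC.
have pp v : 0 <= (c v * Num.max (f v - g v) 0)%:E.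
  by rewrite EFinM mule_ge0.
have mp (p q : E -> R) : measurable_fun [set: E] p -> measurable_fun [set: E] q ->
    measurable_fun [set: E] (fun v => (c v * Num.max (p v - q v) 0)%:E).
  move=> mp mq; apply/measurable_EFinP; apply: measurable_funM => //.
  by apply: measurable_maxr => //; exact: measurable_funB.
rewrite ge0_integralDT; last 4 first.
- exact: mp.
- by apply: emeasurable_funM => //; exact: mmax.
- exact: pp.
- by move=> v; rewrite mule_ge0.
rewrite ge0_integralZr//; last exact: mmax.
rewrite deltaE integral_nu//.
rewrite -ge0_integralDT; last 4 first.
- exact: mp.
- by apply: emeasurable_funM => //; exact: mmax.
- exact: pp.
- by move=> v; rewrite mule_ge0.
apply: eq_integral => v _; rewrite -EFinM -EFinD -mulrDr; congr (_ * _)%:E.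
by rewrite /Num.max; case: ltP => h1; case: ltP => h2; case: (ger0P (f v - g v)%R) => h3; lra.
Qed.

End rejection_coupling.

Lemma integral_prod_fst {R : realType} d1 d2 (T1 : measurableType d1)
    (T2 : measurableType d2) (P1 : probability T1 R) (P2 : probability T2 R)
    (b : T1 -> \bar R) : measurable_fun [set: T1] b -> (forall x, (0 <= b x)%E) ->
  (\int[(P1 \x P2)%E]_z b z.1 = \int[P1]_x b x)%E.
Proof.
move=> mb b0.
have m2 : measurable_fun [set: T1 * T2] (fun z => b z.1) by exact: measurableT_comp.
rewrite (@tonelli_prod R _ _ _ _ P1 P2 (fun x _ => b x) m2 (fun x _ => b0 x)).
apply: eq_integral => x _; rewrite integral_cst// -[RHS]mule1; congr (_ * _)%E.
exact: probability_setT.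
Qed.

Lemma measure_prod_fst {R : realType} d1 d2 (T1 : measurableType d1)
    (T2 : measurableType d2) (P1 : probability T1 R) (P2 : probability T2 R) B :
  measurable B -> (P1 \x P2)%E (B `*` [set: T2]) = P1 B.
Proof.
move=> mB; rewrite product_measure1E// -[RHS]mule1; congr (_ * _)%E.
exact: probability_setT.
Qed.

(** * Coupling a sum of symmetric vectors with a Gaussian vector *)

Section clt_coupling.
Context {R : realType} (N : nat).
Local Notation E := (N.-tuple R).
Notation sg := (@std_gauss R).
Notation d0 := (\d_(tzero N) : probability E R).

Lemma is_gauss_dirac0 : is_gauss d0.
Proof.
exists 0, 0, (tzero N) => B mB.
have mA := @measurable_affine R 0 N 0 (tzero N).
have mAB : measurable (affine 0 (tzero N) @^-1` B : set (0.-tuple R)).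
  by rewrite -[X in measurable X]setTI; exact: mA.
rewrite (prob_indic (sg 0) mAB) integral_std_gauss0; last first.
  exact/measurable_EFinP/measurable_indic.
have aE : affine 0 (tzero N) [tuple] = tzero N :> E.
  by apply: eq_from_tnth => i; rewrite tnth_mktuple tE add0r big_ord0.
rewrite /= diracE indicE; congr ((nat_of_bool _)%:R%:E).
by apply/idP/idP; rewrite !inE /preimage/= aE.
Qed.

(** From x <= x^2/(2c) + c/2 with c = sqrt N; dimension 0 is separate because [c] is a divisor. *)
Lemma integral_enorm_std_gauss : (\int[sg N]_z (enorm z)%:E <= (Num.sqrt N%:R)%:E)%E.
Proof.
have [N0|Npos] := posnP N.
  rewrite integral0_eq ?lee_fin ?sqrtr_ge0// => z _.
  have -> : enorm z = 0; last by [].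
  rewrite /enorm /dot (_ : \sum_(_ < _) _ = 0) ?sqrtr0//.
  apply: big1 => i _; exfalso; move: (ltn_ord i); move: (nat_of_ord i) => m.
  by rewrite N0.
pose c : R := Num.sqrt N%:R.
have cp : 0 < c by rewrite sqrtr_gt0 ltr0n.
have me : measurable_fun [set: E] (fun z : E => (enorm z)%:E).
  by apply/measurable_EFinP; exact: measurable_enorm.
have md : measurable_fun [set: E] (fun z : E => ((2 * c)^-1%:E * (dot z z)%:E)%E).
  by apply: emeasurable_funM => //; exact: measurable_normsq.
apply: (@le_trans _ _ (\int[sg N]_z ((2 * c)^-1%:E * (dot z z)%:E + (c / 2)%:E))%E).
  apply: ge0_le_integralT.
  - exact: me.
  - exact: emeasurable_funD.
  - by move=> z; rewrite lee_fin enorm_ge0.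
  - move=> z; rewrite -EFinM -EFinD lee_fin -enorm_sqr.
    have -> : (2 * c)^-1 * enorm z ^+ 2 + c / 2 =
      enorm z + (enorm z - c) ^+ 2 / (2 * c) by field; rewrite gt_eqF.
    by rewrite lerDl divr_ge0 ?sqr_ge0// mulr_ge0 ?ltW.
have c0 : 0 <= (2 * c)^-1 by rewrite invr_ge0 mulr_ge0 ?ltW.
rewrite ge0_integralDT; [|exact: md|exact: measurable_cst
  |by move=> z; rewrite mule_ge0 ?lee_fin ?dot_ge0
  |by move=> z; rewrite lee_fin divr_ge0 ?ltW].
rewrite integral_prob_cst ge0_integralZlT//; last 2 first.
- exact: measurable_normsq.
- by move=> z; rewrite lee_fin dot_ge0.
apply: (@le_trans _ _ ((2 * c)^-1%:E * N%:R%:E + (c / 2)%:E)%E).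
  by rewrite leeD2r// lee_wpmul2l ?lee_fin//; exact: std_gauss_normsq.
rewrite -EFinM -EFinD lee_fin -/c.
have -> : N%:R = c ^+ 2 :> R by rewrite sqr_sqrtr.
by rewrite le_eqVlt; apply/orP; left; apply/eqP; field; rewrite gt_eqF.
Qed.

Lemma integral_dens mu : (\int[sg N]_z (dens mu z)%:E = 1)%E.
Proof.
have := @integral_convol_std_gauss R N mu (cst 1%E) (measurable_cst _) (fun _ => lee01).
rewrite integral_prob_cst => ->.
by apply: eq_integral => z _; rewrite mul1e.
Qed.

Lemma enorm_tsub_triangle (x y z : E) :
  enorm (tsub x z) <= enorm (tsub x y) + enorm y + enorm z.
Proof.
have -> : tsub x z = tadd (tsub x y) (tsub y z).
  by apply: eq_from_tnth => i; rewrite !tE; ring.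
apply: (le_trans (ler_enormD _ _)); rewrite -addrA lerD2l.
by apply: (le_trans (ler_enormD _ _)); rewrite enormZ normrN1 mul1r.
Qed.

Context d (D : measurableType d) (Q : probability D R) (X : D -> E).
Hypothesis mX : measurable_fun [set: D] X.
Hypothesis Xb : forall w, dot (X w) (X w) <= 2^-1.
Hypothesis sX : symm (law Q mX).
Variables (k : nat) (M4 M eta lam : R).
Hypothesis hM4 : (\int[Q]_v \int[Q]_w (dot (X v) (X w) ^+ 4)%:E <= M4%:E)%E.
Hypothesis hM : (mom2 (law Q mX) <= M%:E)%E.
Hypotheses (M0 : 0 <= M) (eta0 : 0 < eta) (lam0 : 0 < lam).
Hypothesis heta : 11 / 18 * M4 <= eta ^+ 2.
Hypothesis hlam : k%:R * M + N%:R <= lam ^+ 2.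

Context dT (T : measurableType dT) (P : probability T R) (W : T -> E).
Hypothesis mW : measurable_fun [set: T] W.
Hypothesis lawW : forall u : E -> \bar R, measurable_fun [set: E] u ->
  (forall x, (0 <= u x)%E) ->
  (\int[P]_t u (W t) = \int[cpow d0 (law Q mX) k]_x u x)%E.

(** The noise sits on both sides: W + Z is turned by rejection into [V], which has the law of the
    Gaussian sum plus noise and so is Gaussian itself. Hence |W - V| is at most |Z|, plus the
    rejection cost. The last clause is for degree one, where [V] must stay independent of the linear
    part. *)
Lemma clt_coupling : exists dT' (T' : measurableType dT') (P' : probability T' R)
    (pr : T' -> T) (V : T' -> E) (mV : measurable_fun [set: T'] V),
  [/\ measurable_fun [set: T'] pr,
      forall A, measurable A -> P' (pr @^-1` A) = P A,
      is_gauss (law P' mV),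
      (\int[P']_w (enorm (tsub (W (pr w)) (V w)))%:E <=
        (Num.sqrt N%:R + k%:R * eta * lam)%:E)%E &
      forall dS (F : measurableType dS) (S : T -> F), measurable_fun [set: T] S ->
       (forall A C, measurable A -> measurable C ->
          P (W @^-1` A `&` S @^-1` C) = (P (W @^-1` A) * P (S @^-1` C))%E) ->
       forall A C, measurable A -> measurable C ->
         P' (V @^-1` A `&` (fun w => S (pr w)) @^-1` C) =
         (P' (V @^-1` A) * P (S @^-1` C))%E].
Proof.
have [A covA] := cov_root Q mX Xb.
pose mu := law Q mX; pose nu := gcov A.
pose f := dens (cpow d0 mu k); pose g := dens (cpow d0 nu k).
have mom0 : mom2 d0 = 0%E.
  rewrite /mom2 integral_dirac//; last exact: measurable_normsq.
  by rewrite diracE mem_set// mul1e dot0r.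
have hsq : (sqdist mu nu <= (eta ^+ 2)%:E)%E.
  by apply: (le_trans (chi2_bound Xb sX covA hM4)); rewrite lee_fin.
have hw : (wdist (cpow d0 mu k) (cpow d0 nu k) <= (k%:R * eta * lam)%:E)%E.
  apply: (wdist_cpow eta0 lam0 M0 sX (symm_gcov A) hM _ hsq).
    by apply: le_trans hM; exact: mom2_gcov.
  by rewrite mom0 add0e lee_fin.
pose P1 : probability (T * E)%type R := (P \x sg N)%E.
pose V1 (x : T * E) := tadd (W x.1) x.2.
have mV1 : measurable_fun [set: T * E] V1.
  by apply: measurable_tadd => //; exact: measurableT_comp.
have V1f (u : E -> \bar R) : measurable_fun [set: E] u -> (forall x, (0 <= u x)%E) ->
    (\int[P1]_t u (V1 t) = \int[sg N]_z (u z * (f z)%:E))%E.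
  move=> mu_ u0.
  have m2 : measurable_fun [set: T * E] (fun z : T * E => u (tadd (W z.1) z.2)).
    exact: measurableT_comp mu_ mV1.
  rewrite (@tonelli_prod R _ _ _ _ P (sg N) (fun t z => u (tadd (W t) z)) m2 (fun _ _ => u0 _)).
  have mi := measurable_integral_shift mu_ u0 (sg N).
  have i0 x : (0 <= \int[sg N]_z u (tadd x z))%E by exact: integral_ge0.
  rewrite (lawW mi i0) -(ge0_integral_convol mu_ u0 (cpow d0 mu k) (sg N)).
  exact: integral_convol_std_gauss.
have [delta [rho [delta0 deltaE rhoE]]] := rejection_parameters
  (measurable_dens _) (dens_ge0 _) (integral_dens (cpow d0 mu k))
  (measurable_dens _) (dens_ge0 _) (integral_dens (cpow d0 nu k)).
pose P2 := rej_prob P1 rho.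
pose V2 := rej_map V1 f g.
have mV2 : measurable_fun [set: (T * E * measurableTypeR R) * E] V2.
  exact: measurable_rej_map mV1 (measurable_dens _) (measurable_dens _).
have mpr : measurable_fun [set: (T * E * measurableTypeR R) * E] (fun w => w.1.1.1).
  by apply: measurableT_comp => //; apply: measurableT_comp.
exists _, ((T * E * measurableTypeR R) * E)%type, P2, (fun w => w.1.1.1), V2, mV2.
split => //.
- move=> B mB.
  have -> : (fun w : (T * E * measurableTypeR R) * E => w.1.1.1) @^-1` B =
      ((B `*` setT) `*` setT) `*` setT.
    by apply/seteqP; split => -[[[]]]/=; tauto.
  have mB1 : measurable (B `*` [set: E]) by exact: measurableX.
  have mB2 : measurable (B `*` [set: E] `*` [set: measurableTypeR R]).
    exact: measurableX.
  apply: (etrans (measure_prod_fst (P1 \x uniform_prob (@ltr01 R))%E rho mB2)).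
  apply: (etrans (measure_prod_fst P1 (uniform_prob (@ltr01 R)) mB1)).
  exact: (measure_prod_fst P (sg N) mB).
- apply: (@is_gauss_eq R N (convol (cpow d0 nu k) (sg N))).
    move=> B mB; apply: eq_meas_integral mB => u mu_ u0.
    rewrite (integral_convol_std_gauss _ mu_ u0).
    rewrite (ge0_integral_law P2 mV2 mu_ u0).
    by rewrite /P2 /V2 (rej_map_law mV1 (measurable_dens _) (dens_ge0 _)
      (measurable_dens _) (dens_ge0 _) V1f delta0 deltaE rhoE mu_ u0).
  apply: is_gauss_convol; last exact: is_gauss_std.
  apply: is_gauss_cpow; first exact: is_gauss_dirac0.
  exact: is_gauss_gcov.
- have me : measurable_fun [set: E] (@enorm R N) by exact: measurable_enorm.
  have cost := rej_map_cost mV1 (measurable_dens _) (dens_ge0 _)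
      (measurable_dens _) (dens_ge0 _) V1f delta0 deltaE rhoE me (@enorm_ge0 R N).
  pose J w := (if rejects V1 f g w then enorm (V1 w.1.1) + enorm w.2 else 0)%:E.
  have mw112 : measurable_fun [set: (T * E * measurableTypeR R) * E] (fun w => w.1.1.2).
    by apply: measurableT_comp => //; apply: measurableT_comp.
  have mw11 : measurable_fun [set: (T * E * measurableTypeR R) * E] (fun w => w.1.1).
    by apply: measurableT_comp.
  have mJ : measurable_fun [set: (T * E * measurableTypeR R) * E] J.
    apply/measurable_EFinP; apply: measurable_fun_ifT => //.
      exact: measurable_rejects mV1 (measurable_dens _) (measurable_dens _).
    apply: measurable_funD; last exact: measurable_enorm_comp.
    by apply: measurable_enorm_comp; exact: measurableT_comp mV1 mw11.
  have J0 w : (0 <= J w)%E by rewrite /J; case: ifP => _; rewrite lee_fin ?addr_ge0 ?enorm_ge0.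
  have mz : measurable_fun [set: (T * E * measurableTypeR R) * E] (fun w => (enorm w.1.1.2)%:E).
    by apply/measurable_EFinP; exact: measurable_enorm_comp.
  have z0 (w : (T * E * measurableTypeR R) * E) : (0 <= (enorm w.1.1.2)%:E)%E by rewrite lee_fin enorm_ge0.
  apply: (@le_trans _ _ (\int[P2]_w ((enorm w.1.1.2)%:E + J w))%E).
    apply: ge0_le_integralT.
    + apply/measurable_EFinP; apply: measurable_enorm_comp; apply: measurable_tsub => //.
      exact: measurableT_comp mW mpr.
    + exact: emeasurable_funD.
    + by move=> w; rewrite lee_fin enorm_ge0.
    + move=> w; rewrite /J /V2 /rej_map -EFinD lee_fin.
      have zE : enorm (tsub (W w.1.1.1) (V1 w.1.1)) = enorm w.1.1.2.
        rewrite /V1 -[RHS]mul1r -normrN1 -enormZ; congr enorm.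
        by apply: eq_from_tnth => i; rewrite !tE; ring.
      case: ifP => _; last by rewrite zE addr0.
      by rewrite addrA -zE enorm_tsub_triangle.
  rewrite (ge0_integralDT _ mz mJ z0 J0) EFinD; apply: leeD; last first.
    rewrite /J /P2 cost; exact: hw.
  apply: le_trans integral_enorm_std_gauss.
  have m2 : measurable_fun [set: T * E] (fun x : T * E => (enorm x.2)%:E).
    by apply/measurable_EFinP; exact: measurable_enorm_comp.
  have E1 : (\int[P2]_w (enorm w.1.1.2)%:E = \int[P1]_x (enorm x.2)%:E)%E.
    rewrite (@integral_prod_fst R _ _ _ _ (P1 \x uniform_prob (@ltr01 R))%E rho
      (fun x => (enorm x.1.2)%:E)).
    - apply: (@integral_prod_fst R _ _ _ _ P1 (uniform_prob (@ltr01 R)) _ m2) => x.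
      by rewrite lee_fin enorm_ge0.
    - exact: (measurableT_comp m2 measurable_fst).
    - by move=> x; rewrite lee_fin enorm_ge0.
  rewrite E1 (@tonelli_prod R _ _ _ _ P (sg N) (fun t z => (enorm z)%:E) m2).
    rewrite integral_cst// [X in (_ * X)%E](_ : _ = 1%E) ?mule1//.
    exact: probability_setT.
  by move=> t z; rewrite lee_fin enorm_ge0.
- move=> dS F S mS hS B C mB mC.
  have mS1 : measurable_fun [set: T * E] (fun x => S x.1) by exact: measurableT_comp.
  have PS (C' : set F) : measurable C' -> P1 ((fun x => S x.1) @^-1` C') = P (S @^-1` C').
    move=> mC'.
    have -> : (fun x : T * E => S x.1) @^-1` C' = (S @^-1` C') `*` setT.
      by apply/seteqP; split => -[]/=; tauto.
    by apply: (measure_prod_fst P (sg N)); exact: measurable_preimageT.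
  rewrite -(PS C mC).
  apply: (rej_map_indep mV1 (measurable_dens _) (dens_ge0 _)
      (measurable_dens _) (dens_ge0 _) V1f delta0 deltaE rhoE mS1 _ mB mC).
  move=> B' C' mB' mC'; rewrite (PS C' mC').
  have mIB : measurable_fun [set: E] (fun v : E => (\1_B' v)%:E : \bar R).
    by exact/measurable_EFinP/measurable_indic.
  have mIC : measurable_fun [set: F] (fun v : F => (\1_C' v)%:E : \bar R).
    by exact/measurable_EFinP/measurable_indic.
  have pI dX (X' : measurableType dX) (B0 : set X') v : (0 <= (\1_B0 v)%:E :> \bar R)%E.
    by rewrite lee_fin.
  pose kk (x : E) := (\int[sg N]_z (\1_B' (tadd x z))%:E)%E : \bar R.
  have mkk : measurable_fun [set: E] kk.
    exact: (measurable_integral_shift mIB (pI _ _ _) (sg N)).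
  have kk0 x : (0 <= kk x)%E by exact: integral_ge0.
  have m2 : measurable_fun [set: T * E] (fun z : T * E => (\1_B' (tadd (W z.1) z.2))%:E : \bar R).
    exact: measurableT_comp mIB mV1.
  have -> : P1 (V1 @^-1` B') = (\int[P]_t kk (W t))%E.
    transitivity (\int[P1]_x (\1_(V1 @^-1` B') x)%:E)%E.
      by rewrite integral_indic ?setIT//; exact: measurable_preimageT.
    exact: (@tonelli_prod R _ _ _ _ P (sg N) (fun t z => (\1_B' (tadd (W t) z))%:E) m2 (fun _ _ => pI _ _ _ _)).
  have mWi := measurableT_comp mIC mS.
  rewrite -(indep_integral mW mS hS mkk kk0 mC').
  transitivity (\int[P1]_x ((\1_B' (tadd (W x.1) x.2))%:E * (\1_C' (S x.1))%:E))%E.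
    transitivity (\int[P1]_x (\1_(V1 @^-1` B' `&` (fun x => S x.1) @^-1` C') x)%:E)%E.
      by rewrite integral_indic ?setIT//; apply: measurableI; exact: measurable_preimageT.
    apply: eq_integral => x _; rewrite !indicE in_setI.
    have -> : (x \in V1 @^-1` B') = (tadd (W x.1) x.2 \in B').
      by apply/idP/idP; rewrite !inE.
    have -> : (x \in (fun x => S x.1) @^-1` C') = (S x.1 \in C').
      by apply/idP/idP; rewrite !inE.
    by rewrite -EFinM -natrM mulnb.
  have m3 : measurable_fun [set: T * E]
      (fun x => (\1_B' (tadd (W x.1) x.2))%:E * (\1_C' (S x.1))%:E : \bar R)%E.
    apply: emeasurable_funM => //.
    exact: measurableT_comp mIC mS1.
  rewrite (@tonelli_prod R _ _ _ _ P (sg N)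
    (fun t z => (\1_B' (tadd (W t) z))%:E * (\1_C' (S t))%:E)%E m3); last first.
    by move=> t z; rewrite mule_ge0.
  apply: eq_integral => t _; rewrite ge0_integralZr//.
  exact: (measurable_shift mIB).
Qed.

End clt_coupling.

(** * Sums over independent weights *)

Section conditional_independence.
Context {R : realType} d (T : measurableType d) (P : probability T R).
Context d1 d2 (E : measurableType d1) (F : measurableType d2).
Variables (Y : T -> E) (Z : T -> F).
Hypotheses (mY : measurable_fun [set: T] Y) (mZ : measurable_fun [set: T] Z).
Local Open Scope ereal_scope.

Lemma conditional_probability (ev : set T) : measurable ev -> P ev != 0 ->
  exists Q : probability T R, forall A, measurable A -> Q A * P ev = P (A `&` ev).
Proof.
move=> mev ev0.
have [c cE] : exists c : R, P ev = c%:E.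
  by exists (fine (P ev)); rewrite fineK// fin_num_measure.
have c0 : (0 < c)%R.
  by rewrite -lte_fin -cE lt_neqAle eq_sym ev0 measure_ge0.
pose h (t : T) : R := (c^-1 * \1_ev t)%R.
have mh : measurable_fun [set: T] h by apply: measurable_funM => //.
have h0 t : (0 <= h t)%R by rewrite mulr_ge0// invr_ge0 ltW.
have hE A : measurable A -> \int[P]_(t in A) (h t)%:E = c^-1%:E * P (A `&` ev).
  move=> mA; rewrite /h; under eq_integral do rewrite EFinM.
  rewrite (@ge0_integralZl _ T R P A mA (fun t => (\1_ev t)%:E)).
  - by rewrite integral_indic// setIC.
  - by apply/measurable_EFinP; apply: measurable_funTS; exact: measurable_indic.
  - by move=> t _; rewrite lee_fin.
  - by rewrite lee_fin invr_ge0 ltW.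
have h1 : \int[P]_t (h t)%:E = 1.
  by rewrite hE// setTI cE -EFinM mulVf// gt_eqF.
exists (dprob mh h0 h1) => A mA; rewrite [X in X * _](hE A mA) cE muleAC -EFinM mulVf ?gt_eqF//.
by rewrite mul1e.
Qed.

(** Uniqueness of product measures is applied under the probability conditioned on [ev]; for a null
    [ev] both sides are 0. *)
Lemma law_pair_cond (ev : set T) : measurable ev ->
  (forall A B, measurable A -> measurable B ->
    P (Y @^-1` A `&` Z @^-1` B `&` ev) = P (Y @^-1` A) * P (Z @^-1` B) * P ev) ->
  forall C, measurable C ->
    P ([set t | C (Y t, Z t)] `&` ev) = (law P mY \x law P mZ) C * P ev.
Proof.
move=> mev H C mC.
have mYZ : measurable_fun [set: T] (fun t => (Y t, Z t)) by exact: measurable_fun_pair.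
have [ev0|ev0] := eqVneq (P ev) 0.
  rewrite ev0 mule0; apply/eqP; rewrite eq_le measure_ge0 andbT -ev0.
  apply: le_measure; rewrite ?inE//; last by apply: measurableI => //; exact: (measurable_preimageT mYZ).
have [Q QE] := conditional_probability mev ev0.
rewrite -QE; last exact: (measurable_preimageT mYZ).
congr (_ * _).
apply: (law_pair mY mZ mYZ) => // A B mA mB.
rewrite (lawE P mY) (lawE P mZ).
have [c cE] : exists c : R, P ev = c%:E.
  by exists (fine (P ev)); rewrite fineK// fin_num_measure.
have cn : c != 0%R by apply: contra_neq ev0 => c0; rewrite cE c0.
have I : measurable (Y @^-1` A `&` Z @^-1` B) by apply: measurableI; exact: measurable_preimageT.
have := H A B mA mB; rewrite -QE// cE.
rewrite -[Q _]fineK ?fin_num_measure// -[P (Y @^-1` A)]fineK; last by rewrite fin_num_measure//; exact: measurable_preimageT.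
rewrite -[P (Z @^-1` B)]fineK; last by rewrite fin_num_measure//; exact: measurable_preimageT.
by rewrite -!EFinM => -[] /(mulIf cn) ->.
Qed.

End conditional_independence.

Section independence_of_family.
Context {R : realType} d (T : measurableType d) (P : probability T R).
Context (I : finType) (F : I -> set (set T)).
Hypothesis mF : forall i A, F i A -> measurable A.
Hypothesis F_indep : mutual_indep P F.
Local Open Scope ereal_scope.

(** Joint independence of [Y] from the sigma-algebras indexed by [J], in a form that survives
    feeding them into [Y] one at a time. *)
Definition indep_of d1 (E : measurableType d1) (Y : T -> E) (J : {set I}) :=
  forall A (K : {set I}) (D : I -> set T), measurable A -> K \subset J ->
    (forall i, i \in K -> F i (D i)) ->
    P (Y @^-1` A `&` \bigcap_(i in [set` K]) D i) =
    P (Y @^-1` A) * P (\bigcap_(i in [set` K]) D i).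

Lemma indep_of_cst d1 (E : measurableType d1) (y : E) J : indep_of (fun=> y) J.
Proof.
move=> A K D mA KJ FD.
have [yA|yA] := pselect (A y).
  have -> : (fun=> y) @^-1` A = [set: T] by apply/seteqP; split.
  by rewrite setTI [P setT]probability_setT mul1e.
have -> : (fun=> y) @^-1` A = set0 :> set T by apply/seteqP; split.
by rewrite set0I [P set0]measure0 mul0e.
Qed.

Lemma indep_of_comp d1 d2 (E1 : measurableType d1) (E2 : measurableType d2)
    (Y : T -> E1) (f : E1 -> E2) J : measurable_fun [set: E1] f ->
  indep_of Y J -> indep_of (f \o Y) J.
Proof.
move=> mf h A K D mA KJ FD; rewrite comp_preimage; apply: h => //.
by rewrite -[X in measurable X]setTI; exact: mf.
Qed.

Section step.
Context d1 d2 (E1 : measurableType d1) (E2 : measurableType d2).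
Variables (Y : T -> E1) (Z : T -> E2) (mY : measurable_fun [set: T] Y)
  (mZ : measurable_fun [set: T] Z) (J : {set I}) (i0 : I).
Hypotheses (i0J : i0 \in J) (Y_indep : indep_of Y J)
  (F0 : forall B, measurable B -> F i0 (Z @^-1` B)).

Let meas_cap (K : {set I}) (D : I -> set T) : (forall i, i \in K -> F i (D i)) ->
  measurable (\bigcap_(i in [set` K]) D i).
Proof.
move=> FD; apply: fin_bigcap_measurable => [|i iK]; first exact: finite_finset.
by apply: (@mF i); exact: FD.
Qed.

Let step_rect (K : {set I}) (D : I -> set T) A B : K \subset J :\ i0 ->
  (forall i, i \in K -> F i (D i)) -> measurable A -> measurable B ->
  P (Y @^-1` A `&` Z @^-1` B `&` \bigcap_(i in [set` K]) D i) =
  P (Y @^-1` A) * P (Z @^-1` B) * P (\bigcap_(i in [set` K]) D i).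
Proof.
move=> KJ FD mA mB.
have i0K : i0 \notin K by apply/negP => /(fintype.subsetP KJ); rewrite !inE eqxx.
(* The event on [Z] is counted as one more member of the intersection, at the index [i0] that [K]
   leaves out. *)
pose D' i := if i == i0 then Z @^-1` B else D i.
have FD' i : i \in i0 |: K -> F i (D' i).
  rewrite !inE /D'; have [->|_]/= := eqVneq i i0; first by move=> _; exact: F0.
  exact: FD.
have capE : \bigcap_(i in [set` i0 |: K]) D' i = Z @^-1` B `&` \bigcap_(i in [set` K]) D i.
  apply/seteqP; split => [t H|t [H1 H2] i].
    split; first by have := H i0; rewrite /= /D' eqxx; apply; rewrite !inE eqxx.
    move=> i/= iK; have := H i; rewrite /= /D'; case: eqVneq => [ii|_].
      by rewrite ii (negbTE i0K) in iK.
    by apply; rewrite !inE iK orbT.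
  rewrite /= /D' !inE; case: eqVneq => [_ _|_ /=]; first exact: H1.
  exact: H2.
rewrite -setIA -capE Y_indep//; last first.
  by rewrite finset.subUset finset.sub1set i0J; apply: (fintype.subset_trans KJ); exact: finset.subsetDl.
rewrite -muleA; congr (_ * _).
rewrite (F_indep FD') big_setU1//= {1}/D' eqxx EFinM fineK; last first.
  by rewrite fin_num_measure// -[X in measurable X]setTI; exact: mZ.
rewrite (F_indep FD); congr (_ * _%:E); apply: eq_bigr => i iK.
by rewrite /D'; case: eqVneq => // ii; rewrite ii (negbTE i0K) in iK.
Qed.

(** One index is consumed: [Z] joins the variable and [i0] leaves the set. Rectangles factor by
    mutual independence, and [law_pair_cond] extends this to all measurable sets. *)
Lemma indep_of_pair : indep_of (fun t => (Y t, Z t)) (J :\ i0).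
Proof.
move=> C K D mC KJ FD.
have mcap := meas_cap FD.
have H := law_pair_cond mY mZ mcap (fun A B mA mB => step_rect KJ FD mA mB) mC.
apply: (etrans H); congr (_ * _).
have H0 : forall i, i \in finset.set0 -> F i (D i) by move=> i; rewrite inE.
have c0 : \bigcap_(i in [set` finset.set0 : {set I}]) D i = setT.
  by apply/seteqP; split => // t _ i; rewrite /= inE.
have := law_pair_cond mY mZ (meas_cap H0) (fun A B mA mB => step_rect (finset.sub0set _) H0 mA mB) mC.
by rewrite c0 setIT [P setT]probability_setT mule1.
Qed.

Lemma law_pair_indep_of C : measurable C ->
  P [set t | C (Y t, Z t)] = (law P mY \x law P mZ) C.
Proof.
move=> mC; pose D (i : I) : set T := setT.
have H0 : forall i, i \in finset.set0 -> F i (D i) by move=> i; rewrite inE.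
have c0 : \bigcap_(i in [set` finset.set0 : {set I}]) D i = setT.
  by apply/seteqP; split => // t _ i; rewrite /= inE.
have := law_pair_cond mY mZ (meas_cap H0) (fun A B mA mB => step_rect (finset.sub0set _) H0 mA mB) mC.
by rewrite c0 setIT [P setT]probability_setT mule1.
Qed.

End step.
End independence_of_family.

Section independent_law.
Context {R : realType} d (T : measurableType d) (P : probability T R).
Context (I : finType) (F : I -> set (set T)).
Hypothesis mF : forall i A, F i A -> measurable A.
Hypothesis F_indep : mutual_indep P F.
Context d1 d2 (E1 : measurableType d1) (E2 : measurableType d2).
Variables (Y : T -> E1) (Z : T -> E2) (mY : measurable_fun [set: T] Y)
  (mZ : measurable_fun [set: T] Z) (J : {set I}) (i0 : I).
Hypotheses (i0J : i0 \in J) (Y_indep : indep_of P F Y J)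
  (F0 : forall B, measurable B -> F i0 (Z @^-1` B)).
Variable nu : probability E2 R.
Hypothesis lawZ : forall B, measurable B -> P (Z @^-1` B) = nu B.

Lemma integral_pair_indep_of (u : E1 -> E2 -> \bar R) :
  measurable_fun [set: E1 * E2] (fun z => u z.1 z.2) -> (forall x y, (0 <= u x y)%E) ->
  (\int[P]_t u (Y t) (Z t) = \int[P]_t \int[nu]_z u (Y t) z)%E.
Proof.
move=> mu u0.
have mYZ : measurable_fun [set: T] (fun t => (Y t, Z t)) by exact: measurable_fun_pair.
have u0' (z : E1 * E2) : (0 <= u z.1 z.2)%E by [].
apply: (etrans (esym (ge0_integral_law P mYZ mu u0'))).
transitivity (\int[(law P mY \x nu)%E]_z u z.1 z.2)%E.
  apply: eq_measure_integral => A mA _.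
  apply: (law_pair mY mZ mYZ) mA => B C mB mC.
  have H := law_pair_indep_of mF F_indep mY mZ i0J Y_indep F0 (measurableX mB mC).
  apply: (etrans H); rewrite product_measure1E// (lawE P mY); congr (_ * _)%E.
  by apply: (etrans (lawE P mZ C)); exact: lawZ.
apply: (etrans (@tonelli_prod R _ _ _ _ (law P mY) nu u mu u0)).
apply: (ge0_integral_law P mY).
- exact: measurable_integral2 mu u0.
- by move=> y; exact: integral_ge0.
Qed.

End independent_law.

Section rademacher_law.
Context {R : realType}.

Definition signr (b : bool) : measurableTypeR R := if b then 1 else -1.

Lemma measurable_signr : measurable_fun [set: bool] signr.
Proof. by []. Qed.

Definition rad : probability (measurableTypeR R) R :=
  law (bernoulli_prob (2^-1 : R)) measurable_signr.

Lemma half01 : 0 <= (2^-1 : R) <= 1.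
Proof. by apply/andP; split; lra. Qed.

Lemma integral_rad (u : R -> \bar R) :
  measurable_fun [set: measurableTypeR R] u -> (forall x, (0 <= u x)%E) ->
  (\int[rad]_x u x = 2^-1%:E * u 1%R + 2^-1%:E * u (-1)%R)%E.
Proof.
move=> mu u0; rewrite (ge0_integral_law _ measurable_signr mu u0).
rewrite (integral_bernoulli_prob half01)//= /signr.
by congr (_ + _%:E * _)%E; rewrite /unstable.onem; lra.
Qed.

Lemma rad_integral B : measurable B -> rad B = (\int[rad]_x (\1_B x)%:E)%E.
Proof. by move=> mB; rewrite integral_indic// setIT. Qed.

(** The two given events are disjoint and exhaust the mass, so the other values of [s] form a null
    event. *)
Lemma rademacher_law d (T : measurableType d) (P : probability T R) (s : T -> R) :
  rademacher P s -> forall B : set (measurableTypeR R), measurable B ->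
  P (s @^-1` B) = rad B.
Proof.
move=> [ms s1 s2] B mB.
have mI : measurable_fun [set: measurableTypeR R] (fun x => (\1_B x)%:E : \bar R).
  by exact/measurable_EFinP/measurable_indic.
rewrite (rad_integral mB) (integral_rad mI); last by move=> x; rewrite lee_fin.
have mpre (C : set (measurableTypeR R)) : measurable C -> measurable (s @^-1` C).
  exact: measurable_preimageT.
pose e1 := [set t | s t = 1]; pose e2 := [set t | s t = -1].
have me1 : measurable e1 by exact: (mpre [set 1%R]).
have me2 : measurable e2 by exact: (mpre [set (-1)%R]).
have dis : e1 `&` e2 = set0.
  by apply/seteqP; split => // t []; rewrite /e1 /e2 /= => ->; lra.
have mA := mpre B mB; set A := s @^-1` B in mA *.
have eU : P (e1 `|` e2) = 1%E.
  apply: (etrans (measureU P me1 me2 dis)).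
  by apply: (etrans (congr2 _ s1 s2)); congr _%:E; lra.
have P0 : P (A `\` (e1 `|` e2)) = 0%E.
  apply/eqP; rewrite eq_le measure_ge0 andbT.
  have <- : P (~` (e1 `|` e2)) = 0%E.
    by rewrite probability_setC; [rewrite eU subee|exact: measurableU].
  apply: le_measure; rewrite ?inE.
  - by apply: measurableD => //; exact: measurableU.
  - by apply: measurableC; exact: measurableU.
  - by move=> t [].
rewrite (measureDI P mA (measurableU _ _ me1 me2)) [X in (X + _)%E]P0 add0e setIUr measureU; last 3 first.
- exact: measurableI.
- exact: measurableI.
- by rewrite setIACA setIid dis setI0.
have aux (x : R) : measurable [set t | s t = x] -> P [set t | s t = x] = 2^-1%:E ->
    P (A `&` [set t | s t = x]) = (2^-1%:E * (\1_B x)%:E)%E.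
  move=> mx Px; rewrite indicE; have [xB|xB] := boolP (x \in B).
    rewrite mule1 -Px; congr (P _); apply/seteqP; split => [t []//|t tx].
    by split => //; rewrite /A /= tx; rewrite inE in xB.
  rewrite mule0 -[RHS](measure0 P); congr (P _); apply/seteqP; split => // t [].
  by rewrite /A /= => Bst sx; move: xB; rewrite -sx => /negP; rewrite inE.
by apply: congr2; apply: aux.
Qed.

End rademacher_law.

Section chain.
Context {R : realType} d (T : measurableType d) (P : probability T R).
Variables (n k : nat) (w : 'I_k -> T -> n.-tuple R) (s : 'I_k -> T -> R).
Hypothesis nw : network_weights P w s.
Context dE (E : measurableType dE).
Local Notation D := (measurableTypeR R * n.-tuple R)%type.
Variables (step : E -> D -> E) (y0 : E).
Hypothesis mstep : measurable_fun [set: E * D] (fun z => step z.1 z.2).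

(** The state after absorbing the signs and weights listed in [l]. The state space is left general
    to serve both a single sum and the pair of sums of degree one. *)
Definition chain (l : seq 'I_k) (t : T) : E :=
  foldr (fun i y => step y (s i t, w i t)) y0 l.

Let ms i : measurable_fun [set: T] (s i : T -> measurableTypeR R).
Proof. by case: nw => _ /(_ i) []. Qed.

Let mw i : measurable_fun [set: T] (w i).
Proof. by case: nw => /(_ i) []. Qed.

Lemma measurable_chain l : measurable_fun [set: T] (chain l).
Proof.
elim: l => [|i l IH]; first exact: measurable_cst.
apply: (@measurableT_comp _ _ _ _ _ _ _ _ (fun t => (chain l t, (s i t, w i t))) mstep).
apply: measurable_fun_pair; first exact: IH.
by apply: measurable_fun_pair; [exact: ms|exact: mw].
Qed.

Let Fam (i : 'I_k + 'I_k) : set (set T) :=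
  match i with
  | inl a => g_sigma_algebra_preimage (w a)
  | inr b => g_sigma_algebra_preimage (s b)
  end.

Let mFam i A : Fam i A -> measurable A.
Proof.
by case: i => i [B mB <-]; [exact: mw|exact: ms].
Qed.

Let later (l : seq 'I_k) : {set 'I_k + 'I_k} :=
  [set x : 'I_k + 'I_k | match x with inl a => a \notin l | inr a => a \notin l end].

(** Sign and weight are adjoined by two uses of [indep_of_pair], which nests the pairs to the
    left. *)
Let assoc (z : (E * measurableTypeR R) * n.-tuple R) : E := step z.1.1 (z.1.2, z.2).

Let massoc : measurable_fun [set: (E * measurableTypeR R) * n.-tuple R] assoc.
Proof.
apply: (@measurableT_comp _ _ _ _ _ _ _ _ (fun z => (z.1.1, (z.1.2, z.2))) mstep).
apply: measurable_fun_pair; first by apply: measurableT_comp.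
by apply: measurable_fun_pair => //; apply: measurableT_comp.
Qed.

Let Fam_s i (B : set (measurableTypeR R)) : measurable B -> Fam (inr i) (s i @^-1` B).
Proof. by move=> mB; exists B => //; rewrite setTI. Qed.

Let Fam_w i (B : set (n.-tuple R)) : measurable B -> Fam (inl i) (w i @^-1` B).
Proof. by move=> mB; exists B => //; rewrite setTI. Qed.

Let Fam_indep : mutual_indep P Fam.
Proof. by case: nw. Qed.

Let chain_pair i l : i \notin l -> indep_of P Fam (chain l) (later l) ->
  indep_of P Fam (fun t => (chain l t, s i t : measurableTypeR R)) (later l :\ inr i).
Proof.
move=> il H; apply: (indep_of_pair mFam Fam_indep (measurable_chain l) (ms i) _ H).
- by rewrite inE.
- exact: Fam_s.
Qed.

Let chain_indep l : uniq l -> indep_of P Fam (chain l) (later l).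
Proof.
elim: l => [_|i l IH /= /andP[il ul]]; first exact: indep_of_cst.
have H := chain_pair il (IH ul).
have mp : measurable_fun [set: T] (fun t => (chain l t, s i t : measurableTypeR R)).
  by apply: measurable_fun_pair => //; exact: measurable_chain.
have i0 : inl i \in later l :\ inr i by rewrite !inE.
have := indep_of_pair mFam Fam_indep mp (mw i) i0 H (@Fam_w i).
have -> : later l :\ inr i :\ inl i = later (i :: l).
  by apply/setP => -[] j; rewrite !inE (inj_eq inl_inj, inj_eq inr_inj) negb_or.
by move=> /(indep_of_comp massoc).
Qed.

(** As [i] does not occur in [l], its sign and weight are independent of the state and are
    integrated out against their laws. *)
Lemma integral_chain_cons i l (u : E -> \bar R) : uniq (i :: l) ->
  measurable_fun [set: E] u -> (forall x, (0 <= u x)%E) ->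
  (\int[P]_t u (chain (i :: l) t) =
   \int[P]_t \int[rad]_a \int[std_gauss n]_v u (step (chain l t) (a, v)))%E.
Proof.
move=> /= /andP[il ul] mu u0.
have H := chain_pair il (chain_indep ul).
have mp : measurable_fun [set: T] (fun t => (chain l t, s i t : measurableTypeR R)).
  by apply: measurable_fun_pair => //; exact: measurable_chain.
have i0 : inl i \in later l :\ inr i by rewrite !inE.
have i1 : inr i \in later l by rewrite !inE.
have lw B : measurable B -> P (w i @^-1` B) = std_gauss n B.
  by case: nw => /(_ i) [_ h] _ _; exact: h.
have ls : rademacher P (s i) by case: nw.
have mu1 := measurableT_comp mu massoc.
have := @integral_pair_indep_of R _ T P _ Fam mFam Fam_indep _ _ _ _
  (fun t => (chain l t, s i t : measurableTypeR R)) (w i) mp (mw i) _ _ i0 H (@Fam_w i)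
  (std_gauss n) lw (fun z v => u (step z.1 (z.2, v))) mu1 (fun _ _ => u0 _).
move=> e1; apply: (etrans e1).
have m2 := @measurable_integral2 R _ _ _ _ (std_gauss n)
  (fun z v => u (step z.1 (z.2, v))) mu1 (fun _ _ => u0 _).
have := (@integral_pair_indep_of R _ T P _ Fam mFam Fam_indep _ _ _ (measurableTypeR R)
  (chain l) (s i) (measurable_chain l) (ms i) _ _ i1 (chain_indep ul) (@Fam_s i)
  rad (rademacher_law ls) (fun y a => \int[std_gauss n]_v u (step y (a, v)))%E m2).
by apply => y a; exact: integral_ge0.
Qed.

End chain.

Section sums.
Context {R : realType} d (T : measurableType d) (P : probability T R).
Variables (n k : nat) (w : 'I_k -> T -> n.-tuple R) (s : 'I_k -> T -> R).
Hypothesis nw : network_weights P w s.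
Local Notation D := (measurableTypeR R * n.-tuple R)%type.
Notation d0 N := (\d_(tzero N) : probability (N.-tuple R) R).
Variables (N : nat) (X : D -> N.-tuple R) (mX : measurable_fun [set: D] X).

Definition weight_sum (t : T) : N.-tuple R :=
  [tuple \sum_(i < k) tnth (X (s i t, w i t)) c | c < N].

Let step (y : N.-tuple R) (z : D) := tadd y (X z).

Let mstep : measurable_fun [set: N.-tuple R * D] (fun z => step z.1 z.2).
Proof. by apply: measurable_tadd => //; exact: measurableT_comp. Qed.

Let chainE l t : chain w s step (tzero N) l t =
  [tuple \sum_(i <- l) tnth (X (s i t, w i t)) c | c < N].
Proof.
elim: l => [|i l IH].
  by apply: eq_from_tnth => c; rewrite [RHS]tnth_mktuple big_nil /= tE.
rewrite /= /step -/(chain w s step (tzero N) l t) IH.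
by apply: eq_from_tnth => c; rewrite tE !tnth_mktuple big_cons addrC.
Qed.

Let weight_sumE : weight_sum = chain w s step (tzero N) (index_enum 'I_k).
Proof. by apply/funext => t; rewrite chainE. Qed.

Lemma measurable_weight_sum : measurable_fun [set: T] weight_sum.
Proof. by rewrite weight_sumE; exact: (measurable_chain nw (tzero N) mstep). Qed.

Let chain_law l (u : N.-tuple R -> \bar R) : uniq l ->
  measurable_fun [set: N.-tuple R] u -> (forall x, (0 <= u x)%E) ->
  (\int[P]_t u (chain w s step (tzero N) l t) =
   \int[cpow (d0 N) (law (rad \x std_gauss n)%E mX) (size l)]_x u x)%E.
Proof.
elim: l u => [|i l IH] u.
  move=> _ mu u0 /=; rewrite integral_dirac// diracT mul1e.
  exact: integral_prob_cste.
move=> uil mu u0; have /andP[_ ul] : (i \notin l) && uniq l by [].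
apply: (etrans (integral_chain_cons nw (tzero N) mstep uil mu u0)).
set nu := law _ mX.
have mv := measurable_integral_shift mu u0 nu.
have v0 x : (0 <= \int[nu]_y u (tadd x y))%E by exact: integral_ge0.
rewrite /= (ge0_integral_convol mu u0 _ nu) -(IH _ ul mv v0).
apply: eq_integral => t _; set y := chain _ _ _ _ _ t.
rewrite (ge0_integral_law _ mX (measurable_shift mu y) (fun z => u0 _)).
have mz : measurable_fun [set: D] (fun z => u (step y (z.1, z.2))).
  apply: (measurableT_comp mu); apply: measurable_tadd => //.
  by apply: (measurableT_comp mX); exact: measurable_fun_pair.
have H := @tonelli_prod R _ _ _ _ rad (std_gauss n) (fun a v => u (step y (a, v))) mz (fun _ _ => u0 _).
apply: (etrans (esym H)); apply: eq_integral => -[a v] _.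
by [].
Qed.

Lemma integral_weight_sum (u : N.-tuple R -> \bar R) :
  measurable_fun [set: N.-tuple R] u -> (forall x, (0 <= u x)%E) ->
  (\int[P]_t u (weight_sum t) =
   \int[cpow (d0 N) (law (rad \x std_gauss n)%E mX) k]_x u x)%E.
Proof.
move=> mu u0; rewrite weight_sumE (chain_law (index_enum_uniq _) mu u0).
by rewrite /index_enum/= -enumT size_enum_ord.
Qed.

End sums.

Section sign_gaussian_sums.
Context {R : realType} d (T : measurableType d) (P : probability T R).
Variables (n k : nat) (w : 'I_k -> T -> n.-tuple R) (s : 'I_k -> T -> R).
Hypothesis nw : network_weights P w s.
Local Notation D := (measurableTypeR R * n.-tuple R)%type.
Notation d0 N := (\d_(tzero N) : probability (N.-tuple R) R).
Variables (N : nat) (X : measurableTypeR R -> N.-tuple R)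
  (mX : measurable_fun [set: measurableTypeR R] X) (alpha : R).

Lemma measurable_tscale_cst m (a : R) : measurable_fun [set: m.-tuple R] (tscale a).
Proof. by apply: measurable_tscale. Qed.

Let Y (z : D) : n.-tuple R := tscale (alpha * z.1) z.2.
Let X' (z : D) := X z.1.

Let mY : measurable_fun [set: D] Y.
Proof. by apply: measurable_tscale => //; exact: measurable_funM. Qed.

Let mX' : measurable_fun [set: D] X'.
Proof. exact: measurableT_comp. Qed.

Definition scaled_gauss : probability (n.-tuple R) R :=
  law (std_gauss n) (measurable_tscale_cst (m := n) alpha).

Let step (y : N.-tuple R * n.-tuple R) (z : D) :=
  (tadd y.1 (X' z), tadd y.2 (Y z)).

Let E := (N.-tuple R * n.-tuple R)%type.

Let mstep : measurable_fun [set: E * D] (fun z => step z.1 z.2).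
Proof.
apply: measurable_fun_pair; apply: measurable_tadd.
- by apply: measurableT_comp.
- exact: measurableT_comp.
- by apply: measurableT_comp.
- exact: measurableT_comp.
Qed.

Let c0 : E := (tzero N, tzero n).

Let chainE l t : chain w s step c0 l t =
  ([tuple \sum_(i <- l) tnth (X' (s i t, w i t)) c | c < N],
   [tuple \sum_(i <- l) tnth (Y (s i t, w i t)) c | c < n]).
Proof.
elim: l => [|i l IH].
  by congr pair; apply: eq_from_tnth => c; rewrite [RHS]tnth_mktuple big_nil /= tE.
rewrite /= -/(chain w s step c0 l t) IH /step.
apply: congr2; apply: eq_from_tnth => c; rewrite [LHS]tnth_tadd.
  rewrite [RHS]tnth_mktuple big_cons addrC; congr (_ + _).
  by rewrite [LHS]tnth_mktuple.
rewrite [RHS]tnth_mktuple big_cons addrC; congr (_ + _).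
by rewrite [LHS]tnth_mktuple.
Qed.

(** A Gaussian vector times a fixed sign has the same law, so the sign can be erased. *)
Let flip (u : n.-tuple R -> \bar R) : measurable_fun [set: n.-tuple R] u ->
  (forall x, (0 <= u x)%E) -> forall x a, a = 1 \/ a = -1 ->
  (\int[std_gauss n]_v u (tadd x (tscale (alpha * a) v)) =
   \int[scaled_gauss]_v u (tadd x v))%E.
Proof.
move=> mu u0 x a [->|->].
  by rewrite mulr1 (ge0_integral_law _ (measurable_tscale_cst alpha)
    (measurable_shift mu x) (fun z => u0 _)).
rewrite (ge0_integral_law _ (measurable_tscale_cst alpha)
    (measurable_shift mu x) (fun z => u0 _)).
rewrite -std_gauss_opp; last 2 first.
- apply: (measurableT_comp mu); apply: measurable_tadd => //.
  exact: measurable_tscale.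
- by move=> v.
by apply: eq_integral => v _; rewrite tscaleA mulrN1 -mulrN1 -mulrA mulrN1 opprK mulr1.
Qed.

(** Although each sign enters both sums, the conditional law of the Gaussian sum given the signs
    does not depend on them, by [flip] at each step. So that sum may be replaced by an independent
    copy under the inner integral. *)
Let chain_law l (u : N.-tuple R -> n.-tuple R -> \bar R) : uniq l ->
  measurable_fun [set: E] (fun z => u z.1 z.2) -> (forall x y, (0 <= u x y)%E) ->
  (\int[P]_t u (chain w s step c0 l t).1 (chain w s step c0 l t).2 =
   \int[P]_t \int[cpow (d0 n) scaled_gauss (size l)]_y u (chain w s step c0 l t).1 y)%E.
Proof.
elim: l u => [|i l IH] u.
  move=> _ mu u0 /=; apply: eq_integral => t _.
  rewrite integral_dirac// ?diracT ?mul1e//.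
  exact: (measurableT_comp mu (measurable_pair1 _)).
move=> uil mu u0; have /andP[_ ul] : (i \notin l) && uniq l by [].
have mu' : measurable_fun [set: E] (fun z => u z.1 z.2) := mu.
apply: (etrans (integral_chain_cons nw c0 mstep uil mu (fun z => u0 _ _))).
set G := cpow (d0 n) scaled_gauss.
pose u1 (x : N.-tuple R) (y : n.-tuple R) :=
  (\int[rad]_a \int[scaled_gauss]_v u (tadd x (X a)) (tadd y v))%E.
have mpair dd (S : measurableType dd) (f : S -> N.-tuple R) (g : S -> n.-tuple R) :
    measurable_fun [set: S] f -> measurable_fun [set: S] g ->
    measurable_fun [set: S] (fun z => u (f z) (g z)).
  move=> mf mg; apply: (@measurableT_comp _ _ _ _ _ _ _ _ (fun z => (f z, g z)) mu).
  exact: measurable_fun_pair.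
have mXc dd (S : measurableType dd) (f : S -> measurableTypeR R) :
    measurable_fun [set: S] f -> measurable_fun [set: S] (fun z => X (f z)).
  by move=> mf; exact: measurableT_comp mX mf.
have u10 x y : (0 <= u1 x y)%E.
  by apply: integral_ge0 => a _; exact: integral_ge0.
have m4 : measurable_fun [set: (E * measurableTypeR R) * n.-tuple R]
    (fun z => u (tadd z.1.1.1 (X z.1.2)) (tadd z.1.1.2 z.2)).
  have m11 : measurable_fun [set: (E * measurableTypeR R) * n.-tuple R] (fun z => z.1.1).
    by apply: measurableT_comp.
  apply: mpair; apply: measurable_tadd => //.
  - exact: (measurableT_comp measurable_fst m11).
  - by apply: mXc; apply: measurableT_comp.
  - exact: (measurableT_comp measurable_snd m11).
have m3 := @measurable_integral2 R _ _ (E * measurableTypeR R)%type (n.-tuple R) scaled_gauss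
  (fun z v => u (tadd z.1.1 (X z.2)) (tadd z.1.2 v)) m4 (fun _ _ => u0 _ _).
have mu1 : measurable_fun [set: E] (fun z => u1 z.1 z.2).
  apply: (@measurable_integral2 R _ _ E (measurableTypeR R) rad
    (fun z a => \int[scaled_gauss]_v u (tadd z.1 (X a)) (tadd z.2 v))%E m3).
  by move=> z a; exact: integral_ge0.
have u1E x y : (\int[rad]_a \int[std_gauss n]_v u (step (x, y) (a, v)).1 (step (x, y) (a, v)).2 = u1 x y)%E.
  have mg (Q : probability (n.-tuple R) R) (f : D -> n.-tuple R) : measurable_fun [set: D] f ->
      measurable_fun [set: measurableTypeR R] (fun a => \int[Q]_v u (tadd x (X a)) (tadd y (f (a, v))))%E.
    move=> mf; apply: (@measurable_integral2 R _ _ (measurableTypeR R) (n.-tuple R) Q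
      (fun a v => u (tadd x (X a)) (tadd y (f (a, v))))) => //.
    have mf' : measurable_fun [set: D] (fun z => f (z.1, z.2)).
      by apply: (measurableT_comp mf); exact: measurable_fun_pair.
    have mX1 : measurable_fun [set: D] (fun z => X z.1) by exact: mX'.
    by apply: mpair; apply: measurable_tadd.
  have g0 (Q : probability (n.-tuple R) R) (f : D -> n.-tuple R) a :
      (0 <= \int[Q]_v u (tadd x (X a)) (tadd y (f (a, v))))%E by exact: integral_ge0.
  have mux z : measurable_fun [set: n.-tuple R] (u z) by exact: mpair.
  rewrite (integral_rad (mg (std_gauss n) Y mY) (g0 _ _)).
  rewrite /u1 (integral_rad (mg scaled_gauss snd measurable_snd) (g0 _ _)).
  congr (_ * _ + _ * _)%E.
    by apply: (flip (mux _) (u0 _)); left.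
  by apply: (flip (mux _) (u0 _)); right.
transitivity (\int[P]_t u1 (chain w s step c0 l t).1 (chain w s step c0 l t).2)%E.
  by apply: eq_integral => t _; rewrite -u1E; case: (chain _ _ _ _ _ t).
rewrite (IH u1 ul mu1 u10) -/G.
pose h (x : N.-tuple R) := (\int[G (size l).+1]_y u x y)%E.
have mh : measurable_fun [set: N.-tuple R] h by exact: measurable_integral2.
have h0 x : (0 <= h x)%E by exact: integral_ge0.
have mhE : measurable_fun [set: E] (fun z => h z.1) by exact: measurableT_comp.
apply/esym; apply: (etrans (integral_chain_cons nw c0 mstep uil mhE (fun z => h0 _))).
apply: eq_integral => t _; move: (chain _ _ _ _ _ t) => -[x y0] /=.
rewrite /u1.
have m5 : measurable_fun [set: n.-tuple R * measurableTypeR R]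
    (fun z => \int[scaled_gauss]_v u (tadd x (X z.2)) (tadd z.1 v))%E.
  apply: (@measurable_integral2 R _ _ (n.-tuple R * measurableTypeR R)%type (n.-tuple R) scaled_gauss
    (fun z v => u (tadd x (X z.2)) (tadd z.1 v))) => //.
  apply: mpair; apply: measurable_tadd => //.
  - by apply: mXc; apply: measurableT_comp.
  - by apply: measurableT_comp.
have sw := @tonelli_swap R _ _ _ _ (G (size l)) rad
  (fun y a => \int[scaled_gauss]_v u (tadd x (X a)) (tadd y v))%E m5
  (fun _ _ => integral_ge0 _ (fun _ _ => u0 _ _)).
apply: (etrans _ (esym sw)); apply: eq_integral => a _.
apply: (etrans (integral_prob_cste (std_gauss n) (h (tadd x (X a))))).
rewrite /h /=; apply: ge0_integral_convol => //.
by apply: mpair.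
Qed.

Definition sign_sum (t : T) : N.-tuple R :=
  [tuple \sum_(i < k) tnth (X (s i t)) c | c < N].

Definition gauss_sum (t : T) : n.-tuple R :=
  [tuple \sum_(i < k) tnth (tscale (alpha * s i t) (w i t)) c | c < n].

Let chain_sums : chain w s step c0 (index_enum 'I_k) = fun t => (sign_sum t, gauss_sum t).
Proof. by apply/funext => t; rewrite chainE. Qed.

Let mchain : measurable_fun [set: T] (chain w s step c0 (index_enum 'I_k)).
Proof. exact: (measurable_chain nw c0 mstep). Qed.

Lemma measurable_sign_sum : measurable_fun [set: T] sign_sum.
Proof.
have -> : sign_sum = fst \o chain w s step c0 (index_enum 'I_k) by rewrite chain_sums.
exact: (measurableT_comp measurable_fst mchain).
Qed.

Lemma measurable_gauss_sum : measurable_fun [set: T] gauss_sum.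
Proof.
have -> : gauss_sum = snd \o chain w s step c0 (index_enum 'I_k) by rewrite chain_sums.
exact: (measurableT_comp measurable_snd mchain).
Qed.

Lemma sign_gauss_sum_indep (B : set (n.-tuple R)) (C : set (N.-tuple R)) :
  measurable B -> measurable C ->
  P (gauss_sum @^-1` B `&` sign_sum @^-1` C) =
    (cpow (d0 n) scaled_gauss k B * P (sign_sum @^-1` C))%E.
Proof.
move=> mB mC.
pose u (x : N.-tuple R) (y : n.-tuple R) : \bar R := (\1_(C `*` B) (x, y))%:E.
have mCB : measurable (C `*` B) by exact: measurableX.
have mu : measurable_fun [set: E] (fun z => u z.1 z.2).
  have -> : (fun z => u z.1 z.2) = (fun z : E => (\1_(C `*` B) z)%:E) by apply/funext => -[].
  exact/measurable_EFinP/measurable_indic.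
have u0 x y : (0 <= u x y)%E by rewrite lee_fin.
have mS := measurable_preimageT measurable_sign_sum mC.
have mG := measurable_preimageT measurable_gauss_sum mB.
have := chain_law (index_enum_uniq _) mu u0.
have -> : size (index_enum 'I_k) = k by rewrite /index_enum/= -enumT size_enum_ord.
rewrite chain_sums /=; set G := cpow _ _ _ => H.
have uE x y : u x y = ((\1_C x)%:E * (\1_B y)%:E)%E.
  by rewrite /u !indicE in_setX -EFinM -natrM mulnb.
transitivity (\int[P]_t u (sign_sum t) (gauss_sum t))%E.
  rewrite (prob_indic P (measurableI _ _ mG mS)); apply: eq_integral => t _.
  rewrite uE !indicE in_setI -EFinM -natrM mulnb andbC.
  by congr ((nat_of_bool _)%:R%:E); apply/idP/idP; rewrite !inE.
rewrite H; transitivity (\int[P]_t ((\1_(sign_sum @^-1` C) t)%:E * G B))%E.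
  apply: eq_integral => t _; under eq_integral do rewrite uE.
  rewrite ge0_integralZlT//; last by exact/measurable_EFinP/measurable_indic.
  rewrite -(prob_indic G mB) !indicE; congr ((nat_of_bool _)%:R%:E * _)%E.
rewrite ge0_integralZr//; last by exact/measurable_EFinP/measurable_indic.
by rewrite muleC -(prob_indic P mS).
Qed.

End sign_gaussian_sums.

(** * Processes spanned by finitely many functions *)

Section open_measurable.
Context {R : realType} (N : nat).
Local Notation E := (N.-tuple R).

Let box (q : N.-tuple rat) (m : nat) : set E :=
  [set c | forall i, `|tnth c i - ratr (tnth q i)| < m.+1%:R^-1].

Let measurable_box q m : measurable (box q m).
Proof.
have -> : box q m = \bigcap_(i in [set: 'I_N])
    ((fun c => `|tnth c i - ratr (tnth q i)|) @^-1` `]-oo, m.+1%:R^-1[%classic).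
  apply/seteqP; split => [c h i _|c h i].
    by rewrite /= in_itv/=; exact: h.
  by have := h i I; rewrite /= in_itv/=.
apply: fin_bigcap_measurable => // i _.
rewrite -[X in measurable X]setTI.
have mf : measurable_fun [set: E] (fun c : E => `|tnth c i - ratr (tnth q i)|).
  apply: measurableT_comp => //.
  by apply: measurable_funB => //; exact: measurable_tnth.
by apply: mf => //; exact: measurable_itv.
Qed.

(** An open set is the union of the rational boxes that it contains, and these are countably
    many. *)
Lemma measurable_enorm_open (A : set E) :
  (forall c, A c -> exists2 delta : R, 0 < delta &
     forall c', enorm (tsub c' c) < delta -> A c') -> measurable A.
Proof.
move=> oA.
pose F (z : N.-tuple rat * nat) := if pselect (box z.1 z.2 `<=` A) then box z.1 z.2 else set0.
have -> : A = \bigcup_z F z.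
  apply/seteqP; split => [c Ac|c [z _]]; last first.
    by rewrite /F; case: pselect => // h; exact: h.
  have [delta d0 hd] := oA _ Ac.
  (* Two points of a box of radius at most [r] differ by at most [2 * r] in each coordinate, so in
     norm by at most 2 r sqrt N < delta. Using N + 1 makes this valid for [N = 0] too. *)
  pose r := delta / (2 * N.+1%:R).
  have r0 : 0 < r by rewrite divr_gt0// mulr_gt0// ltr0n.
  have [m hm] : exists m : nat, m.+1%:R^-1 < r.
    exists (Num.truncn r^-1); rewrite invf_plt ?posrE ?ltr0n//.
    exact: truncnS_gt.
  have [q hq] : exists q : N.-tuple rat, forall i, `|tnth c i - ratr (tnth q i)| < m.+1%:R^-1.
    have ex i : exists q : rat, `|tnth c i - ratr q| < m.+1%:R^-1.
      have : tnth c i - m.+1%:R^-1 < tnth c i + m.+1%:R^-1.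
        have m0 : 0 < (m.+1%:R^-1 : R) by rewrite invr_gt0 ltr0n.
        by rewrite ltrBlDr -addrA ltrDl addr_gt0.
      move=> /rat_in_itvoo[q]; rewrite in_itv/= => /andP[h1 h2].
      exists q; rewrite ltr_norml ltrBrDr ltrBlDr; apply/andP; split.
        by rewrite addrC -ltrBrDr opprK.
      by rewrite addrC -ltrBlDr.
    have [g hg] := choice ex.
    by exists [tuple g i | i < N] => i; rewrite tnth_mktuple.
  exists (q, m) => //; rewrite /F/=; case: pselect => [_//|h].
  exfalso; apply: h => c' bc'; apply: hd.
  have dE : delta = r * (2 * N.+1%:R) by rewrite /r divfK// mulf_neq0// pnatr_eq0.
  rewrite -ltr_sqr ?nnegrE ?enorm_ge0 ?(ltW d0)// enorm_sqr dE.
  apply: (@le_lt_trans _ _ (\sum_(i < N) (2 * r) ^+ 2)).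
    apply: ler_sum => i _; rewrite !tE mulN1r -expr2 -[leLHS]real_normK ?num_real//.
    rewrite ler_sqr ?nnegrE//; last by rewrite pmulr_rge0// ltW.
    have := ler_normD (tnth c' i - ratr (tnth q i)) (ratr (tnth q i) - tnth c i).
    have -> : tnth c' i - ratr (tnth q i) + (ratr (tnth q i) - tnth c i) = tnth c' i - tnth c i.
      by ring.
    move=> /le_trans; apply; rewrite mulr_natl mulr2n lerD//.
      exact: ltW (lt_trans (bc' i) hm).
    by rewrite distrC; exact: ltW (lt_trans (hq i) hm).
  rewrite sumr_const card_ord -[ltLHS]mulr_natl.
  have N1 : (N%:R : R) < N.+1%:R ^+ 2.
    by rewrite -natrX ltr_nat -mulnn mulSn ltnS leq_addr.
  have r2 : 0 < r ^+ 2 by rewrite exprn_gt0.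
  have -> : (r * (2 * N.+1%:R)) ^+ 2 = N.+1%:R ^+ 2 * (2 * r) ^+ 2 by ring.
  by rewrite ltr_pM2r// exprn_gt0// mulr_gt0.
have fi z : measurable (F z).
  by rewrite /F; case: ifP => _; [exact: measurable_box|exact: measurable0].
exact: countable_bigcupT_measurable.
Qed.

End open_measurable.

Section finite_dimensional_process.
Context {R : realType} (n N : nat).
Local Notation E := (N.-tuple R).
Variables (Psi : n.-tuple R -> E) (b : R).
Hypothesis mPsi : measurable_fun [set: n.-tuple R] Psi.
Hypothesis Psi_le : forall x, sphere n x -> enorm (Psi x) <= b.
Hypothesis b0 : 0 <= b.

Definition linear_path (c : E) : sample_path n := fun x => dot c (Psi x).

Let measurable_sphere : measurable (sphere n : set (n.-tuple R)).
Proof.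
have -> : sphere n = @enorm R n @^-1` [set (1 : R)] by [].
by rewrite -[X in measurable X]setTI; exact: measurable_enorm.
Qed.

Lemma linear_path_le c x : sphere n x -> `|linear_path c x| <= enorm c * b.
Proof.
move=> sx; apply: (le_trans (dot_le_enorm _ _)).
by rewrite ler_wpM2l ?enorm_ge0//; exact: Psi_le.
Qed.

Lemma linear_path_sub c c' x : linear_path (tsub c c') x = linear_path c x - linear_path c' x.
Proof. by rewrite /linear_path dotDl dotZl; ring. Qed.

Lemma measurable_linear_path c : measurable_fun [set: n.-tuple R] (linear_path c).
Proof. exact: measurable_dot. Qed.

Lemma integral_linear_path_sqr c :
  (\int[sphere_measure n]_(x in sphere n) ((linear_path c x) ^+ 2)%:E <=
   ((enorm c * b) ^+ 2)%:E)%E.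
Proof.
apply: (@le_trans _ _ (\int[sphere_measure n]_(x in sphere n) ((enorm c * b) ^+ 2)%:E)%E).
  apply: ge0_le_integral.
  - exact: measurable_sphere.
  - by move=> x _; rewrite lee_fin sqr_ge0.
  - apply/measurable_EFinP; apply: measurable_funX; apply: measurable_funTS.
    exact: measurable_linear_path.
  - exact: measurable_cst.
  - move=> x sx; rewrite lee_fin -[leLHS]real_normK ?num_real//.
    by rewrite ler_sqr ?nnegrE ?mulr_ge0 ?enorm_ge0// linear_path_le.
rewrite [leLHS](integral_cst _ measurable_sphere) -[leRHS]mule1 lee_wpmul2l ?lee_fin ?sqr_ge0//.
exact: probability_le1.
Qed.

Lemma L2_linear_path c : L2 (linear_path c).
Proof.
split; first by apply: measurable_funTS; exact: measurable_linear_path.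
exact: le_lt_trans (integral_linear_path_sqr c) (ltry _).
Qed.

(** Checked on generators: evaluations are linear in the coefficients, and the preimage of an
    L^2-open set is open because coefficients map to paths in a Lipschitz way. *)
Lemma measurable_linear_path_space : measurable_fun [set: E] (linear_path : E -> path_space n).
Proof.
apply: (@measurability _ _ _ (path_space n) _ _ (@path_gen R n)) => // _ [A gA <-].
rewrite setTI; case: gA => [[UL2 oU]|[x sx [B mB ->]]]; last first.
  rewrite -[X in measurable X]setTI.
  have : measurable_fun [set: E] (fun c : E => dot c (Psi x)) by exact: measurable_dot.
  exact.
apply: measurable_enorm_open => c Uc.
have [r r0 hr] := oU _ Uc.
exists (r / (b + 1)); first by rewrite divr_gt0// ltr_wpDl.
move=> c' cc'; apply: hr; first exact: L2_linear_path.
have -> : (fun x => ((linear_path c x - linear_path c' x) ^+ 2)%:E) = fun x => ((linear_path (tsub c' c) x) ^+ 2)%:E.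
  by apply/funext => x; rewrite linear_path_sub; congr _%:E; ring.
apply: (le_lt_trans (integral_linear_path_sqr _)); rewrite lte_fin.
rewrite ltr_sqr ?nnegrE ?mulr_ge0 ?enorm_ge0 ?(ltW r0)//.
have b1 : 0 < b + 1 by rewrite ltr_wpDl.
rewrite ltr_pdivlMr// in cc'; apply: le_lt_trans cc'.
by rewrite ler_wpM2l ?enorm_ge0// lerDl.
Qed.

Lemma sup_dist_linear_path_ub c c' (M : R) :
  (forall x, sphere n x -> `|linear_path c x - linear_path c' x| <= M) ->
  (sup_dist (linear_path c) (linear_path c') <= M%:E)%E.
Proof.
by move=> h; apply: ge_ereal_sup => _ [x sx <-]; rewrite lee_fin h.
Qed.

Lemma random_process_linear_path d (T : measurableType d) (c : T -> E) : measurable_fun [set: T] c ->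
  random_process (fun t => linear_path (c t)).
Proof.
move=> mc; split; first by move=> t; exact: L2_linear_path.
exact: (measurableT_comp measurable_linear_path_space mc).
Qed.

(** The supremum is over an uncountable sphere, but its superlevel sets are open in the
    coefficients: a point [x] witnessing a value above [r] keeps doing so nearby. *)
Lemma measurable_sup_dist_linear_path d (T : measurableType d) (c c' : T -> E) : measurable_fun [set: T] c ->
  measurable_fun [set: T] c' ->
  measurable_fun [set: T] (fun t => sup_dist (linear_path (c t)) (linear_path (c' t))).
Proof.
move=> mc mc'.
pose h (v : E) : \bar R := ereal_sup [set `|linear_path v x|%:E | x in sphere n].
have -> : (fun t => sup_dist (linear_path (c t)) (linear_path (c' t))) = fun t => h (tsub (c t) (c' t)).
  apply/funext => t; rewrite /h /sup_dist; congr ereal_sup.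
  by apply/seteqP; split => [_ [x sx <-]|_ [x sx <-]]; exists x => //; rewrite linear_path_sub.
apply: (@measurableT_comp _ _ _ _ _ _ h); last exact: measurable_tsub.
apply: (measurability _ (ErealGenOInfty.measurableE R)) => _ [_ [r ->] <-].
rewrite setTI; apply: measurable_enorm_open => v /=.
rewrite in_itv/= andbT => /ereal_sup_gt[_ [x sx <-]]; rewrite lte_fin => hx.
have b1 : 0 < b + 1 by rewrite ltr_wpDl.
exists ((`|linear_path v x| - r) / (b + 1)); first by rewrite divr_gt0// subr_gt0.
move=> v'; rewrite ltr_pdivlMr// => hv; rewrite in_itv/= andbT.
apply: (@lt_le_trans _ _ `|linear_path v' x|%:E); last by apply: ereal_sup_ubound; exists x.
rewrite lte_fin.
have h1 : `|linear_path (tsub v' v) x| <= enorm (tsub v' v) * (b + 1).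
  by apply: (le_trans (linear_path_le _ sx)); rewrite ler_wpM2l ?enorm_ge0// lerDl.
have := ler_normD (linear_path v' x) (- linear_path (tsub v' v) x).
rewrite normrN linear_path_sub opprB addrC subrK -linear_path_sub.
by lra.
Qed.

Lemma gaussian_process_linear_path d (T : measurableType d) (P : probability T R) (c : T -> E) (mc : measurable_fun [set: T] c) :
  is_gauss (law P mc) -> gaussian_process P (fun t => linear_path (c t)).
Proof.
move=> gc; split; first exact: random_process_linear_path.
move=> m x sx.
pose A : 'M[R]_(m, N) := \matrix_(j, i) tnth (Psi (tnth x j)) i.
have [r [M [b' H]]] := is_gauss_affine A (tzero m) gc.
exists r, M, b' => B mB; rewrite -H// (lawE _ (measurable_affine A (tzero m))) (lawE P mc).
congr (P _); apply/seteqP.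
have E1 t : [tuple linear_path (c t) (tnth x j) | j < m] = affine A (tzero m) (c t).
  apply: eq_from_tnth => j; rewrite [LHS]tnth_mktuple [RHS]tnth_mktuple tE add0r /linear_path /dot.
  by apply: eq_bigr => i _; rewrite mxE mulrC.
by split => t /=; rewrite E1.
Qed.

Hypothesis n0 : (0 < n)%N.

Let sphere_neq0 : exists x : n.-tuple R, sphere n x.
Proof.
exists [tuple ((i : nat) == 0%N)%:R | i < n]; rewrite /sphere/= /enorm /dot.
rewrite (bigD1 (Ordinal n0))//= big1; last first.
  move=> i i0; rewrite !tnth_mktuple (_ : (i : nat) == 0%N = false) ?mul0r//.
  by apply: contraNF i0 => /eqP i0; apply/eqP/val_inj.
by rewrite tnth_mktuple /= mulr1 addr0 sqrtr1.
Qed.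

Lemma sup_dist_ge0 (f g : @sample_path R n) : (0 <= sup_dist f g)%E.
Proof.
have [x sx] := sphere_neq0.
apply: (@le_trans _ _ `|f x - g x|%:E); first by rewrite lee_fin.
by apply: ereal_sup_ubound; exists x.
Qed.

(** The competitor is the pair of paths of [c \o pr] and [c'] on the enlarged space; the first has
    the right law since [pr] preserves probabilities. Squaring is monotone because the sphere is
    non-empty, which makes every supremum, and hence the infimum, non-negative. *)
Lemma WF_infty_sqr_le d (T : measurableType d) (P : probability T R) (c : T -> E) d' (T' : measurableType d')
    (P' : probability T' R) (pr : T' -> T) (c' : T' -> E) (f : T' -> R) (kappa : R) :
  measurable_fun [set: T] c -> measurable_fun [set: T'] pr ->
  measurable_fun [set: T'] c' -> measurable_fun [set: T'] f ->
  (forall A, measurable A -> P' (pr @^-1` A) = P A) ->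
  (forall t x, sphere n x -> `|linear_path (c (pr t)) x - linear_path (c' t) x| <= f t) ->
  (\int[P']_t (f t)%:E <= kappa%:E)%E ->
  (WF_infty P (fun t => linear_path (c t)) P' (fun t => linear_path (c' t)) ^+ 2 <= (kappa ^+ 2)%:E)%E.
Proof.
move=> mc mpr mc' mf P'E hf hk; set WF := WF_infty _ _ _ _.
have mcp : measurable_fun [set: T'] (c \o pr) by exact: measurableT_comp.
have msd := measurable_sup_dist_linear_path mcp mc'.
have f0 t : 0 <= f t.
  by have [x sx] := sphere_neq0; exact: le_trans (normr_ge0 _) (hf t x sx).
have WF0 : (0 <= WF)%E.
  apply: le_ereal_inf_tmp => _ [d0 [T0 [P0 [Y [Y' [_ _ _ _ ->]]]]]].
  by apply: integral_ge0 => t _; exact: sup_dist_ge0.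
have WFk : (WF <= kappa%:E)%E.
  apply: (le_trans _ hk); apply: (@le_trans _ _ (\int[P']_t sup_dist (linear_path (c (pr t))) (linear_path (c' t)))%E).
    apply: ereal_inf_lbound; exists d', T', P', (fun t => linear_path (c (pr t))), (fun t => linear_path (c' t)).
    split => //.
    - split; last exact: random_process_linear_path mc'.
      exact: random_process_linear_path mcp.
    - move=> A mA; rewrite -[RHS]P'E//.
      rewrite -[X in measurable X]setTI.
      exact: (measurableT_comp measurable_linear_path_space mc).
  apply: ge0_le_integralT => //.
  - exact/measurable_EFinP.
  - by move=> t; exact: sup_dist_ge0.
  - by move=> t; apply: sup_dist_linear_path_ub => x; exact: hf.
case: WF WF0 WFk => [v|//|//]; rewrite !lee_fin => v0 vk.
by rewrite -expr2 ler_sqr ?nnegrE// (le_trans v0).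
Qed.

End finite_dimensional_process.

(** * Monomial features and their moments *)

Section features.
Context {R : realType} (d n : nat).

(** Words of length at most [d]: every monomial appears once per ordering of its factors. This
    replaces the multinomial weights in the expansion of (w.x)^m. *)
Definition monomial : finType := {m : 'I_d.+1 & {ffun 'I_m -> 'I_n}}.

(** The weight depends on the degree only: 1 on the side of the random weights, the coefficients of
    [p] on the side of the sphere. *)
Definition feat (u : nat -> R) (w : n.-tuple R) : #|monomial|.-tuple R :=
  [tuple u (tag (enum_val i)) * \prod_(l < tag (enum_val i)) tnth w (tagged (enum_val i) l)
    | i < #|monomial|].

Lemma dot_feat u v w x :
  dot (feat u w) (feat v x) = \sum_(m < d.+1) u m * v m * dot w x ^+ m.
Proof.
pose F (i : monomial) := (u (tag i) * v (tag i)) *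
  \prod_(l < tag i) (tnth w (tagged i l) * tnth x (tagged i l)).
transitivity (\sum_(i : monomial) F i).
  rewrite [RHS](eq_bigl (mem monomial))// [RHS]big_enum_val /dot.
  apply: eq_bigr => i _; rewrite !tnth_mktuple /F big_split/=; ring.
rewrite /F -(@sig_big_dep _ _ _ _ (fun m : 'I_d.+1 => {ffun 'I_m -> 'I_n}) xpredT (fun=> xpredT)
  (fun (m : 'I_d.+1) (f : {ffun 'I_m -> 'I_n}) =>
   (u m * v m) * \prod_(l < m) (tnth w (f l) * tnth x (f l))))/=.
apply: eq_bigr => m _; rewrite -big_distrr/=; congr (_ * _).
rewrite -(bigA_distr_bigA (fun (l : 'I_m) j => tnth w j * tnth x j)) /=.
by rewrite prodr_const card_ord.
Qed.

Lemma card_monomial : (0 < n)%N -> (#|monomial|%:R : R) <= d.+1%:R * n%:R ^+ d.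
Proof.
move=> n0; rewrite -sum1_card (eq_bigl xpredT)//.
rewrite -(@sig_big_dep _ _ _ _ (fun m : 'I_d.+1 => {ffun 'I_m -> 'I_n}) xpredT (fun=> xpredT)
  (fun (m : 'I_d.+1) (f : {ffun 'I_m -> 'I_n}) => 1%N))/=.
rewrite -natrX -natrM ler_nat.
apply: (@leq_trans (\sum_(m < d.+1) n ^ d)); last by rewrite sum_nat_const card_ord.
apply: leq_sum => m _; rewrite sum1_card card_ffun !card_ord.
by rewrite leq_pexp2l// -ltnS.
Qed.

Lemma measurable_feat u : measurable_fun [set: n.-tuple R] (feat u).
Proof.
apply/measurable_fun_tnthP => i.
rewrite (_ : _ \o _ = fun w => u (tag (enum_val i)) *
  \prod_(l < tag (enum_val i)) tnth w (tagged (enum_val i) l)); last first.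
  by apply/funext => w /=; rewrite tnth_mktuple.
apply: measurable_funM => //; apply: measurable_prod => l _.
exact: measurable_tnth.
Qed.

End features.

Section gaussian_moments.
Context {R : realType} (n : nat).
Hypothesis n0 : (0 < n)%N.
Notation sg := (@std_gauss R n).

(** The scale at which exp(l|z|^2/2) has a mean bounded in every dimension: (1 - l)^n >= 1 - n l =
    1/2. *)
Let l : R := (2 * n%:R)^-1.

Let l0 : 0 < l.
Proof. by rewrite invr_gt0 mulr_gt0// ltr0n. Qed.

Let l12 : l <= 2^-1.
Proof. by rewrite lef_pV2 ?posrE ?mulr_gt0 ?ltr0n// ler_peMr// ler1n. Qed.

Lemma expr_le_expR (x : R) q : 0 <= x -> x ^+ q <= q`!%:R * expR x.
Proof.
move=> x0; case: q => [|q].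
  by rewrite expr0 fact0 mul1r -expR0 ler_expR.
rewrite mulrC -ler_pdivrMr ?ltr0n ?fact_gt0//.
by apply: le_trans (expR_ge1Dxn q x0); rewrite lerDr.
Qed.

Lemma std_gauss_expR_le2 : (\int[sg]_z (expR (l * dot z z / 2))%:E <= 2%:E)%E.
Proof.
have l1 : l < 1 by apply: le_lt_trans l12 _; lra.
rewrite std_gauss_expR_sqr// lee_fin.
have s0 : 0 < Num.sqrt (1 - l) by rewrite sqrtr_gt0 subr_gt0.
rewrite exprVn -[leRHS]invrK lef_pV2 ?posrE ?invr_gt0 ?exprn_gt0//.
rewrite -ler_sqr ?nnegrE ?invr_ge0 ?exprn_ge0 ?(ltW s0)//.
rewrite -exprM mulnC exprM sqr_sqrtr ?subr_ge0 ?(ltW l1)//.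
have bern m : 1 - m%:R * l <= (1 - l) ^+ m.
  elim: m => [|m IH]; first by rewrite mul0r subr0 expr0.
  rewrite exprS; apply: (@le_trans _ _ ((1 - l) * (1 - m%:R * l))); last first.
    by rewrite ler_wpM2l// subr_ge0 ltW.
  have m0 : 0 <= (m%:R : R) by [].
  rewrite -natr1; nra.
apply: le_trans (bern n).
have -> : n%:R * l = 2^-1.
  by rewrite /l invfM mulrCA divff ?mulr1// pnatr_eq0 -lt0n.
lra.
Qed.

(** Use x^q <= q! exp x at x = l|z|^2/2 = |z|^2/(4n). *)
Lemma std_gauss_normsq_pow q :
  (\int[sg]_z (dot z z ^+ q)%:E <= (2 * q`!%:R * (4 * n%:R) ^+ q)%:E)%E.
Proof.
pose c : R := q`!%:R * (4 * n%:R) ^+ q.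
have c0 : 0 <= c by rewrite mulr_ge0// exprn_ge0// mulr_ge0.
have mE : measurable_fun [set: n.-tuple R] (fun z => (expR (l * dot z z / 2))%:E).
  apply/measurable_EFinP; apply: measurableT_comp => //.
  apply: measurable_funM => //; apply: measurable_funM => //.
  exact: measurable_dot.
apply: (@le_trans _ _ (\int[sg]_z (c%:E * (expR (l * dot z z / 2))%:E))%E).
  apply: ge0_le_integralT.
  - by apply/measurable_EFinP; apply: measurable_funX; exact: measurable_dot.
  - exact: emeasurable_funM.
  - by move=> z; rewrite lee_fin exprn_ge0// dot_ge0.
  - move=> z; rewrite -EFinM lee_fin /c.
    have x0 : 0 <= l * dot z z / 2 by rewrite divr_ge0// mulr_ge0 ?dot_ge0// ltW.
    have -> : dot z z ^+ q = (4 * n%:R) ^+ q * (l * dot z z / 2) ^+ q.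
      rewrite -exprMn; congr (_ ^+ _); rewrite /l; field.
      by rewrite pnatr_eq0 -lt0n.
    rewrite [leRHS]mulrAC [leRHS]mulrC ler_wpM2l ?exprn_ge0 ?mulr_ge0//.
    exact: expr_le_expR.
rewrite ge0_integralZlT//.
rewrite (_ : 2 * _ * _ = c * 2) ?EFinM; last by rewrite /c; ring.
by rewrite lee_wpmul2l ?lee_fin//; exact: std_gauss_expR_le2.
Qed.

(** With x = sqrt l <v,w>, bound x^(2q) by (2q)! (exp x + exp(-x)); integrating over [w] gives
    exp(l|v|^2/2), which has mean at most 2. The order n^q is half the exponent that Cauchy-Schwarz
    would give. *)
Lemma std_gauss_dot_pow q :
  (\int[sg]_v \int[sg]_w (dot v w ^+ q.*2)%:E <= (4 * q.*2`!%:R * (2 * n%:R) ^+ q)%:E)%E.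
Proof.
pose s : R := Num.sqrt l.
have s0 : 0 < s by rewrite sqrtr_gt0.
have s2 : s ^+ 2 = l by rewrite sqr_sqrtr// ltW.
pose c : R := q.*2`!%:R * (2 * n%:R) ^+ q.
have c0 : 0 <= c by rewrite mulr_ge0// exprn_ge0// mulr_ge0.
have mEx a : measurable_fun [set: n.-tuple R * n.-tuple R] (fun z => (expR (dot (tscale a z.1) z.2))%:E).
  apply/measurable_EFinP; apply: measurableT_comp => //.
  by apply: measurable_dot => //; apply: measurable_tscale.
have mex a v : measurable_fun [set: n.-tuple R] (fun z => (expR (dot (tscale a v) z))%:E).
  by apply/measurable_EFinP; apply: measurableT_comp => //; exact: measurable_dot.
have pt (v w : n.-tuple R) : dot v w ^+ q.*2 <= c * (expR (dot (tscale s v) w) + expR (dot (tscale (- s) v) w)).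
  have -> : dot v w ^+ q.*2 = (2 * n%:R) ^+ q * `|dot (tscale s v) w| ^+ q.*2.
    rewrite dotZl -mul2n exprM [X in _ = _ * X]exprM real_normK ?num_real//.
    rewrite -exprMn (exprMn _ s) s2; congr (_ ^+ _); rewrite /l; field.
    by rewrite pnatr_eq0 -lt0n.
  rewrite /c [leRHS]mulrAC [leRHS]mulrC ler_wpM2l ?exprn_ge0 ?mulr_ge0//.
  apply: (le_trans (expr_le_expR _ (normr_ge0 _))); rewrite ler_wpM2l//.
  rewrite !dotZl mulNr; case: (ger0P (s * dot v w)) => _; first by rewrite lerDl expR_ge0.
  by rewrite lerDr expR_ge0.
pose g (v : n.-tuple R) := expR (l * dot v v / 2).
have gE a v : a ^+ 2 = l -> (\int[sg]_w (expR (dot (tscale a v) w))%:E = (g v)%:E)%E.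
  by move=> a2; rewrite std_gauss_mgf dotZl dotZr mulrA -expr2 a2.
have mg : measurable_fun [set: n.-tuple R] (fun z => (g z)%:E).
  apply/measurable_EFinP; apply: measurableT_comp => //.
  apply: measurable_funM => //; apply: measurable_funM => //.
  exact: measurable_dot.
have inner v : (\int[sg]_w (dot v w ^+ q.*2)%:E <= (2 * c)%:E * (g v)%:E)%E.
  apply: (@le_trans _ _ (\int[sg]_w (c%:E * ((expR (dot (tscale s v) w))%:E +
      (expR (dot (tscale (- s) v) w))%:E)))%E).
    apply: ge0_le_integralT.
    - by apply/measurable_EFinP; apply: measurable_funX; exact: measurable_dot.
    - by apply: emeasurable_funM => //; exact: emeasurable_funD.
    - by move=> w; rewrite lee_fin -mul2n exprM exprn_ge0// sqr_ge0.
    - by move=> w; rewrite -EFinD -EFinM lee_fin.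
  rewrite (@ge0_integralZlT _ _ _ sg c (fun w => (expR (dot (tscale s v) w))%:E + (expR (dot (tscale (- s) v) w))%:E)%E c0); last 2 first.
  - exact: emeasurable_funD.
  - by move=> w; rewrite -EFinD lee_fin addr_ge0 ?expR_ge0.
  rewrite ge0_integralDT//.
  rewrite (gE _ _ s2) (gE (- s)) ?sqrrN// -EFinD -!EFinM lee_fin; lra.
apply: (@le_trans _ _ (\int[sg]_v ((2 * c)%:E * (g v)%:E))%E).
  apply: ge0_le_integralT => //.
  - apply: (@measurable_integral2 R _ _ _ _ sg (fun v w : n.-tuple R => (dot v w ^+ q.*2)%:E)).
      by apply/measurable_EFinP; apply: measurable_funX; exact: measurable_dot.
    by move=> v w; rewrite lee_fin -mul2n exprM exprn_ge0// sqr_ge0.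
  - exact: emeasurable_funM.
  - move=> v; apply: integral_ge0 => w _.
    by rewrite lee_fin -mul2n exprM exprn_ge0// sqr_ge0.
rewrite ge0_integralZlT ?mulr_ge0//; last by move=> v; rewrite lee_fin expR_ge0.
rewrite (_ : 4 * _ * _ = 2 * c * 2) ?EFinM; last by rewrite /c; ring.
by rewrite lee_wpmul2l ?lee_fin ?mulr_ge0//; exact: std_gauss_expR_le2.
Qed.

End gaussian_moments.

Lemma cpow_eq_integral {R : realType} N (pi mu nu : probability (N.-tuple R) R) k :
  (forall u : N.-tuple R -> \bar R, measurable_fun [set: N.-tuple R] u ->
     (forall x, (0 <= u x)%E) -> (\int[mu]_x u x = \int[nu]_x u x)%E) ->
  forall u : N.-tuple R -> \bar R, measurable_fun [set: N.-tuple R] u ->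
    (forall x, (0 <= u x)%E) ->
  (\int[cpow pi mu k]_x u x = \int[cpow pi nu k]_x u x)%E.
Proof.
move=> H; elim: k => [//|k IH] u mu_ u0 /=.
rewrite (ge0_integral_convol mu_ u0 _ mu) (ge0_integral_convol mu_ u0 _ nu).
transitivity (\int[cpow pi mu k]_x \int[nu]_y u (tadd x y))%E.
  apply: eq_integral => x _; apply: H => //; exact: measurable_shift.
apply: IH; first exact: measurable_integral_shift.
by move=> x; exact: integral_ge0.
Qed.

(** * Vectors multiplied by a random sign *)

Section signed_vectors.
Context {R : realType} (n N : nat).
Local Notation D := (measurableTypeR R * n.-tuple R)%type.
Local Notation E := (N.-tuple R).
Local Notation Q := (rad \x @std_gauss R n)%E.
Local Notation sg := (@std_gauss R n).

Lemma integral_rad_gauss (h : D -> \bar R) (h' : n.-tuple R -> \bar R) :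
  measurable_fun [set: D] h -> (forall z, (0 <= h z)%E) ->
  (forall a w, a = 1 \/ a = -1 -> h (a, w) = h' w) ->
  (\int[Q]_z h z = \int[sg]_w h' w)%E.
Proof.
move=> mh h0 hE.
have mh2 : measurable_fun [set: D] (fun z => h (z.1, z.2)).
  by have -> : (fun z : D => h (z.1, z.2)) = h by apply/funext => -[].
transitivity (\int[Q]_z h (z.1, z.2))%E; first by apply: eq_integral => -[].
rewrite (@tonelli_prod R _ _ _ _ rad sg (fun a w => h (a, w)) mh2 (fun _ _ => h0 _)).
rewrite (integral_rad (@measurable_integral2 R _ _ _ _ sg (fun a w => h (a, w)) mh2 (fun _ _ => h0 _))); last first.
  by move=> a; exact: integral_ge0.
have -> : (\int[sg]_w h (1%R, w) = \int[sg]_w h' w)%E.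
  by apply: eq_integral => w _; apply: hE; left.
have -> : (\int[sg]_w h ((-1)%R, w) = \int[sg]_w h' w)%E.
  by apply: eq_integral => w _; apply: hE; right.
have i0 : (0 <= \int[sg]_w h' w)%E.
  by apply: integral_ge0 => w _; rewrite -(hE 1)//; left.
rewrite -ge0_muleDl ?lee_fin ?invr_ge0// -EFinD.
by rewrite (_ : 2^-1 + 2^-1 = 1 :> R) ?mul1e//; lra.
Qed.

(* Makes the summand bounded at every real sign, which [rademacher] only
   constrains almost surely. *)
Definition clamp (a : measurableTypeR R) : measurableTypeR R := if 0 < a then 1 else -1.

Lemma measurable_clamp : measurable_fun [set: measurableTypeR R] clamp.
Proof.
apply: measurable_fun_ifT => //.
by apply: measurable_fun_ltr.
Qed.

Lemma clampE a : a = 1 \/ a = -1 -> clamp a = a.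
Proof. by rewrite /clamp => -[] ->; rewrite ?ltr01// ltr0N1. Qed.

Variables (Y : n.-tuple R -> E) (mY : measurable_fun [set: n.-tuple R] Y).

Definition signed (z : D) : E := tscale z.1 (Y z.2).

Lemma measurable_signed : measurable_fun [set: D] signed.
Proof. by apply: measurable_tscale => //; exact: measurableT_comp. Qed.

Definition csigned (z : D) : E := tscale (clamp z.1) (Y z.2).

Lemma measurable_csigned : measurable_fun [set: D] csigned.
Proof.
apply: measurable_tscale; last exact: measurableT_comp.
exact: measurableT_comp measurable_clamp measurable_fst.
Qed.

Lemma integral_signed (u : E -> \bar R) : measurable_fun [set: E] u ->
  (forall x, (0 <= u x)%E) ->
  (\int[law Q measurable_signed]_x u x =
   \int[sg]_w (2^-1%:E * u (Y w) + 2^-1%:E * u (tscale (-1) (Y w))))%E.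
Proof.
move=> mu u0; rewrite (ge0_integral_law _ measurable_signed mu u0).
have m2 : measurable_fun [set: D] (fun z => u (tscale z.1 (Y z.2))).
  exact: (measurableT_comp mu measurable_signed).
have mv (f : n.-tuple R -> E) : measurable_fun [set: n.-tuple R] f ->
    measurable_fun [set: n.-tuple R] (fun w => u (f w)).
  by move=> mf; exact: measurableT_comp mu mf.
have mN : measurable_fun [set: n.-tuple R] (fun w => tscale (-1) (Y w)).
  exact: measurable_tscale.
rewrite (@tonelli_prod R _ _ _ _ rad sg (fun a w => u (tscale a (Y w))) m2 (fun _ _ => u0 _)).
rewrite (integral_rad (@measurable_integral2 R _ _ _ _ sg (fun a w => u (tscale a (Y w))) m2 (fun _ _ => u0 _))); last first.
  by move=> a; exact: integral_ge0.
rewrite ge0_integralDT; last 4 first.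
- by apply: emeasurable_funM => //; exact: mv.
- by apply: emeasurable_funM => //; exact: mv.
- by move=> w; rewrite mule_ge0// lee_fin invr_ge0.
- by move=> w; rewrite mule_ge0// lee_fin invr_ge0.
rewrite !ge0_integralZlT ?invr_ge0//; last 2 first.
- exact: mv.
- exact: mv.
by congr (_ * _ + _)%E; apply: eq_integral => w _; rewrite tscale1.
Qed.

Lemma integral_csigned (u : E -> \bar R) : measurable_fun [set: E] u ->
  (forall x, (0 <= u x)%E) ->
  (\int[law Q measurable_csigned]_x u x = \int[law Q measurable_signed]_x u x)%E.
Proof.
move=> mu u0; rewrite (ge0_integral_law _ measurable_csigned mu u0).
have m2 : measurable_fun [set: D] (fun z => u (tscale (clamp z.1) (Y z.2))).
  exact: (measurableT_comp mu measurable_csigned).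
have mv (f : n.-tuple R -> E) : measurable_fun [set: n.-tuple R] f ->
    measurable_fun [set: n.-tuple R] (fun w => u (f w)).
  by move=> mf; exact: measurableT_comp mu mf.
have mN : measurable_fun [set: n.-tuple R] (fun w => tscale (-1) (Y w)).
  exact: measurable_tscale.
rewrite (integral_signed mu u0).
rewrite (@tonelli_prod R _ _ _ _ rad sg (fun a w => u (tscale (clamp a) (Y w))) m2 (fun _ _ => u0 _)).
rewrite (integral_rad (@measurable_integral2 R _ _ _ _ sg (fun a w => u (tscale (clamp a) (Y w))) m2 (fun _ _ => u0 _))); last first.
  by move=> a; exact: integral_ge0.
rewrite !clampE; [|by right|by left].
rewrite ge0_integralDT; last 4 first.
- by apply: emeasurable_funM => //; exact: mv.
- by apply: emeasurable_funM => //; exact: mv.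
- by move=> w; rewrite mule_ge0// lee_fin invr_ge0.
- by move=> w; rewrite mule_ge0// lee_fin invr_ge0.
rewrite !ge0_integralZlT ?invr_ge0//; last 2 first.
- exact: mv.
- exact: mv.
by congr (_ * _ + _)%E; apply: eq_integral => w _; rewrite tscale1.
Qed.

Lemma symm_signed : symm (law Q measurable_signed).
Proof.
move=> u mu u0.
have mN : measurable_fun [set: E] (fun x => u (tscale (-1) x)).
  by apply: (measurableT_comp mu); exact: measurable_tscale.
rewrite (integral_signed mN (fun _ => u0 _)) (integral_signed mu u0).
apply: eq_integral => w _; rewrite tscaleA mulrNN mulr1 tscale1 addeC.
by [].
Qed.

Lemma symm_csigned : symm (law Q measurable_csigned).
Proof.
move=> u mu u0.
have mN : measurable_fun [set: E] (fun x => u (tscale (-1) x)).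
  by apply: (measurableT_comp mu); exact: measurable_tscale.
rewrite (integral_csigned mN (fun _ => u0 _)) (integral_csigned mu u0).
exact: symm_signed.
Qed.

Lemma mom2_signed : (mom2 (law Q measurable_signed) = \int[sg]_w (dot (Y w) (Y w))%:E)%E.
Proof.
rewrite /mom2 (ge0_integral_law _ measurable_signed (@measurable_normsq R N)); last first.
  by move=> x; rewrite lee_fin dot_ge0.
apply: integral_rad_gauss.
- exact: measurableT_comp (@measurable_normsq R N) measurable_signed.
- by move=> z; rewrite lee_fin dot_ge0.
- by move=> a w [->|->]; rewrite /signed /= ?dotNN ?tscale1.
Qed.

Lemma mom2_csigned : (mom2 (law Q measurable_csigned) = \int[sg]_w (dot (Y w) (Y w))%:E)%E.
Proof.
rewrite -mom2_signed; apply: integral_csigned; first exact: measurable_normsq.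
by move=> x; rewrite lee_fin dot_ge0.
Qed.

Lemma mom4_csigned :
  (\int[Q]_v \int[Q]_w (dot (csigned v) (csigned w) ^+ 4)%:E =
   \int[sg]_v \int[sg]_w (dot (Y v) (Y w) ^+ 4)%:E)%E.
Proof.
have mc := measurable_csigned.
have pos (x : R) : (0 <= (x ^+ 4)%:E)%E.
  by rewrite lee_fin (exprM x 2 2) sqr_ge0.
have m2 : measurable_fun [set: D * D] (fun z => (dot (csigned z.1) (csigned z.2) ^+ 4)%:E).
  apply/measurable_EFinP; apply: measurable_funX; apply: measurable_dot.
    exact: measurableT_comp mc measurable_fst.
  exact: measurableT_comp mc measurable_snd.
apply: integral_rad_gauss.
- exact: (@measurable_integral2 R _ _ _ _ Q (fun v w => (dot (csigned v) (csigned w) ^+ 4)%:E) m2 (fun _ _ => pos _)).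
- by move=> z; exact: integral_ge0.
- move=> a v ha; apply: integral_rad_gauss.
  + apply/measurable_EFinP; apply: measurable_funX; exact: measurable_dot.
  + by move=> z; exact: pos.
  + move=> b w hb; rewrite /csigned /= !clampE// dotZl dotZr.
    by congr (_%:E); case: ha hb => -> [->|->]; ring.
Qed.

End signed_vectors.

Section signed_sums.
Context {R : realType} d (T : measurableType d) (P : probability T R).
Variables (n k : nat) (w : 'I_k -> T -> n.-tuple R) (s : 'I_k -> T -> R).
Hypothesis nw : network_weights P w s.
Variables (N : nat) (Y : n.-tuple R -> N.-tuple R) (mY : measurable_fun [set: n.-tuple R] Y).
Local Notation sg := (@std_gauss R n).

Definition signed_sum : T -> N.-tuple R := weight_sum w s (signed Y).

Lemma measurable_signed_sum : measurable_fun [set: T] signed_sum.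
Proof. exact: (measurable_weight_sum nw (measurable_signed mY)). Qed.

Lemma mom2_signed_sum M : (\int[sg]_w (dot (Y w) (Y w))%:E <= M%:E)%E ->
  (\int[P]_t (dot (signed_sum t) (signed_sum t))%:E <= (k%:R * M)%:E)%E.
Proof.
move=> hM.
rewrite (integral_weight_sum nw (measurable_signed mY) (@measurable_normsq R N)); last first.
  by move=> x; rewrite lee_fin dot_ge0.
have hM' : (mom2 (law (rad \x sg)%E (measurable_signed mY)) <= M%:E)%E.
  by rewrite mom2_signed.
apply: (le_trans (mom2_cpow _ k (symm_signed mY) hM')).
rewrite /mom2 integral_dirac//; last exact: measurable_normsq.
by rewrite diracT mul1e dot0r add0e.
Qed.

(** [clt_coupling] for the clamped vectors, whose law is that of the signed ones. Signs drop out of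
    the even moments, so the hypotheses concern [Y] alone. *)
Lemma signed_clt (M4 M eta lam : R) : (forall v, dot (Y v) (Y v) <= 2^-1) ->
  (\int[sg]_v \int[sg]_w (dot (Y v) (Y w) ^+ 4)%:E <= M4%:E)%E ->
  (\int[sg]_w (dot (Y w) (Y w))%:E <= M%:E)%E ->
  0 <= M -> 0 < eta -> 0 < lam ->
  11 / 18 * M4 <= eta ^+ 2 -> k%:R * M + N%:R <= lam ^+ 2 ->
  exists dT' (T' : measurableType dT') (P' : probability T' R)
      (pr : T' -> T) (V : T' -> N.-tuple R) (mV : measurable_fun [set: T'] V),
  [/\ measurable_fun [set: T'] pr,
      forall A, measurable A -> P' (pr @^-1` A) = P A,
      is_gauss (law P' mV),
      (\int[P']_w (enorm (tsub (signed_sum (pr w)) (V w)))%:E <=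
        (Num.sqrt N%:R + k%:R * eta * lam)%:E)%E &
      forall dS (F : measurableType dS) (S : T -> F), measurable_fun [set: T] S ->
       (forall A C, measurable A -> measurable C ->
          P (signed_sum @^-1` A `&` S @^-1` C) = (P (signed_sum @^-1` A) * P (S @^-1` C))%E) ->
       forall A C, measurable A -> measurable C ->
         P' (V @^-1` A `&` (fun w => S (pr w)) @^-1` C) =
         (P' (V @^-1` A) * P (S @^-1` C))%E].
Proof.
move=> Yb hM4 hM M0 eta0 lam0 heta hlam.
apply: (@clt_coupling R N _ _ (rad \x sg)%E (csigned Y) (measurable_csigned mY) _
  (symm_csigned mY) k M4 M eta lam _ _ M0 eta0 lam0 heta hlam _ T P signed_sum
  measurable_signed_sum).
- move=> z; rewrite /csigned dotZl dotZr mulrA.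
  have -> : clamp z.1 * clamp z.1 = 1 by rewrite /clamp; case: ifP => _; ring.
  by rewrite mul1r.
- by rewrite mom4_csigned.
- by rewrite mom2_csigned.
- move=> u mu u0; rewrite (integral_weight_sum nw (measurable_signed mY) mu u0).
  apply: cpow_eq_integral => // v mv v0.
  by apply/esym; exact: (integral_csigned mY mv v0).
Qed.

End signed_sums.

Section independent_gaussians.
Context {R : realType}.

Lemma is_gauss_indep_add d (T : measurableType d) (P : probability T R) N1 N2 N
    (X : T -> N1.-tuple R) (Y : T -> N2.-tuple R)
    (mX : measurable_fun [set: T] X) (mY : measurable_fun [set: T] Y)
    (A : 'M[R]_(N, N1)) (B : 'M[R]_(N, N2))
    (mZ : measurable_fun [set: T] (fun t => tadd (affine A (tzero N) (X t)) (affine B (tzero N) (Y t)))) :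
  (forall C D, measurable C -> measurable D ->
     P (X @^-1` C `&` Y @^-1` D) = (P (X @^-1` C) * P (Y @^-1` D))%E) ->
  is_gauss (law P mX) -> is_gauss (law P mY) -> is_gauss (law P mZ).
Proof.
move=> ind gX gY.
have mA := measurable_affine A (tzero N).
have mB := measurable_affine B (tzero N).
apply: (is_gauss_eq _ (is_gauss_convol (is_gauss_affine A (tzero N) gX) (is_gauss_affine B (tzero N) gY))).
apply: eq_meas_integral => u mu u0.
rewrite (ge0_integral_law P mZ mu u0) (ge0_integral_convol mu u0).
pose v x := (\int[law (law P mY) mB]_y u (tadd x y))%E.
have mv : measurable_fun [set: N.-tuple R] v by exact: measurable_integral_shift.
have v0 x : (0 <= v x)%E by exact: integral_ge0.
rewrite (ge0_integral_law (law P mX) mA mv v0).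
have mXY : measurable_fun [set: T] (fun t => (X t, Y t)) by exact: measurable_fun_pair.
pose h (x : N1.-tuple R) (y : N2.-tuple R) := u (tadd (affine A (tzero N) x) (affine B (tzero N) y)).
have mh : measurable_fun [set: N1.-tuple R * N2.-tuple R] (fun z => h z.1 z.2).
  apply: (measurableT_comp mu); apply: measurable_tadd.
    exact: measurableT_comp mA measurable_fst.
  exact: measurableT_comp mB measurable_snd.
transitivity (\int[law P mX]_x \int[law P mY]_y h x y)%E.
  apply: eq_integral => x _; rewrite /v.
  exact: (ge0_integral_law (law P mY) mB (measurable_shift mu _) (fun _ => u0 _)).
rewrite -(@tonelli_prod R _ _ _ _ (law P mX) (law P mY) h mh (fun _ _ => u0 _)).
have e := ge0_integral_law P mXY mh (fun z => u0 _).
apply: (etrans _ e); apply/esym/eq_measure_integral => C mC _.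
apply: (etrans (lawE P mXY C)); apply: (law_pair mX mY mXY) => // C1 C2 mC1 mC2.
Qed.

(** Together with [tail_mx], it writes a vector made of two blocks as a sum of linear images, the
    form required by [is_gauss_indep_add]. *)
Definition head_mx n (e : R) : 'M[R]_(n.+1, 1) := \matrix_(i, j) if i == ord0 then e else 0.
Definition tail_mx n : 'M[R]_(n.+1, n) := \matrix_(i, j) (i == lift ord0 j)%:R.

Lemma affine_tail n (g : n.-tuple R) : affine (tail_mx n) (tzero _) g = tcons (0, g).
Proof.
apply: eq_from_tnth => i; rewrite tnth_mktuple tE add0r.
case: (unliftP ord0 i) => [j ->|->].
  rewrite [RHS]tnthS (bigD1 j)//= mxE eqxx mul1r big1 ?addr0// => l lj.
  by rewrite mxE (inj_eq lift_inj) eq_sym (negbTE lj) mul0r.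
by rewrite [RHS]tnth0 big1// => l _; rewrite mxE (negbTE (neq_lift _ _)) mul0r.
Qed.

Lemma tconsE n (e : R) (y : 1.-tuple R) (g : n.-tuple R) :
  tadd (affine (head_mx n e) (tzero _) y) (affine (tail_mx n) (tzero _) g) =
  tcons (e * tnth y ord0, g).
Proof.
rewrite affine_tail; apply: eq_from_tnth => i; rewrite tE tnth_mktuple tE add0r big_ord1 mxE.
case: (unliftP ord0 i) => [j ->|->]; last by rewrite !tnth0 eqxx addr0.
by rewrite !tnthS eq_sym (negbTE (neq_lift _ _)) mul0r add0r.
Qed.

End independent_gaussians.

(** * Degree one *)

Section linear_network.
Context {R : realType} d (T : measurableType d) (P : probability T R).
Variables (n k : nat) (w : 'I_k -> T -> n.-tuple R) (s : 'I_k -> T -> R).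
Hypothesis nw : network_weights P w s.
Hypotheses (n1 : (1 < n)%N) (k0 : (0 < k)%N).
Variables (p : {poly R}) (sp : size p = 2).

Let al : R := (Num.sqrt k%:R)^-1.

Let al2 : al ^+ 2 = k%:R^-1.
Proof. by rewrite exprVn sqr_sqrtr. Qed.

Let Y (e : R) (_ : n.-tuple R) : 1.-tuple R := [tuple e | i < 1].

Let mY e : measurable_fun [set: n.-tuple R] (Y e).
Proof. exact: measurable_cst. Qed.

Let S e := signed_sum w s (Y e).

Let mS e : measurable_fun [set: T] (S e).
Proof. exact: (measurable_signed_sum nw (mY e)). Qed.

Let X e (a : measurableTypeR R) : 1.-tuple R := tscale a [tuple e | i < 1].

Let mX e : measurable_fun [set: measurableTypeR R] (X e).
Proof. exact: measurable_tscale. Qed.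

Let g : T -> n.-tuple R := gauss_sum w s al.

Let mg : measurable_fun [set: T] g.
Proof. exact: (measurable_gauss_sum nw (mX 0)). Qed.

Notation d0 := (\d_(tzero n) : probability (n.-tuple R) R).

Let g_law B : measurable B -> P (g @^-1` B) = cpow d0 (scaled_gauss n al) k B.
Proof.
move=> mB; have := sign_gauss_sum_indep nw (mX 0) al mB measurableT.
rewrite preimage_setT setIT [P setT]probability_setT mule1.
exact.
Qed.

Let g_gauss : is_gauss (law P mg).
Proof.
apply: (@is_gauss_eq R n (cpow d0 (scaled_gauss n al) k)).
  by move=> B mB; rewrite (lawE P mg) g_law.
apply: is_gauss_cpow; first exact: is_gauss_dirac0.
exists n, (al%:M), (tzero n) => B mB.
rewrite /scaled_gauss (lawE (std_gauss n)); congr (std_gauss n _).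
have E z : affine al%:M (tzero n) z = tscale al z.
  apply: eq_from_tnth => i; rewrite tnth_mktuple !tE add0r (bigD1 i)//= mxE eqxx mulr1n.
  by rewrite big1 ?addr0// => j ji; rewrite mxE eq_sym (negbTE ji) mul0r.
by apply/seteqP; split => z; rewrite /preimage/= E.
Qed.

Let Sg_indep e B C : measurable B -> measurable C ->
  P (S e @^-1` C `&` g @^-1` B) = (P (S e @^-1` C) * P (g @^-1` B))%E.
Proof.
move=> mB mC; rewrite setIC muleC g_law//.
exact: (sign_gauss_sum_indep nw (mX e) al mB mC).
Qed.

Let Psi (x : n.-tuple R) : n.+1.-tuple R := tcons (p`_0, tscale p`_1 x).

Let c (t : T) : n.+1.-tuple R := tcons (tnth (S al t) ord0, g t).

Let mtcons dd (U : measurableType dd) (f : U -> R) (h : U -> n.-tuple R) :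
  measurable_fun [set: U] f -> measurable_fun [set: U] h ->
  measurable_fun [set: U] (fun t => tcons (f t, h t)).
Proof.
move=> mf mh; apply: (measurableT_comp (@measurable_tcons R n)).
exact: measurable_fun_pair.
Qed.

Let mPsi : measurable_fun [set: n.-tuple R] Psi.
Proof. by apply: mtcons => //; exact: measurable_tscale. Qed.

Let mc : measurable_fun [set: T] c.
Proof. by apply: mtcons => //; exact: measurableT_comp (measurable_tnth _) (mS _). Qed.

Let dot_Psi x (a : R) (v : n.-tuple R) :
  dot (tcons (a, v)) (Psi x) = a * p`_0 + p`_1 * dot v x.
Proof. by rewrite /Psi dot_cons dotZr. Qed.

Let b := Num.sqrt (p`_0 ^+ 2 + p`_1 ^+ 2).

Let Psi_le x : sphere n x -> enorm (Psi x) <= b.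
Proof.
move=> sx; rewrite ler_wsqrtr// dot_Psi dotZl -enorm_sqr sx; nra.
Qed.

Let hornerE2 x : p.[x] = p`_0 + p`_1 * x.
Proof. by rewrite horner_coef sp !big_ord_recl big_ord0/= expr0 expr1; ring. Qed.

Let network_path : network w s (horner p) = fun t => linear_path Psi (c t).
Proof.
apply/funext => t; apply/funext => x; rewrite /network /linear_path /c dot_Psi -/al.
have -> : dot (g t) x = \sum_(i < k) al * s i t * dot (w i t) x.
  rewrite /dot; under eq_bigr do rewrite tnth_mktuple mulr_suml.
  rewrite exchange_big/=; apply: eq_bigr => i _; rewrite mulr_sumr.
  by apply: eq_bigr => j _; rewrite tE mulrA.
rewrite tnth_mktuple mulr_suml !mulr_sumr -big_split/=; apply: eq_bigr => i _.
by rewrite /signed tE tnth_mktuple hornerE2/=; ring.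
Qed.

Variable A : R.
Hypotheses (A0 : p`_0 ^+ 2 <= A).
Let B2 : R := (n%:R `^ (5 * 1%:R - 2^-1) / k%:R) `^ 3^-1.

(** The rate in [k], and also the normalised step: with noise level sqrt kap one has 1 / sqrt k =
    sqrt kap * kap. *)
Let kap : R := (k%:R^-1) `^ 3^-1.

Let kR : 0 < (k%:R : R). Proof. by rewrite ltr0n. Qed.

Let powR3 (x : R) : 0 <= x -> (x `^ 3^-1) ^+ 3 = x.
Proof.
move=> x0; rewrite -powR_mulrn ?powR_ge0// -powRrM mulVf ?powRr1//.
Qed.

Let kap0 : 0 < kap.
Proof. by rewrite powR_gt0// invr_gt0. Qed.

Let kap3 : kap ^+ 3 = k%:R^-1.
Proof. by rewrite powR3// invr_ge0 ltW. Qed.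

(* n^(9/2) >= 2^(9/2) > (8/3)^3 *)
Let B2_ge : 8 / 3 * kap <= B2.
Proof.
have c0 : 0 <= 8 / 3 :> R by lra.
have p0 : 0 <= n%:R `^ (5 * 1%:R - 2^-1) :> R by exact: powR_ge0.
have kn0 : 0 <= (k%:R : R) by exact: ltW kR.
have q0 : 0 <= n%:R `^ (5 * 1%:R - 2^-1) / k%:R :> R by exact: divr_ge0.
rewrite -(@ler_pXn2r _ 3) ?nnegrE; [|by []|exact: mulr_ge0 c0 (ltW kap0)|exact: powR_ge0].
rewrite (powR3 q0) exprMn kap3 ler_wpM2r ?invr_ge0//.
have c30 : 0 <= (8 / 3) ^+ 3 :> R by exact: exprn_ge0.
rewrite -(@ler_pXn2r _ 2) ?nnegrE//.
rewrite -[leRHS]powR_mulrn// -powRrM.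
have -> : (5 * 1%:R - 2^-1) * 2%:R = 9%:R :> R by lra.
rewrite powR_mulrn//; apply: (@le_trans _ _ (2 ^+ 9)); first by lra.
by rewrite lerXn2r ?nnegrE// ler_nat.
Qed.

Lemma linear_network_clt :
  exists (disp' : measure_display) (T' : measurableType disp')
        (P' : probability T' R) (G : T' -> sample_path n),
        gaussian_process P' G /\
        (WF_infty P (network w s (horner p)) P' G ^+ 2 <= (A * B2)%:E)%E.
Proof.
have n0 : (0 < n)%N by apply: ltnW.
have b0 : 0 <= b by exact: sqrtr_ge0.
rewrite network_path.
(* For such small k the constant term may be dropped from the Gaussian. *)
have [kl|kl] := leP (2 / 5) kap.
  pose c' t : n.+1.-tuple R := tcons (0, g t).
  have mc' : measurable_fun [set: T] c' by exact: mtcons.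
  exists d, T, P, (fun t => linear_path Psi (c' t)); split.
    apply: (gaussian_process_linear_path mPsi Psi_le b0 (mc := mc')).
    have E : c' = affine (tail_mx n) (tzero _) \o g.
      by apply/funext => t; rewrite /c' -affine_tail.
    apply: is_gauss_eq (is_gauss_affine (tail_mx n) (tzero _) g_gauss) => B mB.
    by rewrite (lawE _ (measurable_affine _ _)) (lawE P mg) (lawE P mc') E.
  pose q : R := `|p`_0|.
  apply: (@le_trans _ _ ((q ^+ 2)%:E)); last first.
    rewrite lee_fin /q real_normK ?num_real//; apply: (le_trans A0).
    have A00 : 0 <= A by apply: le_trans A0; exact: sqr_ge0.
    (* Here [B2] is at least 8/3 * 2/5 = 16/15, so the trivial bound by the squared constant
       coefficient is enough. *)
    rewrite ler_peMr//; apply: (le_trans _ B2_ge); lra.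
  (* A majorant of q|S| whose mean is at most [q], since S has variance at most 1. *)
  pose f t := q / 2 * (tnth (S al t) ord0 ^+ 2 + 1).
  have mf : measurable_fun [set: T] f.
    apply: measurable_funM => //; apply: measurable_funD => //.
    by apply: measurable_funX; exact: measurableT_comp (measurable_tnth _) (mS _).
  apply: (WF_infty_sqr_le mPsi Psi_le b0 n0 (pr := id) mc _ mc' mf) => //.
    move=> t x sx; rewrite -linear_path_sub /linear_path /tsub.
    rewrite (_ : tscale (-1) (c' t) = tcons (0, tscale (-1) (g t))); last first.
      by rewrite /c' tscale_cons mulr0.
    rewrite /c tadd_cons addr0 dot_Psi.
    have -> : tadd (g t) (tscale (-1) (g t)) = tzero n.
      by apply: eq_from_tnth => i; rewrite !tE; ring.
    rewrite dotC dot0r mulr0 addr0 normrM -/q /f.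
    set S0 := tnth _ _; rewrite -[X in _ * (X + 1)]real_normK ?num_real//.
    have q0 : 0 <= q by exact: normr_ge0.
    have := sqr_ge0 (`|S0| - 1); nra.
  pose f2 t := dot (S al t) (S al t).
  have f2E t : tnth (S al t) ord0 ^+ 2 = f2 t by rewrite /f2 /dot big_ord1 expr2.
  have H : (\int[P]_t (f2 t)%:E <= (k%:R * k%:R^-1)%:E)%E.
    apply: (mom2_signed_sum nw (mY al)).
    under eq_integral do rewrite /dot big_ord1 tnth_mktuple -expr2 al2.
    by rewrite integral_prob_cst.
  have mf2 : measurable_fun [set: T] (fun t => (f2 t)%:E).
    by apply/measurable_EFinP; exact: measurable_dot (mS _) (mS _).
  have f20 t : 0 <= f2 t by exact: dot_ge0.
  apply: (@le_trans _ _ (\int[P]_t ((q / 2)%:E * ((f2 t)%:E + 1%:E)))%E).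
    rewrite le_eqVlt; apply/orP; left; apply/eqP; apply: eq_integral => t _.
    by rewrite /f f2E EFinM EFinD.
  have q20 : 0 <= q / 2 by rewrite divr_ge0 ?normr_ge0.
  rewrite (@ge0_integralZlT _ _ _ P (q / 2) (fun t => (f2 t)%:E + 1%:E)%E q20); last 2 first.
  - exact: emeasurable_funD.
  - by move=> t; rewrite -EFinD lee_fin addr_ge0.
  rewrite ge0_integralDT// integral_prob_cst.
  have qE : (q%:E = (q / 2)%:E * (1%:E + 1%:E))%E by rewrite -EFinD -EFinM; congr _%:E; field.
  rewrite [leRHS]qE lee_wpmul2l ?lee_fin// leeD2r//.
  by apply: (le_trans H); rewrite divff ?gt_eqF.
pose ep := Num.sqrt kap.
have ep0 : 0 < ep by rewrite sqrtr_gt0.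
have ep2 : ep ^+ 2 = kap by rewrite sqr_sqrtr// ltW.
have alE : al = ep * kap.
  have al0 : 0 <= al by rewrite invr_ge0 sqrtr_ge0.
  have ek0 : 0 <= ep * kap by rewrite mulr_ge0 ?ltW.
  apply/eqP; rewrite -(@eqrXn2 _ 2)//; apply/eqP.
  by rewrite al2 -kap3 exprMn ep2; ring.
have kE : k%:R = (kap ^+ 3)^-1 by rewrite kap3 invrK.
have kn0 : kap != 0 by rewrite gt_eqF.
have dotY v v' : dot (Y kap v) (Y kap v') = kap ^+ 2.
  by rewrite /dot big_ord1 !tnth_mktuple expr2.
have h1 v : dot (Y kap v) (Y kap v) <= 2^-1 by rewrite dotY; nra.
have h2 : (\int[std_gauss n]_v \int[std_gauss n]_v' (dot (Y kap v) (Y kap v') ^+ 4)%:E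
    <= ((kap ^+ 2) ^+ 4)%:E)%E.
  under eq_integral do under eq_integral do rewrite dotY.
  under eq_integral do rewrite integral_prob_cst.
  by rewrite integral_prob_cst.
have h3 : (\int[std_gauss n]_v (dot (Y kap v) (Y kap v))%:E <= (kap ^+ 2)%:E)%E.
  under eq_integral do rewrite dotY.
  by rewrite integral_prob_cst.
have h4 : 0 <= kap ^+ 2 by rewrite sqr_ge0.
(* The values of [eta] and, next, [lam]. They satisfy 11/18 <= (4/5)^2, and k kap^2 + 1 = (kap +
   kap^2) / kap^2 <= (3/4)^2 / kap^2, which holds below the threshold 2/5. *)
have h5 : 0 < 4 / 5 * kap ^+ 4 by rewrite mulr_gt0 ?exprn_gt0//; lra.
have h6 : 0 < 3 / 4 / kap by rewrite divr_gt0//; lra.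
have h7 : 11 / 18 * (kap ^+ 2) ^+ 4 <= (4 / 5 * kap ^+ 4) ^+ 2.
  have -> : (4 / 5 * kap ^+ 4) ^+ 2 = 16 / 25 * (kap ^+ 2) ^+ 4 by field.
  by apply: ler_wpM2r; [exact: exprn_ge0|lra].
have h8 : k%:R * kap ^+ 2 + 1%:R <= (3 / 4 / kap) ^+ 2.
  rewrite kE (_ : _ + _ = (kap + kap ^+ 2) / kap ^+ 2); last by field.
  rewrite (_ : (3 / 4 / kap) ^+ 2 = 9 / 16 / kap ^+ 2); last by field.
  by rewrite ler_pM2r ?invr_gt0 ?exprn_gt0//; nra.
have [dT' [T' [P' [pr [V [mV [mpr prE gV cost ind]]]]]]] :=
  signed_clt nw (mY kap) h1 h2 h3 h4 h5 h6 h7 h8.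
have mSk := mS kap.
pose c' t : n.+1.-tuple R := tcons (ep * tnth (V t) ord0, g (pr t)).
have mV0 : measurable_fun [set: T'] (fun t => tnth (V t) ord0).
  exact: measurableT_comp (measurable_tnth _) mV.
have mgp : measurable_fun [set: T'] (g \o pr) by exact: measurableT_comp.
have mc' : measurable_fun [set: T'] c' by apply: mtcons => //; exact: measurable_funM.
exists dT', T', P', (fun t => linear_path Psi (c' t)); split.
  apply: (gaussian_process_linear_path mPsi Psi_le b0 (mc := mc')).
  have gE B : measurable B -> P' ((g \o pr) @^-1` B) = P (g @^-1` B).
    by move=> mB; rewrite -prE//; exact: measurable_preimageT mg mB.
  have mZ : measurable_fun [set: T']
      (fun t => tadd (affine (head_mx n ep) (tzero _) (V t)) (affine (tail_mx n) (tzero _) ((g \o pr) t))).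
    apply: measurable_tadd.
      exact: measurableT_comp (measurable_affine _ _) mV.
    exact: measurableT_comp (measurable_affine _ _) mgp.
  apply: (@is_gauss_eq R _ (law P' mZ)).
    move=> B mB; rewrite (lawE P' mZ) (lawE P' mc'); congr (P' (_ @^-1` B)).
    by apply/funext => t; rewrite tconsE.
  apply: (is_gauss_indep_add (mX := mV) (mY := mgp)) => //.
    move=> C D mC mD; rewrite gE//.
    exact: (ind _ _ g mg (fun A0 C0 mA0 mC0 => Sg_indep kap mC0 mA0) C D mC mD).
  apply: is_gauss_eq g_gauss => B mB.
  by rewrite (lawE P mg) (lawE P' mgp) gE.
pose q : R := `|p`_0|.
have q0 : 0 <= q by exact: normr_ge0.
pose f t := q * ep * enorm (tsub (S kap (pr t)) (V t)).
have mSV : measurable_fun [set: T'] (fun t => (enorm (tsub (S kap (pr t)) (V t)))).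
  apply: measurable_enorm_comp; apply: measurable_tsub => //.
  exact: measurableT_comp mSk mpr.
have mf : measurable_fun [set: T'] f by exact: measurable_funM.
apply: (@le_trans _ _ ((q * ep * (8 / 5)) ^+ 2)%:E).
  apply: (WF_infty_sqr_le mPsi Psi_le b0 n0 mc mpr mc' mf prE).
    move=> t x sx; rewrite -linear_path_sub /linear_path /tsub /c'.
    rewrite tscale_cons /c tadd_cons dot_Psi.
    have -> : tadd (g (pr t)) (tscale (-1) (g (pr t))) = tzero n.
      by apply: eq_from_tnth => i; rewrite !tE; ring.
    have -> : tnth (S al (pr t)) ord0 = ep * tnth (S kap (pr t)) ord0.
      rewrite !tnth_mktuple mulr_sumr; apply: eq_bigr => i _.
      by rewrite /signed !tE !tnth_mktuple alE; ring.
    rewrite dotC dot0r mulr0 addr0 normrM mulrC -/q /f -mulrA ler_wpM2l//.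
    rewrite mulN1r -mulrBr normrM (gtr0_norm ep0) ler_wpM2l ?(ltW ep0)//.
    rewrite -(@ler_pXn2r _ 2) ?nnegrE ?normr_ge0 ?enorm_ge0//.
    by rewrite real_normK ?num_real// enorm_sqr /dot big_ord1 -expr2 !tE mulN1r.
  have qe0 : 0 <= q * ep by rewrite mulr_ge0// ltW.
  rewrite /f; under eq_integral do rewrite EFinM.
  rewrite ge0_integralZlT//; last 2 first.
  - exact/measurable_EFinP.
  - by move=> t; rewrite lee_fin enorm_ge0.
  rewrite (EFinM (q * ep)) lee_wpmul2l ?lee_fin//.
  apply: (le_trans cost); rewrite lee_fin sqrtr1 kE.
  (* The noise contributes 1 and the replacements 3/5, together 8/5. *)
  rewrite (_ : (kap ^+ 3)^-1 * (4 / 5 * kap ^+ 4) * (3 / 4 / kap) = 3 / 5); last by field.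
  lra.
rewrite lee_fin !exprMn ep2 real_normK ?num_real//.
(* (8/5)^2 = 64/25 is just below 8/3, the constant available in [B2_ge]. *)
apply: (@le_trans _ _ (p`_0 ^+ 2 * (8 / 3 * kap))).
  have := mulr_ge0 (sqr_ge0 p`_0) (ltW kap0); nra.
apply: (@le_trans _ _ (p`_0 ^+ 2 * B2)); first by rewrite ler_wpM2l ?sqr_ge0.
by rewrite ler_wpM2r// powR_ge0.
Qed.

End linear_network.

Section feature_moments.
Context {R : realType} (d n : nat).
Hypothesis n0 : (0 < n)%N.
Notation sg := (@std_gauss R n).
Notation phi := (@feat R d n (fun=> 1)).

(** One constant for all moments below: (d+1)^4 from the fourth power of a sum over d + 1 degrees, 4
    (4d)! from [std_gauss_dot_pow] at power 4d, and 16^d from (4n)^(2d) in the fourth moment of the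
    norm. *)
Definition moment_cst : R := 4 * d.+1%:R ^+ 4 * (4 * d)`!%:R * 16 ^+ d.
Local Notation K := moment_cst.
Let NN : R := n%:R ^+ d.

Let D1 : 1 <= (d.+1%:R : R).
Proof. by rewrite ler1n. Qed.

Let F1 : 1 <= ((4 * d)`!%:R : R).
Proof. by rewrite ler1n fact_gt0. Qed.

Let c16 : 1 <= (16 ^+ d : R).
Proof. by rewrite exprn_ege1// ler1n. Qed.

Lemma moment_cst_ge1 : 1 <= K.
Proof.
by rewrite /K !mulr_ege1 ?exprn_ege1// ler1n.
Qed.

Let NN1 : 1 <= NN.
Proof. by rewrite exprn_ege1// ler1n. Qed.

Lemma sum_sqr_le m (x : 'I_m -> R) : (\sum_(i < m) x i) ^+ 2 <= m%:R * \sum_(i < m) x i ^+ 2.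
Proof.
have := cauchy_schwarz [tuple (1 : R) | i < m] [tuple x i | i < m].
rewrite /dot; under eq_bigr do rewrite !tnth_mktuple mul1r.
under [X in _ <= X * _]eq_bigr do rewrite !tnth_mktuple mul1r.
under [X in _ <= _ * X]eq_bigr do rewrite !tnth_mktuple -expr2.
by rewrite sumr_const card_ord.
Qed.

Lemma integral_sum_le dT (T : measurableType dT) (P : probability T R) m
    (f : 'I_m -> T -> R) (c : R) : (forall i, measurable_fun [set: T] (f i)) ->
  (forall i x, 0 <= f i x) -> (forall i, (\int[P]_x (f i x)%:E <= c%:E)%E) ->
  (\int[P]_x (\sum_(i < m) f i x)%:E <= (m%:R * c)%:E)%E.
Proof.
move=> mf f0 fc; under eq_integral do rewrite -sumEFin.
rewrite ge0_integral_sum//; last 2 first.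
- by move=> i; exact/measurable_EFinP.
- by move=> i x _; rewrite lee_fin.
apply: (@le_trans _ _ (\sum_(i < m) c%:E)%E); first exact: lee_sum.
by rewrite sumEFin sumr_const card_ord mulr_natl.
Qed.

Let factb m q : (m <= q)%N -> (m`!%:R <= q`!%:R :> R).
Proof. by move=> mq; rewrite ler_nat; exact: leq_fact. Qed.

Let n1 : 1 <= (n%:R : R).
Proof. by rewrite ler1n. Qed.

Let normsq_bound m c : (m <= d)%N -> (c * m <= 4 * d)%N -> (c <= 2)%N ->
  2 * (c * m)`!%:R * (4 * n%:R) ^+ (c * m) <= 2 * (4 * d)`!%:R * 16 ^+ d * NN ^+ c.
Proof.
move=> md cm c2.
have e1 : (4 * n%:R) ^+ (c * m) <= (16 ^+ d * NN ^+ c : R).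
  rewrite exprMn; apply: ler_pM; rewrite ?exprn_ge0//.
    rewrite (_ : 16 = 4 ^+ 2 :> R); last by rewrite -natrX.
    by rewrite -exprM ler_weXn2l ?ler1n// leq_mul.
  by rewrite -exprM mulnC ler_weXn2l// leq_mul.
rewrite -[leRHS]mulrA; apply: ler_pM => //; rewrite ?mulr_ge0 ?exprn_ge0 ?mulr_ge0//.
by rewrite ler_wpM2l//; exact: factb.
Qed.

Let mdot : measurable_fun [set: n.-tuple R] (fun w => dot w w).
Proof. exact: measurable_dot. Qed.

Lemma feat_mom2 : (\int[sg]_w (dot (phi w) (phi w))%:E <= (K * NN)%:E)%E.
Proof.
under eq_integral do rewrite dot_feat.
apply: (@le_trans _ _ (d.+1%:R * (2 * (4 * d)`!%:R * 16 ^+ d * NN))%:E).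
  apply: integral_sum_le.
  - by move=> i; apply: measurable_funM => //; exact: measurable_funX.
  - by move=> i w; rewrite !mul1r exprn_ge0// dot_ge0.
  - move=> i; under eq_integral do rewrite !mul1r.
    have id : (i <= d)%N by rewrite -ltnS.
    apply: (le_trans (std_gauss_normsq_pow n0 i)); rewrite lee_fin.
    have := @normsq_bound i 1 id; rewrite mul1n expr1; apply => //.
    by rewrite (leq_trans id)// leq_pmull.
rewrite lee_fin /K; set F := (4 * d)`!%:R; set c := 16 ^+ d.
have FcN : 0 <= F * c * NN by rewrite !mulr_ge0// (le_trans ler01).
have : d.+1%:R <= (d.+1%:R ^+ 4 : R) by rewrite ler_eXnr.
set D : R := d.+1%:R; move: FcN; set x := F * c * NN => x0 h.
have -> : D * (2 * F * c * NN) = 2 * D * x by rewrite /x; ring.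
have -> : 4 * D ^+ 4 * F * c * NN = 4 * D ^+ 4 * x by rewrite /x; ring.
have D0 : 0 <= D by [].
by rewrite ler_wpM2r//; move: h D0; move: (D ^+ 4) (D) => a b; lra.
Qed.

Lemma feat_mom4 : (\int[sg]_w (dot (phi w) (phi w) ^+ 2)%:E <= (K * NN ^+ 2)%:E)%E.
Proof.
have m1 : measurable_fun [set: n.-tuple R] (fun w => \sum_(i < d.+1) dot w w ^+ (2 * i)).
  by apply: measurable_sum => i; exact: measurable_funX.
have p1 (w : n.-tuple R) : 0 <= \sum_(i < d.+1) dot w w ^+ (2 * i).
  by apply: sumr_ge0 => i _; rewrite exprM exprn_ge0// sqr_ge0.
apply: (@le_trans _ _ (\int[sg]_w (d.+1%:R%:E * (\sum_(i < d.+1) dot w w ^+ (2 * i))%:E))%E).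
  apply: ge0_le_integralT.
  - apply/measurable_EFinP; apply: measurable_funX.
    by apply: measurable_dot; exact: measurable_feat.
  - by apply: emeasurable_funM => //; exact/measurable_EFinP.
  - by move=> w; rewrite lee_fin sqr_ge0.
  - move=> w; rewrite -EFinM lee_fin dot_feat.
    apply: (le_trans (sum_sqr_le _)); rewrite ler_wpM2l//.
    by apply: ler_sum => i _; rewrite !mul1r -exprM mulnC.
rewrite ge0_integralZlT//; last exact/measurable_EFinP.
apply: (@le_trans _ _ (d.+1%:R%:E * (d.+1%:R * (2 * (4 * d)`!%:R * 16 ^+ d * NN ^+ 2))%:E)%E).
  rewrite lee_wpmul2l ?lee_fin//; apply: integral_sum_le.
  - by move=> i; exact: measurable_funX.
  - by move=> i w; rewrite exprM exprn_ge0// sqr_ge0.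
  - move=> i; have id : (i <= d)%N by rewrite -ltnS.
    apply: (le_trans (std_gauss_normsq_pow n0 _)); rewrite lee_fin.
    by apply: normsq_bound => //; rewrite leq_mul.
rewrite -EFinM lee_fin /K; set F := (4 * d)`!%:R; set c := 16 ^+ d.
have FcN : 0 <= F * c * NN ^+ 2 by rewrite !mulr_ge0 ?sqr_ge0// (le_trans ler01).
have : d.+1%:R ^+ 2 <= (d.+1%:R ^+ 4 : R) by rewrite ler_weXn2l.
set D : R := d.+1%:R; move: FcN; set x := F * c * NN ^+ 2 => x0 h.
have -> : D * (D * (2 * F * c * NN ^+ 2)) = 2 * D ^+ 2 * x by rewrite /x; ring.
have -> : 4 * D ^+ 4 * F * c * NN ^+ 2 = 4 * D ^+ 4 * x by rewrite /x; ring.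
have D0 : 0 <= D ^+ 2 by rewrite sqr_ge0.
by rewrite ler_wpM2r//; move: h D0; move: (D ^+ 4) (D ^+ 2) => a b; lra.
Qed.

(** The decisive moment: two independent Gaussian vectors are nearly orthogonal, which brings the
    order down to n^(2d). *)
Lemma feat_dot4 :
  (\int[sg]_v \int[sg]_w (dot (phi v) (phi w) ^+ 4)%:E <= (K * NN ^+ 2)%:E)%E.
Proof.
pose f (i : 'I_d.+1) (v w : n.-tuple R) : R := dot v w ^+ (2 * i).*2.
have f0 i v w : 0 <= f i v w by rewrite /f -mul2n exprM exprn_ge0// sqr_ge0.
have mf2 i : measurable_fun [set: n.-tuple R * n.-tuple R] (fun z => f i z.1 z.2).
  by apply: measurable_funX; exact: measurable_dot.
have mf i v : measurable_fun [set: n.-tuple R] (f i v).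
  by apply: measurable_funX; exact: measurable_dot.
pose G (z : n.-tuple R * n.-tuple R) := \sum_(i < d.+1) f i z.1 z.2.
have mphi : measurable_fun [set: n.-tuple R] phi by exact: measurable_feat.
have m4 : measurable_fun [set: n.-tuple R * n.-tuple R] (fun z => (dot (phi z.1) (phi z.2) ^+ 4)%:E).
  apply/measurable_EFinP; apply: measurable_funX; apply: measurable_dot.
    exact: measurableT_comp mphi measurable_fst.
  exact: measurableT_comp mphi measurable_snd.
have p4 (x : R) : (0 <= (x ^+ 4)%:E)%E by rewrite lee_fin (exprM x 2 2) sqr_ge0.
rewrite -(@tonelli_prod R _ _ _ _ sg sg (fun v w => (dot (phi v) (phi w) ^+ 4)%:E) m4 (fun _ _ => p4 _)).
have mG : measurable_fun [set: n.-tuple R * n.-tuple R] G by exact: measurable_sum.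
have G0 z : 0 <= G z by apply: sumr_ge0 => i _; exact: f0.
have D0 : 0 <= (d.+1%:R ^+ 3 : R) by rewrite exprn_ge0.
apply: (@le_trans _ _ (\int[(sg \x sg)%E]_z ((d.+1%:R ^+ 3)%:E * (G z)%:E))%E).
  apply: ge0_le_integralT.
  - exact: m4.
  - by apply: emeasurable_funM => //; exact/measurable_EFinP.
  - by move=> z; exact: p4.
  - move=> [v w]; rewrite -EFinM lee_fin dot_feat /=.
    rewrite (exprM _ 2 2); set x := \sum_(_ < _) _.
    have h1 : x ^+ 2 <= d.+1%:R * \sum_(i < d.+1) (dot v w ^+ 2) ^+ i.
      apply: (le_trans (sum_sqr_le _)); rewrite ler_wpM2l//.
      by apply: ler_sum => i _; rewrite !mul1r -exprM mulnC exprM.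
    apply: (@le_trans _ _ ((d.+1%:R * \sum_(i < d.+1) (dot v w ^+ 2) ^+ i) ^+ 2)).
      by rewrite ler_sqr ?nnegrE ?sqr_ge0// (le_trans _ h1)// sqr_ge0.
    rewrite exprMn (exprSr _ 2) -mulrA ler_wpM2l ?sqr_ge0//.
    apply: (le_trans (sum_sqr_le _)); rewrite ler_wpM2l// /G.
    apply: ler_sum => i _; rewrite /f -!exprM.
    by have -> : (2 * (i * 2) = (2 * i).*2)%N by rewrite mulnA muln2.
rewrite (@ge0_integralZlT _ _ _ (sg \x sg)%E (d.+1%:R ^+ 3) (fun z => (G z)%:E) D0); last 2 first.
- exact/measurable_EFinP.
- by move=> z; rewrite lee_fin.
apply: (@le_trans _ _ ((d.+1%:R ^+ 3)%:E * (d.+1%:R * (4 * (4 * d)`!%:R * 16 ^+ d * NN ^+ 2))%:E)%E).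
  rewrite lee_wpmul2l ?lee_fin//; apply: integral_sum_le => //.
  move=> i; have id : (i <= d)%N by rewrite -ltnS.
  rewrite (@tonelli_prod R _ _ _ _ sg sg (fun v w => (f i v w)%:E)); last 2 first.
  - exact/measurable_EFinP.
  - by move=> v w; rewrite lee_fin.
  apply: (le_trans (std_gauss_dot_pow n0 _)); rewrite lee_fin.
  have e1 : (2 * n%:R) ^+ (2 * i) <= (16 ^+ d * NN ^+ 2 : R).
    rewrite exprMn; apply: ler_pM; rewrite ?exprn_ge0//.
      apply: (@le_trans _ _ (4 ^+ d)); last by rewrite lerXn2r ?nnegrE// ler_nat.
      rewrite (_ : 4 = 2 ^+ 2 :> R); last by rewrite -natrX.
      by rewrite -exprM ler_weXn2l ?ler1n// leq_mul.
    by rewrite -exprM mulnC ler_weXn2l// leq_mul.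
  rewrite -[leRHS]mulrA; apply: ler_pM => //; rewrite ?mulr_ge0 ?exprn_ge0 ?mulr_ge0//.
  rewrite ler_wpM2l//; apply: factb.
  by rewrite -mul2n mulnA leq_mul.
rewrite -EFinM lee_fin /K; set F := (4 * d)`!%:R; set c := 16 ^+ d.
rewrite le_eqVlt; apply/orP; left; apply/eqP; ring.
Qed.

Lemma card_monomial_le : (#|monomial d n|%:R : R) <= K * NN.
Proof.
apply: (le_trans (card_monomial d n0)); rewrite -/NN ler_wpM2r ?(le_trans ler01)//.
rewrite /K; apply: (@le_trans _ _ (4 * d.+1%:R ^+ 4)); last first.
  have x0 : 0 <= 4 * d.+1%:R ^+ 4 :> R by rewrite mulr_ge0 ?exprn_ge0.
  rewrite -mulrA ler_peMr// mulr_ege1//.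
have D4 : d.+1%:R <= (d.+1%:R ^+ 4 : R) by rewrite ler_eXnr.
by apply: (le_trans D4); rewrite ler_peMl ?exprn_ge0// ler1n.
Qed.

End feature_moments.

(** * Higher degrees *)

Section parameters.
Context {R : realType}.
Variables (K NN q B kk : R).
(* Used with NN = n^d, q = sqrt n, kk = k, so that [kE] makes B^2 the target
   (n^(5d - 1/2) / k)^(1/3); [step_sqr] is the squared size of a normalised step
   at noise level B / sqrt NN. *)
Hypotheses (K1 : 1 <= K) (NN1 : 1 <= NN) (q0 : 0 <= q) (qN : q <= NN) (B0 : 0 < B)
  (k0 : 0 < kk) (kE : kk * B ^+ 6 * q = NN ^+ 5) (BN : B ^+ 2 < NN).

Let NN0 : 0 < NN. Proof. exact: lt_le_trans NN1. Qed.
Let K0 : 0 < K. Proof. exact: lt_le_trans K1. Qed.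

Definition step_sqr := NN / (kk * B ^+ 2).

Let step_sqr_gt0 : 0 < step_sqr.
Proof. by rewrite divr_gt0// mulr_gt0// exprn_gt0. Qed.

Let step_sqrE : step_sqr = B ^+ 4 * q / NN ^+ 4.
Proof.
have qn : q != 0.
  by apply: contra_eq_neq kE => ->; rewrite mulr0 eq_sym expf_neq0// gt_eqF.
rewrite /step_sqr (_ : B ^+ 4 * q / NN ^+ 4 = B ^+ 4 * q * NN / NN ^+ 5).
  by rewrite -kE; field; rewrite qn !gt_eqF.
by field; rewrite gt_eqF.
Qed.

(** Bounds the second moment of the summands cut off by the truncation; what remains after using
    [kE] is B^2 q <= NN^2. *)
Lemma remainder_param : 2 * step_sqr * K * NN ^+ 2 <= 2 * K * B ^+ 2.
Proof.
have -> : 2 * step_sqr * K * NN ^+ 2 = 2 * K * B ^+ 2 * (B ^+ 2 * q / NN ^+ 2).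
  by rewrite step_sqrE; field; rewrite gt_eqF.
have h : 0 <= 2 * K * B ^+ 2 by rewrite !mulr_ge0 ?sqr_ge0// ltW.
rewrite ler_piMr// ler_pdivrMr ?exprn_gt0// mul1r expr2 [leRHS]expr2.
by rewrite -expr2 ler_pM ?sqr_ge0// ltW.
Qed.

(** The summands contribute K NN^2/B^2, and [N] is no larger than that because B^2 < NN. *)
Lemma lambda_param N : N <= K * NN ->
  kk * (step_sqr * (K * NN)) + N <= (2 * K * NN / B) ^+ 2.
Proof.
move=> NK; have -> : kk * (step_sqr * (K * NN)) = K * NN ^+ 2 / B ^+ 2.
  by rewrite /step_sqr; field; rewrite !gt_eqF.
have -> : (2 * K * NN / B) ^+ 2 = 4 * K ^+ 2 * NN ^+ 2 / B ^+ 2 by field; rewrite gt_eqF.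
apply: (@le_trans _ _ (2 * (K * NN ^+ 2 / B ^+ 2))).
  have : K * NN <= K * NN ^+ 2 / B ^+ 2.
    rewrite ler_pdivlMr ?exprn_gt0// -mulrA ler_wpM2l ?(ltW K0)//.
    by rewrite [leRHS]expr2 ler_wpM2l ?ltW.
  by move: (_ / _) NK => x h1 h2; lra.
rewrite mulrA ler_wpM2r ?invr_ge0 ?sqr_ge0// mulrA ler_wpM2r ?sqr_ge0//.
have KK : 0 <= K * (K - 1) by rewrite mulr_ge0 ?subr_ge0// ltW.
nra.
Qed.

Lemma error_param r ep : r ^+ 2 = NN -> 0 < r -> ep = B / r ->
  ep * (K * r + kk * (step_sqr ^+ 2 * K * NN) * (2 * K * NN / B)) <= (K + 2 * K ^+ 2) * B.
Proof.
move=> r2 r0 ->.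
(* The replacement cost is split into factors: the first ratio is 1 by definition of [step_sqr], the
   second equals (B/r)(q/NN) and is at most 1. *)
have -> : B / r * (K * r + kk * (step_sqr ^+ 2 * K * NN) * (2 * K * NN / B)) =
    K * B + 2 * K ^+ 2 * B * (kk * step_sqr * B ^+ 2 / NN) * (step_sqr * NN ^+ 3 / (B ^+ 2 * r * B)).
  by field; rewrite !gt_eqF.
have -> : kk * step_sqr * B ^+ 2 / NN = 1 by rewrite /step_sqr; field; rewrite !gt_eqF.
have -> : step_sqr * NN ^+ 3 / (B ^+ 2 * r * B) = B / r * (q / NN).
  by rewrite step_sqrE; field; rewrite !gt_eqF.
rewrite [X in _ + X * _]mulr1 [leRHS]mulrDl lerD2l ler_piMr ?mulr_ge0 ?sqr_ge0 ?(ltW B0) ?(ltW K0)//.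
have Br : B <= r.
  by rewrite -(@ler_pXn2r _ 2) ?nnegrE ?(ltW B0) ?(ltW r0)// r2 ltW.
by rewrite mulr_ile1 ?divr_ge0 ?(ltW B0) ?(ltW r0) ?(ltW NN0)// ler_pdivrMr ?mul1r.
Qed.

End parameters.

Section polynomial_network.
Context {R : realType} dT (T : measurableType dT) (P : probability T R).
Variables (n k : nat) (w : 'I_k -> T -> n.-tuple R) (s : 'I_k -> T -> R).
Hypothesis nw : network_weights P w s.
Hypotheses (n1 : (1 < n)%N) (k0 : (0 < k)%N).
Variables (d : nat) (d0 : (0 < d)%N) (p : {poly R}) (sp : size p = d.+1).
Variable A : R.
Hypothesis pA : forall m : 'I_d.+1, p`_m ^+ 2 <= A.
Local Notation K := (@moment_cst R d).
Local Notation sg := (@std_gauss R n).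

Let n0 : (0 < n)%N. Proof. exact: ltnW. Qed.
Let phi := @feat R d n (fun=> 1).
Let N := #|monomial d n|.
Let NN : R := n%:R ^+ d.
Let Psi := @feat R d n (fun m => p`_m).
Let b := Num.sqrt (d.+1%:R * A).
Let al : R := (Num.sqrt k%:R)^-1.

Let mphi : measurable_fun [set: n.-tuple R] phi. Proof. exact: measurable_feat. Qed.
Let mPsi : measurable_fun [set: n.-tuple R] Psi. Proof. exact: measurable_feat. Qed.
Let b0 : 0 <= b. Proof. exact: sqrtr_ge0. Qed.

(** By [dot_feat], |Psi x|^2 is the sum of the squared coefficients when |x| = 1, whatever [n].
    Errors in the coefficient vector thus pass to the supremum over the sphere without loss in the
    dimension. *)
Let Psi_le x : sphere n x -> enorm (Psi x) <= b.
Proof.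
move=> sx; rewrite ler_wsqrtr// dot_feat.
apply: (@le_trans _ _ (\sum_(m < d.+1) A)); last by rewrite sumr_const card_ord mulr_natl.
by apply: ler_sum => m _; rewrite -expr2 -enorm_sqr sx !expr1n mulr1.
Qed.

Let al2 : al ^+ 2 = k%:R^-1.
Proof. by rewrite exprVn sqr_sqrtr. Qed.

Let Y0 (x : n.-tuple R) := tscale al (phi x).
Let mY0 : measurable_fun [set: n.-tuple R] Y0.
Proof. exact: measurable_tscale. Qed.

Let S := signed_sum w s Y0.
Let mS : measurable_fun [set: T] S. Proof. exact: (measurable_signed_sum nw mY0). Qed.

Lemma dot_weight_sum m (X : measurableTypeR R * n.-tuple R -> m.-tuple R) t x :
  dot (weight_sum w s X t) x = \sum_(i < k) dot (X (s i t, w i t)) x.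
Proof.
rewrite /dot; under eq_bigr do rewrite tnth_mktuple mulr_suml.
by rewrite exchange_big.
Qed.

Let network_path : network w s (horner p) = fun t => linear_path Psi (S t).
Proof.
apply/funext => t; apply/funext => x; rewrite /network /linear_path /S /signed_sum dot_weight_sum.
rewrite mulr_sumr; apply: eq_bigr => i _; rewrite /signed /Y0 !dotZl dot_feat horner_coef sp.
rewrite mulrCA; congr (_ * (_ * _)); apply: eq_bigr => m _; by rewrite mul1r.
Qed.

Let path_err c c' x : sphere n x -> `|linear_path Psi c x - linear_path Psi c' x| <= b * enorm (tsub c c').
Proof. by move=> sx; rewrite -linear_path_sub mulrC; exact: linear_path_le. Qed.

Let h : R := n%:R `^ (5 * d%:R - 2^-1) / k%:R.
Let B2 : R := h `^ 3^-1.
Let B := Num.sqrt B2.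
Let q : R := n%:R `^ 2^-1.

Let nR : 1 <= (n%:R : R). Proof. by rewrite ler1n. Qed.
Let kR : 0 < (k%:R : R). Proof. by rewrite ltr0n. Qed.
Let NN1 : 1 <= NN. Proof. exact: exprn_ege1. Qed.
Let NN0 : 0 < NN. Proof. exact: lt_le_trans NN1. Qed.
Let K1 : 1 <= K. Proof. exact: moment_cst_ge1. Qed.
Let K0 : 0 < K. Proof. exact: lt_le_trans K1. Qed.

Let B20 : 0 < B2.
Proof. by rewrite powR_gt0// divr_gt0// powR_gt0// (lt_le_trans ltr01). Qed.

Let B0 : 0 < B. Proof. by rewrite sqrtr_gt0. Qed.
Let BE : B ^+ 2 = B2. Proof. by rewrite sqr_sqrtr// ltW. Qed.

Let q0 : 0 <= q. Proof. exact: powR_ge0. Qed.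

Let qN : q <= NN.
Proof.
rewrite /q /NN -powR_mulrn; last exact: le_trans nR.
apply: ler_powR => //; apply: (@le_trans _ _ 1); first lra.
by rewrite ler1n.
Qed.

Let kE : k%:R * B ^+ 6 * q = NN ^+ 5.
Proof.
have h0 : 0 <= h by rewrite divr_ge0 ?powR_ge0// ltW.
have B23 : B2 ^+ 3 = h.
  by rewrite /B2 -powR_mulrn ?powR_ge0// -powRrM mulVf// powRr1.
rewrite (exprM B 2 3) BE B23.
rewrite (_ : k%:R * h = n%:R `^ (5 * d%:R - 2^-1)); last by rewrite /h mulrC divfK ?gt_eqF.
have nn : (n%:R : R) != 0 by rewrite pnatr_eq0 -lt0n.
rewrite /q -powRD ?nn ?implybT//.
rewrite (_ : _ + _ = (d * 5)%N%:R).
  by rewrite powR_mulrn ?(le_trans ler01)// exprM.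
by rewrite natrM; lra.
Qed.

Lemma polynomial_network_clt :
  exists (disp' : measure_display) (T' : measurableType disp')
        (P' : probability T' R) (G : T' -> sample_path n),
        gaussian_process P' G /\
        (WF_infty P (network w s (horner p)) P' G ^+ 2 <=
          ((d.+1%:R * 25 * K ^+ 4) * A * B2)%:E)%E.
Proof.
have A0 : 0 <= A by apply: le_trans (pA ord0); exact: sqr_ge0.
have KK : 1 <= K ^+ 2 by rewrite exprn_ege1.
have KK2 : K <= K ^+ 2 by rewrite expr2 ler_peMr// ltW.
(* The whole proof aims at the mean distance 5 K^2 B b, whose square is the right-hand side. *)
have fin c : c <= b * (5 * K ^+ 2 * B) -> 0 <= c ->
    c ^+ 2 <= (d.+1%:R * 25 * K ^+ 4) * A * B2.
  move=> hc c0; apply: (@le_trans _ _ ((b * (5 * K ^+ 2 * B)) ^+ 2)).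
    by rewrite ler_sqr ?nnegrE// (le_trans c0).
  rewrite exprMn sqr_sqrtr ?mulr_ge0// -BE le_eqVlt; apply/orP; left; apply/eqP; ring.
have alK : (\int[sg]_v (dot (Y0 v) (Y0 v))%:E <= (al ^+ 2 * (K * NN))%:E)%E.
  under eq_integral do rewrite /Y0 dotZl dotZr mulrA -expr2 EFinM.
  rewrite ge0_integralZlT ?sqr_ge0//; last 2 first.
  - by apply/measurable_EFinP; exact: measurable_dot.
  - by move=> v; rewrite lee_fin dot_ge0.
  by rewrite (EFinM (al ^+ 2)) lee_wpmul2l ?lee_fin ?sqr_ge0//; exact: feat_mom2.
have amgm (x : R) : x <= (x ^+ 2 / B + B) / 2.
  rewrite -subr_ge0 (_ : _ - x = (x - B) ^+ 2 / (2 * B)); last by field; rewrite gt_eqF.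
  by rewrite divr_ge0 ?sqr_ge0// mulr_ge0// ltW.
have int_enorm dU (U : measurableType dU) (Q : probability U R) (Z : U -> N.-tuple R) c :
    measurable_fun [set: U] Z -> (\int[Q]_t (dot (Z t) (Z t))%:E <= c%:E)%E ->
    (\int[Q]_t (enorm (Z t))%:E <= ((c / B + B) / 2)%:E)%E.
  move=> mZ hZ.
  have md : measurable_fun [set: U] (fun t => (dot (Z t) (Z t))%:E).
    by apply/measurable_EFinP; exact: measurable_dot.
  have i0 : 0 <= (2 * B)^-1 by rewrite invr_ge0 mulr_ge0// ltW.
  apply: (@le_trans _ _ (\int[Q]_t ((2 * B)^-1%:E * (dot (Z t) (Z t))%:E + (B / 2)%:E))%E).
    apply: ge0_le_integralT.
    - by apply/measurable_EFinP; exact: measurable_enorm_comp.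
    - by apply: emeasurable_funD => //; exact: emeasurable_funM.
    - by move=> t; rewrite lee_fin enorm_ge0.
    - move=> t; rewrite -EFinM -EFinD lee_fin; apply: (le_trans (amgm _)).
      rewrite enorm_sqr le_eqVlt; apply/orP; left; apply/eqP; field; by rewrite gt_eqF.
  have B20' : 0 <= B / 2 by rewrite divr_ge0 ?(ltW B0).
  rewrite ge0_integralDT; [|exact: emeasurable_funM|exact: measurable_cst
    |by move=> t; rewrite mule_ge0 ?lee_fin ?dot_ge0|by move=> t; rewrite lee_fin].
  rewrite integral_prob_cst ge0_integralZlT//; last by move=> t; rewrite lee_fin dot_ge0.
  apply: (@le_trans _ _ ((2 * B)^-1%:E * c%:E + (B / 2)%:E)%E).
    by rewrite leeD2r// lee_wpmul2l ?lee_fin.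
  rewrite -EFinM -EFinD lee_fin le_eqVlt; apply/orP; left; apply/eqP; field; by rewrite gt_eqF.
rewrite network_path.
(* For such small k already |S| is within the bound, and G = 0 will do. *)
have [NB|NB] := leP NN (B ^+ 2).
  pose c' (t : T) : N.-tuple R := tzero N.
  have mc' : measurable_fun [set: T] c' by exact: measurable_cst.
  exists dT, T, P, (fun t => linear_path Psi (c' t)); split.
    apply: (gaussian_process_linear_path mPsi Psi_le b0 (mc := mc')).
    apply: is_gauss_eq (is_gauss_dirac0 N) => C mC.
    rewrite [LHS]/= diracE (lawE P mc').
    have [Ct|Ct] := pselect (C (tzero N)).
      rewrite mem_set// (_ : c' @^-1` C = setT); last by apply/seteqP; split.
      exact/esym/probability_setT.
    rewrite memNset// (_ : c' @^-1` C = set0); last by apply/seteqP; split.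
    by apply/esym; exact: measure0.
  pose f t := b * enorm (S t).
  have mf : measurable_fun [set: T] f by apply: measurable_funM => //; exact: measurable_enorm_comp.
  have H : (\int[P]_t (f t)%:E <= (b * (5 * K ^+ 2 * B))%:E)%E.
    rewrite /f; under eq_integral do rewrite EFinM.
    rewrite ge0_integralZlT//; last 2 first.
    - by apply/measurable_EFinP; exact: measurable_enorm_comp.
    - by move=> t; rewrite lee_fin enorm_ge0.
    rewrite (EFinM b) lee_wpmul2l ?lee_fin//.
    apply: (le_trans (int_enorm _ _ _ _ _ mS (mom2_signed_sum nw mY0 alK))).
    rewrite lee_fin al2 mulVKf ?gt_eqF//.
    have h1 : K * NN / B <= K * B.
      by rewrite ler_pdivrMr// -[leRHS]mulrA -expr2 ler_wpM2l// ltW.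
    have h2 : K * B <= K ^+ 2 * B by rewrite ler_wpM2r// ltW.
    have h3 : B <= K ^+ 2 * B by rewrite ler_peMl// ltW.
    by move: B0 h1 h2 h3; rewrite -(mulrA 5); move: (_ / B) (K ^+ 2 * B) (K * B) => x y z; lra.
  apply: le_trans (WF_infty_sqr_le mPsi Psi_le b0 n0 (pr := id) mS _ mc' mf _ _ H) _ => //.
  - move=> t x sx; apply: (le_trans (path_err _ _ sx)); rewrite /f.
    rewrite (_ : tsub (S t) (c' t) = S t)//.
    by apply: eq_from_tnth => i; rewrite !tE; ring.
  - by rewrite lee_fin fin// !mulr_ge0// ?sqr_ge0 ?(ltW B0).
pose sig := step_sqr NN B k%:R.
pose r := Num.sqrt NN.
have r0 : 0 < r by rewrite sqrtr_gt0.
have r2 : r ^+ 2 = NN by rewrite sqr_sqrtr// ltW.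
(* The noise level: ep E|Z| is of order B since the dimension [N] is at most K r^2. *)
pose ep := B / r.
have ep0 : 0 < ep by rewrite divr_gt0.
(* The size of a summand in units of the noise, with [al = ep * a] and [a ^+ 2 = sig]. *)
pose a := al * r / B.
have a2 : a ^+ 2 = sig.
  by rewrite /a expr_div_n exprMn al2 r2 /sig /step_sqr; field; rewrite !gt_eqF.
have epa : ep * a = al by rewrite /a /ep; field; rewrite !gt_eqF.
have sig0 : 0 <= sig by rewrite -a2 sqr_ge0.
(* Truncation exactly where the chi-square bound applies to the rescaled summand. *)
pose chi v := a ^+ 2 * dot (phi v) (phi v) <= 2^-1.
have mchi : measurable_fun [set: n.-tuple R] chi.
  apply: measurable_fun_ler => //; apply: measurable_funM => //.
  exact: measurable_dot.
(* The kept part is rescaled to noise units, the discarded part [za] keeps its scale [al], so S = ep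
   * (sum of Y) + (sum of Z), as [SE] records. *)
pose ya v := if chi v then a else 0.
pose za v := if chi v then 0 else al.
pose Y v := tscale (ya v) (phi v).
pose Z v := tscale (za v) (phi v).
have mY : measurable_fun [set: n.-tuple R] Y.
  by apply: measurable_tscale => //; exact: measurable_fun_ifT.
have mZ : measurable_fun [set: n.-tuple R] Z.
  by apply: measurable_tscale => //; exact: measurable_fun_ifT.
have dotY v v' : dot (Y v) (Y v') = ya v * ya v' * dot (phi v) (phi v').
  by rewrite /Y dotZl dotZr mulrA.
have phi0 v : 0 <= dot (phi v) (phi v) by exact: dot_ge0.
have mdphi : measurable_fun [set: n.-tuple R] (fun v => dot (phi v) (phi v)).
  exact: measurable_dot.
have h1 v : dot (Y v) (Y v) <= 2^-1.
  rewrite dotY /ya; case: ifP => [|_]; first by rewrite /chi expr2.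
  by rewrite mul0r mul0r invr_ge0.
have h3 : (\int[sg]_v (dot (Y v) (Y v))%:E <= (sig * (K * NN))%:E)%E.
  apply: (@le_trans _ _ (\int[sg]_v (sig%:E * (dot (phi v) (phi v))%:E))%E).
    apply: ge0_le_integralT.
    - by apply/measurable_EFinP; exact: measurable_dot.
    - by apply: emeasurable_funM => //; exact/measurable_EFinP.
    - by move=> v; rewrite lee_fin dot_ge0.
    - move=> v; rewrite -EFinM lee_fin dotY ler_wpM2r// -a2 /ya; case: ifP => _.
        by rewrite expr2.
      by rewrite mul0r sqr_ge0.
  rewrite ge0_integralZlT//; last exact/measurable_EFinP.
  by rewrite (EFinM sig) lee_wpmul2l ?lee_fin//; exact: feat_mom2.
have h2 : (\int[sg]_v \int[sg]_v' (dot (Y v) (Y v') ^+ 4)%:E <= (sig ^+ 4 * (K * NN ^+ 2))%:E)%E.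
  have p4 (x : R) : (0 <= (x ^+ 4)%:E)%E by rewrite lee_fin (exprM x 2 2) sqr_ge0.
  have s4 : 0 <= sig ^+ 4 by rewrite exprn_ge0.
  have mf2 (F : n.-tuple R -> N.-tuple R) : measurable_fun [set: n.-tuple R] F ->
      measurable_fun [set: n.-tuple R * n.-tuple R] (fun z => (dot (F z.1) (F z.2) ^+ 4)%:E).
    move=> mF; apply/measurable_EFinP; apply: measurable_funX; apply: measurable_dot.
      exact: measurableT_comp mF measurable_fst.
    exact: measurableT_comp mF measurable_snd.
  have tp (F : n.-tuple R -> N.-tuple R) (mF : measurable_fun [set: n.-tuple R] F) :=
    @tonelli_prod R _ _ _ _ sg sg (fun v w => (dot (F v) (F w) ^+ 4)%:E) (mf2 F mF) (fun _ _ => p4 _).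
  rewrite -(tp Y mY).
  apply: (@le_trans _ _ (\int[(sg \x sg)%E]_z ((sig ^+ 4)%:E * (dot (phi z.1) (phi z.2) ^+ 4)%:E))%E).
    apply: ge0_le_integralT.
    - exact: mf2.
    - by apply: emeasurable_funM => //; exact: mf2.
    - by move=> z; exact: p4.
    - move=> z; rewrite -EFinM lee_fin dotY exprMn -a2; apply: ler_wpM2r.
        by rewrite (exprM _ 2 2) sqr_ge0.
      rewrite /ya; case: ifP => _; case: ifP => _; rewrite ?(mul0r, mulr0) ?expr2// expr0n/=.
      + by rewrite exprn_ge0 -?expr2 ?sqr_ge0.
      + by rewrite exprn_ge0 -?expr2 ?sqr_ge0.
      + by rewrite exprn_ge0 -?expr2 ?sqr_ge0.
  rewrite (@ge0_integralZlT _ _ _ (sg \x sg)%E _ (fun z => (dot (phi z.1) (phi z.2) ^+ 4)%:E) s4); last 2 first.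
  - exact: mf2.
  - by move=> z; exact: p4.
  rewrite (tp phi mphi) (EFinM (sig ^+ 4)) lee_wpmul2l ?lee_fin//.
  exact: feat_dot4.
(* Markov's argument: off [chi] one has 1 < 2 sig |phi|^2, so |phi|^2 is at most 2 sig |phi|^4. *)
have Zb : (\int[sg]_v (dot (Z v) (Z v))%:E <= (al ^+ 2 * (2 * sig * K * NN ^+ 2))%:E)%E.
  have c0 : 0 <= al ^+ 2 * (2 * sig) by rewrite mulr_ge0 ?sqr_ge0// mulr_ge0.
  apply: (@le_trans _ _ (\int[sg]_v ((al ^+ 2 * (2 * sig))%:E * (dot (phi v) (phi v) ^+ 2)%:E))%E).
    apply: ge0_le_integralT.
    - by apply/measurable_EFinP; exact: measurable_dot.
    - by apply: emeasurable_funM => //; apply/measurable_EFinP; exact: measurable_funX.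
    - by move=> v; rewrite lee_fin dot_ge0.
    - move=> v; rewrite -EFinM lee_fin /Z dotZl dotZr mulrA /za.
      case: ifPn => [_|]; first by rewrite mul0r mul0r mulr_ge0// sqr_ge0.
      rewrite /chi a2 -ltNge => hv; rewrite -(expr2 al) -[leRHS]mulrA ler_wpM2l ?sqr_ge0//.
      by have := phi0 v; move: hv; set x := dot _ _ => hv x0; nra.
  rewrite (@ge0_integralZlT _ _ _ sg _ (fun v => (dot (phi v) (phi v) ^+ 2)%:E) c0); last 2 first.
  - by apply/measurable_EFinP; exact: measurable_funX.
  - by move=> v; rewrite lee_fin sqr_ge0.
  rewrite (_ : al ^+ 2 * (2 * sig * K * NN ^+ 2) = al ^+ 2 * (2 * sig) * (K * NN ^+ 2)); last by ring.
  by rewrite (EFinM (al ^+ 2 * (2 * sig))) lee_wpmul2l ?lee_fin//; exact: feat_mom4.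
(* The square root of the fourth moment sig^4 K NN^2, up to powers of K: the factor 11/18 K is
   absorbed by K^2. *)
pose eta := sig ^+ 2 * K * NN.
pose lam := 2 * K * NN / B.
have sigp : 0 < sig by rewrite divr_gt0// mulr_gt0// exprn_gt0.
have h4 : 0 <= sig * (K * NN) by exact: mulr_ge0 sig0 (mulr_ge0 (ltW K0) (ltW NN0)).
have h5 : 0 < eta by rewrite mulr_gt0// mulr_gt0// exprn_gt0.
have h6 : 0 < lam by rewrite divr_gt0// mulr_gt0// mulr_gt0.
have h7 : 11 / 18 * (sig ^+ 4 * (K * NN ^+ 2)) <= eta ^+ 2.
  rewrite (_ : eta ^+ 2 = K ^+ 2 * (sig ^+ 4 * NN ^+ 2)); last by rewrite /eta; ring.
  rewrite (_ : 11 / 18 * _ = 11 / 18 * K * (sig ^+ 4 * NN ^+ 2)); last by ring.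
  apply: ler_wpM2r; first exact: mulr_ge0 (exprn_ge0 4 sig0) (sqr_ge0 NN).
  by apply: le_trans KK2; have := K1; move: K => x; lra.
have NK : N%:R <= K * NN by exact: card_monomial_le.
have h8 : k%:R * (sig * (K * NN)) + N%:R <= lam ^+ 2.
  exact: lambda_param.
have [dT' [T' [P' [pr [V [mV [mpr prE gV cost _]]]]]]] :=
  signed_clt nw mY h1 h2 h3 h4 h5 h6 h7 h8.
pose c' t : N.-tuple R := tscale ep (V t).
have mc' : measurable_fun [set: T'] c' by exact: measurable_tscale.
exists dT', T', P', (fun t => linear_path Psi (c' t)); split.
  apply: (gaussian_process_linear_path mPsi Psi_le b0 (mc := mc')).
  have E z : affine ep%:M (tzero N) z = tscale ep z.
    apply: eq_from_tnth => i; rewrite tnth_mktuple !tE add0r (bigD1 i)//= mxE eqxx mulr1n.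
    by rewrite big1 ?addr0// => j ji; rewrite mxE eq_sym (negbTE ji) mul0r.
  apply: is_gauss_eq (is_gauss_affine ep%:M (tzero N) gV) => C mC.
  rewrite (lawE _ (measurable_affine ep%:M (tzero N))) (lawE P' mV) (lawE P' mc').
  by congr (P' _); apply/seteqP; split => t /=; rewrite E.
have SE t : S t = tadd (tscale ep (signed_sum w s Y t)) (signed_sum w s Z t).
  apply: eq_from_tnth => i; rewrite !tE !tnth_mktuple mulr_sumr -big_split/=.
  apply: eq_bigr => j _; rewrite /signed /Y0 /Y /Z !tE /ya /za.
  by case: ifP => _; rewrite -epa; ring.
pose f t := b * (ep * enorm (tsub (signed_sum w s Y (pr t)) (V t)) + enorm (signed_sum w s Z (pr t))).
have mSY := measurable_signed_sum nw mY.
have mSZ := measurable_signed_sum nw mZ.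
have mf1 : measurable_fun [set: T'] (fun t => enorm (tsub (signed_sum w s Y (pr t)) (V t))).
  apply: measurable_enorm_comp; apply: measurable_tsub => //.
  exact: measurableT_comp mSY mpr.
have mf2 : measurable_fun [set: T'] (fun t => enorm (signed_sum w s Z (pr t))).
  by apply: measurable_enorm_comp; exact: measurableT_comp mSZ mpr.
have mf : measurable_fun [set: T'] f.
  by apply: measurable_funM => //; apply: measurable_funD => //; exact: measurable_funM.
have Zint : (\int[P']_t (enorm (signed_sum w s Z (pr t)))%:E <= (((2 * K * B ^+ 2) / B + B) / 2)%:E)%E.
  have mZp : measurable_fun [set: T'] (signed_sum w s Z \o pr) by exact: measurableT_comp.
  apply: (int_enorm _ _ P' _ _ mZp).
  have mdd : measurable_fun [set: T] (fun t => (dot (signed_sum w s Z t) (signed_sum w s Z t))%:E).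
    by apply/measurable_EFinP; exact: measurable_dot.
  have -> : (\int[P']_t (dot ((signed_sum w s Z \o pr) t) ((signed_sum w s Z \o pr) t))%:E =
      \int[P]_t (dot (signed_sum w s Z t) (signed_sum w s Z t))%:E)%E.
    rewrite -(@ge0_integral_law R _ _ _ _ P' pr mpr (fun t => (dot (signed_sum w s Z t) (signed_sum w s Z t))%:E)).
    - by apply: eq_measure_integral => C mC _; apply: (etrans (lawE P' mpr C)); exact: prE.
    - exact: mdd.
    - by move=> t; rewrite lee_fin dot_ge0.
  apply: (le_trans (mom2_signed_sum nw mZ Zb)).
  rewrite lee_fin al2 mulVKf ?gt_eqF//.
  exact: (remainder_param K1 NN1 q0 qN B0 kR kE NB).
have H : (\int[P']_t (f t)%:E <= (b * (5 * K ^+ 2 * B))%:E)%E.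
  have f10 t : (0 <= (ep * enorm (tsub (signed_sum w s Y (pr t)) (V t)))%:E)%E.
    by rewrite lee_fin mulr_ge0 ?enorm_ge0// ltW.
  have f20 t : (0 <= (enorm (signed_sum w s Z (pr t)))%:E)%E by rewrite lee_fin enorm_ge0.
  rewrite /f; under eq_integral do rewrite (EFinM b) EFinD.
  rewrite (@ge0_integralZlT _ _ _ P' b (fun t => (ep * enorm (tsub (signed_sum w s Y (pr t)) (V t)))%:E + (enorm (signed_sum w s Z (pr t)))%:E)%E b0); last 2 first.
  - by apply: emeasurable_funD; apply/measurable_EFinP => //; exact: measurable_funM.
  - by move=> t; rewrite adde_ge0.
  rewrite (EFinM b) lee_wpmul2l ?lee_fin//.
  rewrite ge0_integralDT//; last 2 first.
  - by apply/measurable_EFinP; exact: measurable_funM.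
  - exact/measurable_EFinP.
  have I1 : (\int[P']_t (ep * enorm (tsub (signed_sum w s Y (pr t)) (V t)))%:E <=
      ((K + 2 * K ^+ 2) * B)%:E)%E.
    under eq_integral do rewrite EFinM.
    rewrite ge0_integralZlT ?(ltW ep0)//; last 2 first.
    - exact/measurable_EFinP.
    - by move=> t; rewrite lee_fin enorm_ge0.
    apply: (@le_trans _ _ (ep%:E * (K * r + k%:R * eta * lam)%:E)%E).
      rewrite lee_wpmul2l ?lee_fin ?(ltW ep0)//; apply: (le_trans cost).
      rewrite lee_fin lerD2r -(@ler_pXn2r _ 2) ?nnegrE ?sqrtr_ge0 ?mulr_ge0 ?(ltW K0) ?(ltW r0)//.
      rewrite sqr_sqrtr// exprMn r2; apply: (le_trans NK).
      by rewrite ler_wpM2r// ltW.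
    rewrite -EFinM lee_fin.
    exact: (error_param K1 NN1 q0 qN B0 kR kE NB r2 r0 (erefl ep)).
  (* The total is (2 K^2 + 2 K + 1/2) B, and K >= 1. *)
  apply: (le_trans (leeD I1 Zint)); rewrite -EFinD lee_fin.
  have -> : 2 * K * B ^+ 2 / B = 2 * K * B by field; rewrite gt_eqF.
  have g2 : K * B <= K ^+ 2 * B by rewrite ler_wpM2r// ltW.
  have g3 : B <= K ^+ 2 * B by rewrite ler_peMl// ltW.
  by move: B0 g2 g3; rewrite mulrDl -!mulrA; move: (K ^+ 2 * B) (K * B) => x y; lra.
apply: (le_trans (WF_infty_sqr_le mPsi Psi_le b0 n0 mS mpr mc' mf prE _ H)).
  move=> t x sx; apply: (le_trans (path_err _ _ sx)); rewrite /f ler_wpM2l//.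
  have -> : tsub (S (pr t)) (c' t) =
      tadd (tscale ep (tsub (signed_sum w s Y (pr t)) (V t))) (signed_sum w s Z (pr t)).
    by rewrite SE /c'; apply: eq_from_tnth => i; rewrite !tE; ring.
  by apply: (le_trans (ler_enormD _ _)); rewrite enormZ gtr0_norm.
by rewrite lee_fin fin// !mulr_ge0// ?sqr_ge0 ?(ltW B0).
Qed.

End polynomial_network.

(** * Size of the constant and conclusion *)

Lemma fact_leq_expn m q : (m <= q)%N -> (m`! <= q ^ m)%N.
Proof.
elim: m => [//|m IH] mq; rewrite factS expnS leq_mul//.
by apply: IH; exact: ltnW.
Qed.

(** For d >= 2 every numerical factor is a power of [d]: 4 <= d^2, (d+1)^4 <= d^8, (4d)! <=
    (4d)^(4d) <= d^(12d) and 16^d <= d^(4d), so [moment_cst] is at most d^(16d+10). *)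
Lemma moment_cst_le {R : realType} d : (1 < d)%N ->
  d.+1%:R * 25 * @moment_cst R d ^+ 4 <= d%:R `^ (88 * d%:R).
Proof.
move=> d1.
have d0 : (0 < d)%N by exact: ltnW.
have pow e : (2 ^ e <= d ^ e)%N.
  by case: e => [|e]; [rewrite !expn0|rewrite leq_exp2r].
have dS : (d.+1 <= d ^ 2)%N.
  by rewrite -mulnn; apply: (@leq_trans (2 * d)); [rewrite mul2n -addnn -add1n leq_add2r|rewrite leq_mul2r d1 orbT].
pose Kn := (4 * d.+1 ^ 4 * (4 * d)`! * 16 ^ d)%N.
have -> : @moment_cst R d = Kn%:R by rewrite /Kn !natrM !natrX.
rewrite (_ : 88 * d%:R = (88 * d)%N%:R); last by rewrite natrM.
rewrite powR_mulrn// -!natrX -!natrM ler_nat.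
have e1 : (d.+1 ^ 4 <= d ^ 8)%N by rewrite (expnM d 2 4) leq_exp2r.
have e2 : ((4 * d)`! <= d ^ (12 * d))%N.
  apply: (leq_trans (fact_leq_expn (leqnn _))).
  rewrite (_ : 12 * d = 3 * (4 * d))%N; last by rewrite mulnA.
  rewrite (expnM d 3) leq_exp2r ?muln_gt0//.
  by rewrite expnSr leq_mul2r (leq_trans _ (pow 2%N)) ?orbT.
have e3 : (16 ^ d <= d ^ (4 * d))%N by rewrite (expnM d 4) leq_exp2r//; exact: (pow 4%N).
have e4 : (Kn <= d ^ (16 * d + 10))%N.
  rewrite (_ : 16 * d + 10 = 2 + 8 + 12 * d + 4 * d)%N; last first.
    by rewrite -addnA -mulnDl addnC.
  have h4 : (4 <= d ^ 2)%N by exact: (pow 2%N).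
  rewrite (expnD d _ (4 * d)) (expnD d _ (12 * d)) (expnD d 2 8).
  exact: (leq_mul (leq_mul (leq_mul h4 e1) e2) e3).
apply: (@leq_trans (d ^ 2 * d ^ 5 * (d ^ (16 * d + 10)) ^ 4)%N).
  rewrite !leq_mul ?leq_exp2r//.
  by apply: (leq_trans _ (pow 5%N)).
rewrite -expnM -!expnD leq_exp2l// mulnDl.
(* The exponent is 64 d + 47, with 7 of it from (d+1) * 25, and 47 <= 48 <= 24 d; hence 88 = 64 +
   24. *)
apply: (@leq_trans (64 * d + 24 * d)); last by rewrite -mulnDl.
rewrite addnCA (_ : 16 * d * 4 = 64 * d)%N ?leq_add2l; last by rewrite mulnAC.
by apply: (@leq_trans (24 * 2)); rewrite ?leq_mul2l.
Qed.
Theorem theorem1 (R : realType) :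
  exists C : R, 0 < C /\
  exists Cd : nat -> R,
    (forall d : nat, (0 < d)%N -> Cd d <= d%:R `^ (C * d%:R)) /\
    forall (n k d : nat) (p : {poly R})
      (disp : measure_display) (T : measurableType disp) (P : probability T R)
      (w : 'I_k -> T -> n.-tuple R) (s : 'I_k -> T -> R),
      (1 < n)%N -> (0 < k)%N -> (0 < d)%N -> size p = d.+1 ->
      network_weights P w s ->
      exists (disp' : measure_display) (T' : measurableType disp')
        (P' : probability T' R) (G : T' -> sample_path n),
        gaussian_process P' G /\
        (WF_infty P (network w s (horner p)) P' G ^+ 2 <=
          (Cd d * \big[Num.max/0]_(m < d.+1) (`|p`_m| ^+ 2) *
             (n%:R `^ (5 * d%:R - 2^-1) / k%:R) `^ 3^-1)%:E)%E.
Proof.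
exists 88; split => //.
(* At d = 1 the bound d^(Cd) is 1 whatever the exponent, so degree one gets the constant 1. *)
exists (fun d => if d == 1%N then 1 else d.+1%:R * 25 * moment_cst d ^+ 4); split.
  move=> d d0; have [->|d1] := eqVneq d 1%N; first by rewrite powR1.
  by apply: moment_cst_le; rewrite ltn_neqAle eq_sym d1.
move=> n k d p disp T P w s n1 k0 d0 sp nw.
set A := \big[_/_]_(_ < _) _.
have pA (m : 'I_d.+1) : p`_m ^+ 2 <= A.
  by rewrite -real_normK ?num_real// /A; apply: (le_bigmax _ (fun m : 'I_d.+1 => `|p`_m| ^+ 2)).
have [d1|d1] := eqVneq d 1%N; last exact: polynomial_network_clt.
subst d; rewrite mul1r; apply: linear_network_clt => //; exact: (pA ord0).
Qed.
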